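(* Let $\mathrm{A}(\mathbb{D})$ be the disc algebra. The following statements hold. (1) There exist two RFD $\mathrm{C}^*$-covers $[\mathcal{B},\iota]$, $[\mathcal{C},j]$ for $\mathrm{A}(\mathbb{D})$ such that the meet $[\mathcal{B},\iota]\wedge[\mathcal{C},j]$ in $\text{C}^*\text{-Lat}(\mathrm{A}(\mathbb{D}))$ is not an RFD $\mathrm{C}^*$-cover for $\mathrm{A}(\mathbb{D})$. (2) There exists a totally ordered chain of distinct RFD $\mathrm{C}^*$-covers $[\mathcal{B}_k,\iota_k]$ for $\mathrm{A}(\mathbb{D})$ whose meet in $\text{C}^*\text{-Lat}(\mathrm{A}(\mathbb{D}))$ is not an RFD $\mathrm{C}^*$-cover. In particular, the set of residually finite-dimensional $\mathrm{C}^*$-covers for $\mathrm{A}(\mathbb{D})$ is not a lattice under the operations of $\text{C}^*\text{-Lat}(\mathrm{A}(\mathbb{D}))$ (it is not closed under the binary meet of $\text{C}^*\text{-Lat}(\mathrm{A}(\mathbb{D}))$).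
   Context: The disc algebra $\mathrm{A}(\mathbb{D})\subset C(\overline{\mathbb{D}})$ is the algebra of continuous functions on the closed unit disc that are holomorphic on the open disc. **$\mathrm{C}^*$-covers.** Let $\mathcal{A}$ be an operator algebra. A $\mathrm{C}^*$-cover of $\mathcal{A}$ is a pair $(\mathcal{B},\iota)$ with $\mathcal{B}$ a $\mathrm{C}^*$-algebra and $\iota:\mathcal{A}\to\mathcal{B}$ a completely isometric homomorphism with $\mathrm{C}^*(\iota(\mathcal{A}))=\mathcal{B}$. A morphism $\pi:(\mathcal{D},j)\to(\mathcal{B},\iota)$ is a $*$-homomorphism with $\pi j=\iota$; write $(\mathcal{B},\iota)\preceq(\mathcal{D},j)$ if one exists. Two covers are equivalent if each is $\preceq$ the other; $[\mathcal{B},\iota]$ denotes the equivalence class. The set $\text{C}^*\text{-Lat}(\mathcal{A})$ of equivalence classes is a complete lattice under $\preceq$. The meet of a nonempty family $\{[\mathcal{B}_i,\iota_i]\}$ is its greatest lower bound, represented by $[\mathrm{C}^*_{\max}(\mathcal{A})/\mathcal{J},q\mu]$, where $(\mathrm{C}^*_{\max}(\mathcal{A}),\mu)$ is the maximal $\mathrm{C}^*$-cover, $\mathcal{J}=\overline{\sum_i\ker\pi_i}$ for the unique morphisms $\pi_i:(\mathrm{C}^*_{\max}(\mathcal{A}),\mu)\to(\mathcal{B}_i,\iota_i)$, and $q$ is the quotient map. **RFD.** A $\mathrm{C}^*$-algebra is residually finite-dimensional (RFD) if it embeds by an injective $*$-homomorphism into some product $\prod_\lambda M_{r_\lambda}$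 of matrix algebras. A $\mathrm{C}^*$-cover $[\mathcal{B},\iota]$ is RFD if $\mathcal{B}$ is RFD. *)

(* Defs.v *)
From HB Require Import structures.
From mathcomp Require Import all_boot all_order all_algebra complex.
From mathcomp Require Import all_classical all_reals all_analysis.

Set Implicit Arguments.
Unset Strict Implicit.
Unset Printing Implicit Defensive.

Import Order.TTheory GRing.Theory Num.Theory.
Import numFieldNormedType.Exports.
Import Normc.

Set Warnings "-redundant-canonical-projection,-projection-no-head-constant".

Local Open Scope classical_set_scope.
Local Open Scope ring_scope.
Local Open Scope complex_scope.

HB.instance Definition _ (R : realType) := NormedModule.copy R[i] R[i]^o.

(* C*-algebras are not assumed to be unital, hence the multiplication is not
   that of a MathComp ring.  The norm takes its values in the nonnegative reals
   of [R[i]], and [k^*] is the complex conjugate of [k]. *)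
Record cstarAlgebra (R : realType) := CStarAlgebra {
  cs_sort :> completeNormedModType R[i] ;
  cs_mul : cs_sort -> cs_sort -> cs_sort ;
  cs_star : cs_sort -> cs_sort ;
  cs_mulA : associative cs_mul ;
  cs_mul_linearl : forall b, linear (cs_mul^~ b) ;
  cs_mul_linearr : forall a, linear (cs_mul a) ;
  cs_norm_mul : forall a b, `|cs_mul a b| <= `|a| * `|b| ;
  cs_starK : involutive cs_star ;
  cs_star_antilinear : forall (k : R[i]) a b,
    cs_star (k *: a + b) = k^* *: cs_star a + cs_star b ;
  cs_star_mul : forall a b, cs_star (cs_mul a b) = cs_mul (cs_star b) (cs_star a) ;
  cs_norm_starM : forall a, `|cs_mul (cs_star a) a| = `|a| ^+ 2
}.

Record star_hom (R : realType) (B C : cstarAlgebra R) (pi : B -> C) : Prop :=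
  StarHom {
    star_hom_linear : linear pi ;
    star_hom_mul : {morph pi : a b / cs_mul a b} ;
    star_hom_star : {morph pi : a / cs_star a}
  }.

Record cstar_subalgebra (R : realType) (B : cstarAlgebra R) (S : set B) : Prop :=
  CStarSubalgebra {
    csub0 : S 0 ;
    csub_linear : forall (k : R[i]) a b, S a -> S b -> S (k *: a + b) ;
    csub_mul : forall a b, S a -> S b -> S (cs_mul a b) ;
    csub_star : forall a, S a -> S (cs_star a) ;
    csub_closed : closed S
  }.

Definition cstar_generated (R : realType) (B : cstarAlgebra R) (G : set B) : set B :=
  smallest (@cstar_subalgebra R B) G.

Definition cs_mulmx (R : realType) (B : cstarAlgebra R) (n : nat)
    (a b : 'M[B]_n) : 'M[B]_n :=
  \matrix_(i, j) \sum_(k < n) cs_mul (a i k) (b k j).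

Definition cs_starmx (R : realType) (B : cstarAlgebra R) (n : nat)
    (a : 'M[B]_n) : 'M[B]_n :=
  \matrix_(i, j) cs_star (a j i).

(* There is exactly one norm with these properties on the *-algebra M_n(B); it
   is the norm of the C*-algebra M_n(B). *)
Record is_cstar_norm (R : realType) (B : cstarAlgebra R) (n : nat)
    (N : 'M[B]_n -> R) : Prop := IsCStarNorm {
  cnorm_eq0 : forall a, N a = 0 -> a = 0 ;
  cnormD : forall a b, N (a + b) <= N a + N b ;
  cnormZ : forall (k : R[i]) a, N (map_mx ( *:%R k) a) = normc k * N a ;
  cnormM : forall a b, N (cs_mulmx a b) <= N a * N b ;
  cnorm_starM : forall a, N (cs_mulmx (cs_starmx a) a) = N a ^+ 2
}.

Definition adjmx (R : realType) (m n : nat) (A : 'M[R[i]]_(m, n)) : 'M[R[i]]_(n, m) :=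
  map_mx (@conjc R) A^T.

Definition eucl_norm (R : realType) (n : nat) (v : 'cV[R[i]]_n) : R :=
  Num.sqrt (\sum_(i < n) normc (v i 0) ^+ 2).

Definition opnorm (R : realType) (n : nat) (A : 'M[R[i]]_n) : R :=
  sup [set eucl_norm (A *m v) | v in [set v : 'cV[R[i]]_n | eucl_norm v <= 1]].

(* [phi] is a *-homomorphism into the C*-algebra of the bounded families of
   the product of the matrix algebras M_(r l + 1). *)
Definition rfd (R : realType) (B : cstarAlgebra R) : Prop :=
  exists (L : Type) (r : L -> nat) (phi : B -> forall l, 'M[R[i]]_((r l).+1)),
    [/\ forall b, exists M : R, forall l, opnorm (phi b l) <= M,
        forall l, linear (phi^~ l),
        forall l, {morph phi^~ l : a b / cs_mul a b >-> a *m b},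
        forall l, {morph phi^~ l : a / cs_star a >-> adjmx a} &
        injective phi].

Definition closed_disc (R : realType) : set R[i] := [set z | `|z| <= 1].
Arguments closed_disc : clear implicits.

(* Holomorphy is complex differentiability, at each point of the open disc, of
   the extension of [f] by 0; it does not depend on that extension. *)
Definition disc_fun (R : realType) : {pred closed_disc R -> R[i]} :=
  fun f => `[< continuous f /\
    forall z : R[i], `|z| < 1 -> derivable (valL_ 0 f : R[i] -> R[i]) z 1 >].

Section DiscAlgebraClosed.
Variable R : realType.
Implicit Types f g : closed_disc R -> R[i].

Let near_ext f (g : R[i] -> R[i]) :
  (forall z, z \in closed_disc R -> valL_ 0 f z = g z) ->
  forall z, `|z| < 1 -> derivable g z 1 ->
  derivable (valL_ 0 f : R[i] -> R[i]) z 1.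
Proof.
move=> fg z z1; apply: near_eq_derivable.
near=> w; apply/esym/fg; rewrite inE /closed_disc/=; apply: ltW.
by near: w; exact: (@cvgr_norm_lt _ _ _ _ _ id _ cvg_id).
Unshelve. all: by end_near. Qed.

Let valLE f z (hz : z \in closed_disc R) : valL_ 0 f z = f (exist _ z hz).
Proof. by rewrite -[f in RHS](@valLK _ _ 0). Qed.

Lemma disc_fun_subring : subring_closed (@disc_fun R).
Proof.
split.
- apply/asboolP; split; first exact: cst_continuous.
  move=> z z1; apply: (@near_ext _ (cst 1)) => //.
  by move=> w hw; rewrite valLE.
- move=> f g /asboolP[cf df] /asboolP[cg dg]; apply/asboolP; split.
    by move=> z; exact: (continuousB (cf z) (cg z)).
  move=> z z1; apply: (@near_ext _ (valL_ 0 f - valL_ 0 g)) => //.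
    by move=> w hw; rewrite !fctE !valLE.
  by apply: derivableB; [exact: df|exact: dg].
- move=> f g /asboolP[cf df] /asboolP[cg dg]; apply/asboolP; split.
    by move=> z; exact: (@continuousM R[i] _ _ _ _ (cf z) (cg z)).
  move=> z z1; apply: (@near_ext _ (valL_ 0 f * valL_ 0 g)) => //.
    by move=> w hw; rewrite !fctE !valLE.
  by apply: derivableM; [exact: df|exact: dg].
Qed.

Lemma disc_fun_scaler : GRing.scaler_closed (@disc_fun R).
Proof.
move=> k f /asboolP[cf df]; apply/asboolP; split.
  by move=> z; exact: (@continuousM R[i] _ (cst k) f z (@cst_continuous _ _ k z) (cf z)).
move=> z z1; apply: (@near_ext _ (k *: (valL_ 0 f : R[i] -> R[i]))) => //.
  by move=> w hw; rewrite !fctE !valLE.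
by apply: derivableZ; exact: df.
Qed.

End DiscAlgebraClosed.

HB.instance Definition _ (R : realType) :=
  GRing.isSubringClosed.Build (closed_disc R -> R[i]) (@disc_fun R)
    (@disc_fun_subring R).

HB.instance Definition _ (R : realType) :=
  GRing.isScaleClosed.Build R[i] (closed_disc R -> R[i]) (@disc_fun R)
    (@disc_fun_scaler R).

Record disc_algebra (R : realType) := DiscAlgebra {
  disc_val :> closed_disc R -> R[i] ;
  disc_valP : disc_val \in @disc_fun R
}.

HB.instance Definition _ (R : realType) := [isSub for @disc_val R].
HB.instance Definition _ (R : realType) := [Choice of disc_algebra R by <:].
HB.instance Definition _ (R : realType) :=
  GRing.SubChoice_isSubComPzRing.Build _ _ (disc_algebra R) (@disc_fun_subring R).
HB.instance Definition _ (R : realType) :=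
  [SubZmodule_isSubLmodule of disc_algebra R by <:].

(* M_n(A(D)) is normed as a subspace of M_n(C(closed disc)), that is, of the
   M_n(C)-valued continuous functions on the closed disc. *)
Definition disc_mxnorm (R : realType) (n : nat) (F : 'M[disc_algebra R]_n) : R :=
  sup [set opnorm (map_mx (fun f : disc_algebra R => f z) F) | z in [set: closed_disc R]].

Definition completely_isometric (R : realType) (B : cstarAlgebra R)
    (j : disc_algebra R -> B) : Prop :=
  forall n, exists2 N : 'M[B]_n -> R,
    is_cstar_norm N & forall F, N (map_mx j F) = disc_mxnorm F.

Record cstar_cover (R : realType) := CStarCover {
  cov_alg :> cstarAlgebra R ;
  cov_map : disc_algebra R -> cov_alg ;
  cov_map_linear : linear cov_map ;
  cov_map_mul : {morph cov_map : f g / f * g >-> cs_mul f g} ;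
  cov_map_isometric : completely_isometric cov_map ;
  cov_map_generates : cstar_generated (range cov_map) = setT
}.

Definition cover_le (R : realType) (X Y : cstar_cover R) : Prop :=
  exists2 pi : Y -> X, star_hom pi & forall f, pi (cov_map Y f) = cov_map X f.

Definition cover_equiv (R : realType) (X Y : cstar_cover R) : Prop :=
  cover_le X Y /\ cover_le Y X.

(* The elements of C*-Lat(A(D)).  Sets of covers and of classes are plain
   predicates because of a universe constraint on the type [set]. *)
Record cstar_lat (R : realType) := CStarLat {
  lat_class : cstar_cover R -> Prop ;
  lat_classP : exists X, lat_class = cover_equiv X
}.

Definition cover_class (R : realType) (X : cstar_cover R) : cstar_lat R :=
  CStarLat (ex_intro _ X erefl).

(* Neither [lat_le] nor [lat_rfd] depends on the choice of the representatives. *)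
Definition lat_le (R : realType) (x y : cstar_lat R) : Prop :=
  exists X Y, [/\ lat_class x X, lat_class y Y & cover_le X Y].

Definition lat_rfd (R : realType) (x : cstar_lat R) : Prop :=
  exists2 X, lat_class x X & rfd X.

Definition is_meet (R : realType) (K : Type) (x : K -> cstar_lat R)
    (m : cstar_lat R) : Prop :=
  (forall k, lat_le m (x k)) /\
  (forall y, (forall k, lat_le y (x k)) -> lat_le y m).

Definition is_join (R : realType) (K : Type) (x : K -> cstar_lat R)
    (m : cstar_lat R) : Prop :=
  (forall k, lat_le (x k) m) /\
  (forall y, (forall k, lat_le (x k) y) -> lat_le m y).

Definition is_meet2 (R : realType) (x y m : cstar_lat R) : Prop :=
  is_meet (fun b : bool => if b then x else y) m.

Definition is_join2 (R : realType) (x y m : cstar_lat R) : Prop :=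
  is_join (fun b : bool => if b then x else y) m.

Definition meet_closed (R : realType) (P : cstar_lat R -> Prop) : Prop :=
  forall x y m, P x -> P y -> is_meet2 x y m -> P m.

Definition join_closed (R : realType) (P : cstar_lat R -> Prop) : Prop :=
  forall x y m, P x -> P y -> is_join2 x y m -> P m.

Definition sublattice (R : realType) (P : cstar_lat R -> Prop) : Prop :=
  meet_closed P /\ join_closed P.

(* Main.v *)
Require Import Defs.
From HB Require Import structures.
From mathcomp Require Import all_boot all_order all_algebra complex.
From mathcomp Require Import all_classical all_reals all_analysis.
From mathcomp Require Import ring lra zify.

(** The covers come from weighted shifts.  On H = l2(N) let x be the compact
weighted shift e_j |-> 2^-j e_(j+1), and let x_n be x with the weights of index
larger than n replaced by 0, so that x_n lives on the first n+2 coordinates and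
x_n -> x in norm.  For a set E of natural numbers consider the family made of
all scalars z in the closed disc, of x_n for n in E, and of x, and let C_E be
the C*-algebra that this family and the identity generate inside the bounded
families of operators.  By von Neumann's inequality every polynomial p satisfies
|p(x_n)| <= sup |p|, also for matrices of polynomials, and the scalars give the
converse inequality; as polynomials are dense in the disc algebra, f |-> f(x)
is a complete isometry and C_E is a C*-cover.  Forgetting fibers gives morphisms
C_E -> C_F for F included in E, so that C_F lies below C_E.  Three facts then
prove the theorem.

(a) If E is infinite then C_E is residually finite-dimensional (rfd_tail): the
fiber at n is a block of size n+2 plus a scalar that is already seen on the
disc, and the fiber at x is the limit of the fibers at n.

(b) C_0, for the empty set, is not (not_rfd_compact).  A fixed *-polynomial in x
is the projection p onto e_0, and x^* x x^j p = 4^-j x^j p.  In a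
finite-dimensional representation this would give infinitely many eigenvalues
unless p is sent to 0.  As p is a *-polynomial in the generator, this applies to
every cover equivalent to C_0.

(c) C_0 is the meet of C_E and C_F for disjoint E and F (pair_glb), and of the
decreasing chain of the C_[k,oo) (chain_glb).  If Y is a common lower bound, the
morphisms into Y combine to one morphism s : C_N -> Y, and it suffices that
|s b| <= |b_0| where b_0 is the image of b in C_0: s then extends along the dense
range of C_N -> C_0 (cover_le_factor).  For the chain this holds since s factors
through C_[k,oo), where the norm of b is at most |b_0| + e for k large.  For two
disjoint sets, s kills every element that is supported on a single fiber n,
because n is missing from E or from F.  The projection P_n onto the first n+2
coordinates of the fiber n belongs to C_N (calg_blockp), so that s does not
change when P_0 b, ..., P_(N-1) b are subtracted from b; what remains of the
first N fibers is a scalar of the disc, and the other fibers are close to that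
of x.

Even and odd numbers give (1); the chain gives (2) after repetitions are
discarded.

Three classical tools are proved on the way: the density of polynomials, by
Fejer means of the Fourier coefficients on circles, which obey Cauchy's theorem
(disc_poly_dense); von Neumann's inequality for weighted shifts, by averaging
over roots of unity (von_neumann); and the contractivity of unital
*-homomorphisms, by averages of unitaries (star_hom_contractive). *)

Set Implicit Arguments.
Unset Strict Implicit.
Unset Printing Implicit Defensive.

Import Order.TTheory GRing.Theory Num.Theory.
Import numFieldNormedType.Exports.
Import Normc.

Local Open Scope classical_set_scope.
Local Open Scope ring_scope.
Local Open Scope complex_scope.

Local Notation Re := (@complex.Re _).
Local Notation Im := (@complex.Im _).

(** * Moduli of complex numbers and the local behaviour of the disc algebra *)

Section Normc.
Variable R : realType.
Implicit Types x y z : R[i].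

Lemma normcEc x : `|x| = (normc x)%:C.
Proof. by []. Qed.

Lemma normc_ge0 x : 0 <= normc x.
Proof. by case: x => a b; rewrite /normc sqrtr_ge0. Qed.

Lemma normcR (r : R) : normc r%:C = `|r|.
Proof. by rewrite /normc /= expr0n addr0 sqrtr_sqr. Qed.

Lemma normcB x y : normc (x - y) = normc (y - x).
Proof. by rewrite -normcN opprB. Qed.

Lemma normcX x n : normc (x ^+ n) = normc x ^+ n.
Proof. by elim: n => [|n IH]; rewrite ?normc1 // !exprS normcM IH. Qed.

Lemma normc_conj x : normc x^* = normc x.
Proof. by case: x => a b; rewrite /normc /= sqrrN. Qed.

Lemma normc_sqr x : normc x ^+ 2 = Re x ^+ 2 + Im x ^+ 2.
Proof. by case: x => a b; rewrite /normc sqr_sqrtr // addr_ge0 // sqr_ge0. Qed.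

Lemma Re_le_normc x : `|Re x| <= normc x.
Proof.
by rewrite -(@ler_pXn2r _ 2) ?nnegrE ?normc_ge0 ?normr_ge0// real_normK ?num_real// normc_sqr lerDl sqr_ge0.
Qed.

Lemma Im_le_normc x : `|Im x| <= normc x.
Proof.
by rewrite -(@ler_pXn2r _ 2) ?nnegrE ?normc_ge0 ?normr_ge0// real_normK ?num_real// normc_sqr lerDr sqr_ge0.
Qed.

Lemma normc_le_ReIm x : normc x <= `|Re x| + `|Im x|.
Proof.
rewrite -(@ler_pXn2r _ 2) ?nnegrE ?normc_ge0 ?addr_ge0// normc_sqr sqrrD.
by rewrite !real_normK ?num_real// [leRHS]addrAC lerDl mulrn_wge0.
Qed.

Lemma normc_sum (I : Type) (r : seq I) (P : pred I) (F : I -> R[i]) :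
  normc (\sum_(i <- r | P i) F i) <= \sum_(i <- r | P i) normc (F i).
Proof.
elim/big_ind2: _ => [|x y u v h1 h2|//]; first by rewrite normc0.
by apply: le_trans (le_normcD _ _) _; exact: lerD.
Qed.

Lemma normc_triangle x y z : normc (x - z) <= normc (x - y) + normc (y - z).
Proof. by rewrite (_ : x - z = (x - y) + (y - z)) ?le_normcD//; ring. Qed.

Lemma cpos (e : R[i]) : 0 < e -> exists2 d : R, 0 < d & e = d%:C.
Proof.
case: e => a b; rewrite ltcE /= => /andP[/eqP -> a0]; by exists a.
Qed.

End Normc.

Section DiscElem.
Variable R : realType.
Variable f : disc_algebra R.
Let g : R[i] -> R[i] := valL_ 0 (f : closed_disc R -> R[i]).

Lemma disc_extE z (hz : z \in closed_disc R) : g z = f (exist _ z hz).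
Proof. by rewrite /g; move: (f : _ -> _) => h; rewrite -[h in RHS](@valLK _ _ 0). Qed.

(** The extension by 0 is only a device: inside the disc it has a complex
derivative, stated with explicit bounds that can be composed by hand. *)
Lemma disc_ext_diff z : normc z < 1 -> exists A, forall e, 0 < e ->
  exists2 d, 0 < d & forall w, normc (w - z) < d ->
    normc (g w - g z - A * (w - z)) <= e * normc (w - z).
Proof.
move=> z1; have /asboolP[_ df] := disc_valP f.
have {df} : derivable (g : R[i] -> R[i]) z 1 by apply: df; rewrite normcEc ltcR.
move/cvg_ex => [A /= hA]; exists A => e e0.
move/cvgrPdist_le : hA => /(_ e%:C); rewrite ltcR => /(_ e0).
rewrite near_withinE => /nbhs_normP[_ /cpos[d d0 ->] hd].
exists d => // w wz; have [->|wz0] := eqVneq w z.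
  by rewrite !subrr mulr0 subrr normc0 mulr0.
have wz' : w - z != 0 by rewrite subr_eq0.
have := hd (w - z); rewrite /= sub0r normrN normcEc ltcR => /(_ wz wz').
rewrite [_%:A]mulr1 subrK [_ *: _]/(_ * _) normcEc lecR => h.
rewrite (_ : _ - A * _ = - (w - z) * (A - (w - z)^-1 * (g w - g z))); last by field.
by rewrite normcM normcN mulrC ler_wpM2r ?normc_ge0.
Qed.

Lemma disc_ext_cont z : normc z <= 1 -> forall e, 0 < e ->
  exists2 d, 0 < d & forall w, normc w <= 1 -> normc (w - z) < d ->
    normc (g w - g z) < e.
Proof.
move=> z1 e e0; have /asboolP[cf _] := disc_valP f.
have hz : z \in closed_disc R by rewrite inE /closed_disc /= normcEc lecR.
have /cvgrPdist_lt/(_ e%:C) := cf (exist _ z hz).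
rewrite ltcR => /(_ e0); rewrite nbhsE => -[B [] oB Bz Bsub].
case: oB => O oO Of.
have : O z by move: Bz; rewrite -Of.
move: oO; rewrite openE => /[apply] /nbhs_normP[_ /cpos[d d0 ->] hd].
exists d => // w w1 wz.
have hw : w \in closed_disc R by rewrite inE /closed_disc /= normcEc lecR.
have := Bsub (exist _ w hw); rewrite -Of /= => /(_ _).
rewrite (disc_extE hz) (disc_extE hw) normcEc ltcR normcB; apply.
by apply: hd; rewrite /= normcEc ltcR normcB.
Qed.
End DiscElem.

(** * Compactness of the closed disc and the complex exponential *)

Section SmallTerms.
Variable R : realType.

Lemma small_natSinv (e : R) : 0 < e -> exists N, forall n, (N <= n)%N -> n.+1%:R^-1 <= e.
Proof.
move=> ep; have [N _ hN] := near_infty_natSinv_lt (PosNum ep).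
by exists N => n /hN /= /ltW.
Qed.

Lemma small_expr (q e : R) : 0 <= q < 1 -> 0 < e ->
  exists N, forall n, (N <= n)%N -> q ^+ n <= e.
Proof.
move=> /andP[q0 q1] e0; have : (fun n => q ^+ n) @ \oo --> (0 : R).
  by apply: cvg_expr; rewrite ger0_norm.
move=> /cvgrPdist_le/(_ _ e0)[N _ hN]; exists N => n /hN /=.
by rewrite sub0r normrN ger0_norm// exprn_ge0.
Qed.

Lemma half01 : 0 <= (2^-1 : R) < 1.
Proof. by rewrite invr_ge0 ler0n invf_lt1// ltr1n. Qed.
End SmallTerms.

Section UltraLimit.
Variable R : realType.

(** Limits along an ultrafilter finer than the cofinite one replace the
extraction of subsequences and commute with finite sums and scalings. *)
Lemma ex_ultra_nat : exists2 U : set_system nat, UltraFilter U & \oo `<=` U.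
Proof. by have [U [UU sU]] := ultraFilterLemma (_ : ProperFilter \oo); exists U. Qed.

Variable U : set_system nat.
Hypothesis UU : UltraFilter U.

Lemma ultra_fmap (T : Type) (z : nat -> T) : UltraFilter (z @ U).
Proof.
apply: Build_UltraFilter => G GG sG; apply/seteqP; split => A; last exact: sG.
move=> GA; have [//|nA] := in_ultra_setVsetC (z @^-1` A) UU.
have GnA : G (~` A) by apply: sG; rewrite /= /fmap /= preimage_setC.
by have /filter_ex[x []] : G (A `&` ~` A) by exact: filterI.
Qed.

Lemma ulim_exR (z : nat -> R) (M : R) : (forall n, `|z n| <= M) ->
  exists p, forall d, 0 < d -> U (fun n => `|z n - p| < d).
Proof.
move=> zM; have := @segment_compact R (- M) M; rewrite compact_ultra.
move=> /(_ _ (ultra_fmap z)) [].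
  by apply: (@filterE _ U _) => n /=; rewrite in_itv /= -ler_norml.
move=> p [_ zp]; exists p => d d0.
have : nbhs p [set y | `|y - p| < d].
  by apply/nbhs_normP; exists d => //= y; rewrite /= distrC.
by move/zp.
Qed.

Lemma ulim_exC (z : nat -> R[i]) (M : R) : (forall n, normc (z n) <= M) ->
  exists p, forall d, 0 < d -> U (fun n => normc (z n - p) < d).
Proof.
move=> zM.
have [a ha] := @ulim_exR (fun n => Re (z n)) M (fun n => le_trans (Re_le_normc _) (zM n)).
have [b hb] := @ulim_exR (fun n => Im (z n)) M (fun n => le_trans (Im_le_normc _) (zM n)).
exists (a +i* b) => d d0.
have d2 : 0 < d / 2 by rewrite divr_gt0.
apply: filterS (filterI (ha _ d2) (hb _ d2)) => n [h1 h2].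
apply: le_lt_trans (normc_le_ReIm _) _; rewrite [ltRHS](splitr d).
by move: h1 h2; case: (z n) => x y /= h1 h2; exact: ltrD.
Qed.

End UltraLimit.

Section DiscUnif.
Variable R : realType.
Variable f : disc_algebra R.
Let g : R[i] -> R[i] := valL_ 0 (f : closed_disc R -> R[i]).

(** Uniform continuity on the compact disc: pairs of points that contradict it
have a common limit along an ultrafilter, where continuity fails. *)
Lemma disc_ext_unif e : 0 < e -> exists2 d, 0 < d & forall z w,
  normc z <= 1 -> normc w <= 1 -> normc (z - w) < d -> normc (g z - g w) < e.
Proof.
move=> e0; apply: contrapT => hN.
have {hN} h n : exists zw : R[i] * R[i], [/\ normc zw.1 <= 1, normc zw.2 <= 1,
    normc (zw.1 - zw.2) < n.+1%:R^-1 & e <= normc (g zw.1 - g zw.2)].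
  apply: contrapT => hn; apply: hN; exists n.+1%:R^-1; first by rewrite invr_gt0.
  move=> z w z1 w1 zw; rewrite ltNge; apply/negP => le; apply: hn.
  by exists (z, w).
have [s hs] := choice h.
have [U UU sU] := ex_ultra_nat.
have [p hp] := @ulim_exC R U UU (fun n => (s n).1) 1 (fun n => let: And4 h _ _ _ := hs n in h).
have p1 : normc p <= 1.
  apply/ler_addgt0Pr => d d0; have /filter_ex[n hn] := hp _ d0.
  rewrite (_ : p = (s n).1 + (p - (s n).1)); last by rewrite addrC subrK.
  apply: le_trans (le_normcD _ _) _; apply: lerD; first by case: (hs n).
  by rewrite normcB ltW.
have e2 : 0 < e / 2 by rewrite divr_gt0.
have [d d0 hd] := disc_ext_cont f p1 e2.
have d2 : 0 < d / 2 by rewrite divr_gt0.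
have Uinv : U (fun n => n.+1%:R^-1 < d / 2 :> R).
  by apply: sU; apply: (near_infty_natSinv_lt (PosNum d2)).
have [n [n1 n2]] := filter_ex (filterI (hp _ d2) Uinv).
have [z1 w1 zw] := hs n; apply/negP; rewrite -ltNge.
apply: le_lt_trans (normc_triangle _ (g p) _) _.
rewrite [ltRHS](splitr e); apply: ltrD.
  by apply: hd => //; apply: lt_trans n1 _; rewrite ltr_pdivrMr// ltr_pMr // ltr1n.
rewrite normcB; apply: hd => //.
apply: le_lt_trans (normc_triangle _ (s n).1 _) _.
by rewrite [ltRHS](splitr d); apply: ltrD => //; rewrite normcB; apply: lt_trans zw _.
Qed.

Lemma disc_ext_bounded : exists M : R, forall z, normc z <= 1 -> normc (g z) <= M.
Proof.
apply: contrapT => hN.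
have {hN} h (n : nat) : exists z, normc z <= 1 /\ n%:R <= normc (g z).
  apply: contrapT => hn; apply: hN; exists n%:R => z z1.
  by rewrite leNgt; apply/negP => /ltW le; apply: hn; exists z.
have [s hs] := choice h.
have [U UU sU] := ex_ultra_nat.
have [p hp] := @ulim_exC R U UU s 1 (fun n => (hs n).1).
have p1 : normc p <= 1.
  apply/ler_addgt0Pr => d d0; have /filter_ex[n hn] := hp _ d0.
  rewrite (_ : p = s n + (p - s n)); last by rewrite addrC subrK.
  apply: le_trans (le_normcD _ _) _; apply: lerD; first by case: (hs n).
  by rewrite normcB ltW.
have [d d0 hd] := disc_ext_cont f p1 ltr01.
have Uinv : U (fun n => normc (g p) + 1 < n%:R :> R).
  by apply: sU; exact: nbhs_infty_gtr.
have [n [n1 n2]] := filter_ex (filterI (hp _ d0) Uinv).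
have [s1 sn] := hs n; have := hd _ s1 n1; apply/negP; rewrite -leNgt.
have := le_trans (ltW n2) sn; rewrite -{1}(subrK (g p) (g (s n))) => h1.
have := le_trans h1 (le_normcD _ _); lra.
Qed.
End DiscUnif.

Section Expc.
Variable R : realType.
Implicit Types x y z : R[i].

Definition expc z : R[i] :=
  (expR (Re z) * cos (Im z)) +i* (expR (Re z) * sin (Im z)).

Lemma expcD x y : expc (x + y) = expc x * expc y.
Proof.
case: x y => a b [c d]; rewrite /expc /= expRD cosD sinD.
by apply/eqP; rewrite eq_complex /=; apply/andP; split; apply/eqP; ring.
Qed.

Lemma expc0 : expc 0 = 1.
Proof. by rewrite /expc /= expR0 cos0 sin0 mulr1 mulr0. Qed.

Lemma normc_expc x : normc (expc x) = expR (Re x).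
Proof.
apply/eqP; rewrite -(@eqrXn2 _ 2) ?normc_ge0 ?expR_ge0// normc_sqr /expc /=.
by rewrite !exprMn -mulrDr cos2Dsin2 mulr1.
Qed.

Lemma expc_neq0 x : expc x != 0.
Proof.
apply/eqP => h; have := normc_expc x; rewrite h normc0 => /eqP.
by rewrite eq_sym gt_eqF // expR_gt0.
Qed.

Lemma expcM (n : nat) x : expc (n%:R * x) = expc x ^+ n.
Proof.
elim: n => [|n IH]; first by rewrite mul0r expc0.
by rewrite -natr1 mulrDl mul1r expcD IH exprSr.
Qed.

Lemma expc_pi : expc (0 +i* pi) = -1.
Proof.
rewrite /expc /= expR0 cospi sinpi !mul1r.
by apply/eqP; rewrite eq_complex /= oppr0 !eqxx.
Qed.

Lemma expcN x : expc (- x) = (expc x)^-1.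
Proof.
apply: (mulfI (expc_neq0 x)); rewrite mulfV ?expc_neq0//.
by rewrite -expcD subrr expc0.
Qed.

(** The polar form of z. *)
Lemma expc_surj z : z != 0 -> exists x, z = expc x.
Proof.
move=> z0; set r := normc z.
have r0 : 0 < r.
  rewrite lt_neqAle normc_ge0 andbT eq_sym; apply: contra z0 => /eqP h.
  by rewrite (eq0_normc h).
have hcos : -1 <= Re z / r <= 1.
  rewrite ler_pdivlMr // ler_pdivrMr // mul1r mulN1r -ler_norml; exact: Re_le_normc.
have hs : (Im z / r) ^+ 2 = 1 - (Re z / r) ^+ 2.
  have := normc_sqr z; rewrite -/r => h.
  by rewrite !expr_div_n; field: h; rewrite gt_eqF.
have hsin : sin (acos (Re z / r)) = `|Im z / r|.
  by rewrite sin_acos// -hs sqrtr_sqr.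
have hr : expR (ln r) = r by rewrite lnK.
have [s0|s0] := leP 0 (Im z / r).
  exists (ln r +i* acos (Re z / r)); rewrite /expc /= hr acosK // hsin ger0_norm//.
  by rewrite !(mulrC r) !divfK ?gt_eqF//; case: (z).
exists (ln r +i* (- acos (Re z / r))); rewrite /expc /= hr cosN sinN acosK // hsin ltr0_norm//.
by rewrite opprK !(mulrC r) !divfK ?gt_eqF//; case: (z).
Qed.

Lemma derivable_approx (F : R -> R) (x F' : R) : is_derive x 1 F F' ->
  forall e, 0 < e -> exists2 d, 0 < d & forall h, `|h| < d ->
  `|F (x + h) - F x - F' * h| <= e * `|h|.
Proof.
move=> [dF F'E] e e0.
have : (fun h : R => h^-1 *: (F (h *: (1 : R^o) + x) - F x)) @ 0^' --> F'.
  by rewrite -F'E; exact: dF.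
move/cvgrPdist_le => /(_ _ e0); rewrite near_withinE => /nbhs_normP[d d0 hd].
exists d => // h hh; have [->|h0] := eqVneq h 0.
  by rewrite addr0 mulr0 subrr subr0 normr0 mulr0.
have := hd h; rewrite /= sub0r normrN => /(_ hh h0).
rewrite [_%:A]mulr1 [_ *: _]/(_ * _) (addrC h) => k.
rewrite (_ : _ - F' * h = - h * (F' - h^-1 * (F (x + h) - F x))); last by field.
by rewrite normrM normrN mulrC ler_wpM2r.
Qed.

(** Both coordinates of exp h - 1 - h are controlled by the derivatives at 0 of
the real exponential, cosine and sine. *)
Lemma expc_diff0 (e : R) : 0 < e -> exists2 d, 0 < d &
  forall h : R[i], normc h < d -> normc (expc h - 1 - h) <= e * normc h.
Proof.
(* The two coordinates cost 3 c and 5 c. *)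
move=> e0; have [c [c0 c1 c8]] : exists c, [/\ 0 < c, c <= 1 & 8 * c <= e].
  exists (Num.min (e / 8) 1); rewrite lt_min divr_gt0 ?ltr01// ge_min lexx orbT.
  by split=> //; rewrite mulrC -ler_pdivlMr// ge_min lexx.
have [d1 d10 h1] := derivable_approx (is_derive_expR (0 : R)) c0.
have [d2 d20 h2] := derivable_approx (is_derive_cos (0 : R)) c0.
have [d3 d30 h3] := derivable_approx (is_derive_sin (0 : R)) c0.
exists (Num.min (Num.min d1 d2) (Num.min d3 c)); first by rewrite !lt_min d10 d20 d30 c0.
case=> a b; rewrite !lt_min => /andP[/andP[k1 k2] /andP[k3 k4]].
have ha : `|a| <= normc (a +i* b) by exact: (Re_le_normc (a +i* b)).
have hb : `|b| <= normc (a +i* b) by exact: (Im_le_normc (a +i* b)).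
move: k1 k2 k3 k4 ha hb; set r := normc (a +i* b) => k1 k2 k3 k4 ha hb.
have := h1 a (le_lt_trans ha k1); have := h2 b (le_lt_trans hb k2).
have := h3 b (le_lt_trans hb k3); rewrite !add0r sin0 cos0 expR0 subr0 mul1r oppr0 mul0r subr0 mul1r.
move=> q3 q2 q1.
apply: le_trans (normc_le_ReIm _) _; rewrite /expc /= subr0.
have r0 : 0 <= r by exact: normc_ge0.
have e1 : `|expR a * cos b - 1 - a| <= 3 * c * r.
  rewrite (_ : _ - a = (expR a - 1 - a) * cos b + (1 + a) * (cos b - 1)); last by ring.
  apply: le_trans (ler_normD _ _) _; rewrite !normrM.
  have : `|expR a - 1 - a| * `|cos b| <= c * r * 1.
    apply: ler_pM; rewrite ?normr_ge0 ?cos_max//.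
    by apply: le_trans q1 _; rewrite ler_pM2l.
  have : `|1 + a| * `|cos b - 1| <= 2 * (c * r).
    apply: ler_pM => //; last by apply: le_trans q2 _; rewrite ler_pM2l.
    apply: le_trans (ler_normD _ _) _; rewrite normr1; have := ltW k4; lra.
  by lra.
have e2 : `|expR a * sin b - b| <= 5 * c * r.
  rewrite (_ : _ - b = (expR a - 1) * sin b + (sin b - b)); last by ring.
  apply: le_trans (ler_normD _ _) _; rewrite !normrM.
  have ac : `|a| <= c by rewrite (le_trans ha)// ltW.
  have : `|expR a - 1| * `|sin b| <= (2 * c) * (2 * r).
    have cr : c * `|a| <= c by rewrite ler_piMr // ?(ltW c0)// (le_trans ac).
    have cr' : c * `|b| <= r by apply: le_trans hb; rewrite ler_piMl.
    apply: ler_pM; rewrite ?normr_ge0 ?cos_max//.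
      rewrite -[expR a - 1](subrK a); apply: le_trans (ler_normD _ _) _; lra.
    rewrite -[sin b](subrK b); apply: le_trans (ler_normD _ _) _; lra.
  have : `|sin b - b| <= c * r by apply: le_trans q3 _; rewrite ler_pM2l.
  by lra.
have : 8 * c * r <= e * r by rewrite ler_wpM2r. by lra.
Qed.

Lemma expc_diff x (e : R) : 0 < e -> exists2 d, 0 < d &
  forall y, normc (y - x) < d ->
  normc (expc y - expc x - expc x * (y - x)) <= e * normc (y - x).
Proof.
move=> e0; have p0 : 0 < normc (expc x) by rewrite normc_expc expR_gt0.
have [d d0 hd] := expc_diff0 (divr_gt0 e0 p0).
exists d => // y yd; rewrite (_ : expc y - expc x - _ = expc x * (expc (y - x) - 1 - (y - x))).
  rewrite normcM mulrC -ler_pdivlMr// mulrAC; exact: hd.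
have -> : expc y = expc x * expc (y - x) by rewrite -expcD addrC subrK.
by ring.
Qed.
End Expc.

(** * Dyadic averages along segments and the theorem of Goursat *)

Section SegmentAverages.
Variable R : realType.
Implicit Types (h k : R[i] -> R[i]) (p q a b z w : R[i]).

(** The average of h over the 2^m left ends of the dyadic subdivision of the
segment from p to p + a, a Riemann sum divided by a.  Finite sums suffice for
Cauchy's theorem because the sums of affine functions around a parallelogram
vanish exactly. *)
Fixpoint seg (m : nat) h p a : R[i] :=
  if m is m'.+1 then (seg m' h p (a / 2) + seg m' h (p + a / 2) (a / 2)) / 2
  else h p.

Lemma eq_seg m h k p a : h =1 k -> seg m h p a = seg m k p a.
Proof. by move=> hk; elim: m p a => [|m IH] p a /=; rewrite ?hk ?IH. Qed.

Lemma segD m h k p a :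
  seg m (fun z => h z + k z) p a = seg m h p a + seg m k p a.
Proof. by elim: m p a => [|m IH] p a //=; rewrite !IH; field. Qed.

Lemma segZ m c h p a : seg m (fun z => c * h z) p a = c * seg m h p a.
Proof. by elim: m p a => [|m IH] p a //=; rewrite !IH; field. Qed.

Lemma seg_cst m c p a : seg m (fun=> c) p a = c.
Proof. by elim: m p a => [|m IH] p a //=; rewrite !IH; field. Qed.

Lemma segB m h k p a :
  seg m (fun z => h z - k z) p a = seg m h p a - seg m k p a.
Proof.
rewrite -mulN1r -segZ -segD; apply: eq_seg => z; by rewrite mulN1r.
Qed.

Lemma seg_sum m (I : Type) (r : seq I) (F : I -> R[i] -> R[i]) p a :
  seg m (fun z => \sum_(i <- r) F i z) p a = \sum_(i <- r) seg m (F i) p a.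
Proof.
elim: r => [|i r IH].
  by rewrite big_nil -[RHS](seg_cst m 0 p a); apply: eq_seg => z; rewrite big_nil.
by rewrite big_cons -IH -segD; apply: eq_seg => z; rewrite big_cons.
Qed.

Lemma seg_shift m h p q a : seg m h (p + q) a = seg m (fun z => h (z + q)) p a.
Proof.
by elim: m p a => [|m IH] p a //=; rewrite -!IH (addrAC p q).
Qed.

Lemma seg_scale m h c p a : seg m h (c * p) (c * a) = seg m (fun z => h (c * z)) p a.
Proof.
by elim: m p a => [|m IH] p a //=; rewrite -!IH mulrDr !mulrA.
Qed.

Lemma seg_id m : exists tau, forall p a, seg m id p a = p + a * tau.
Proof.
elim: m => [|m [tau IH]]; first by exists 0 => p a; rewrite mulr0 addr0.
by exists (tau / 2 + 1 / 4) => p a; rewrite /= !IH; field.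
Qed.

Lemma halfC (t : R) : (t / 2)%:C = t%:C / 2 :> R[i].
Proof.
have -> : (2 : R[i])^-1 = (2^-1 : R)%:C by rewrite fmorphV /= rmorph_nat.
exact: rmorphM.
Qed.

(** The average is a convex combination of values on the segment. *)
Lemma seg_le m h k p a :
  (forall t : R, 0 <= t <= 1 -> normc (h (p + t%:C * a)) <= Re (k (p + t%:C * a))) ->
  normc (seg m h p a) <= Re (seg m k p a).
Proof.
elim: m p a => [|m IH] p a hk /=.
  by have := hk 0; rewrite lexx ler01 mul0r addr0; apply.
have e2 : (2 : R[i])^-1 = (2^-1 : R)%:C by rewrite -[LHS]mul1r -(halfC 1) mul1r.
rewrite e2; case E : (seg m k p _ + _) => [x y] /=.
rewrite normcM normcR ger0_norm ?invr_ge0// mulr0 subr0 ler_pM2r ?invr_gt0//.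
have -> : x = Re (seg m k p (a / 2)) + Re (seg m k (p + a / 2) (a / 2)).
  move: E; rewrite e2; case: (seg m k p _) => [? ?]; case: (seg m k _ _) => [? ?].
  by case.
rewrite -e2; apply: le_trans (le_normcD _ _) _; apply: lerD; apply: IH => t /andP[t0 t1].
  rewrite (_ : t%:C * (a / 2) = (t / 2)%:C * a); last by rewrite halfC; ring.
  by apply: hk; apply/andP; split; lra.
rewrite (_ : p + _ + _ = p + ((t + 1) / 2)%:C * a).
  by apply: hk; apply/andP; split; lra.
by rewrite halfC rmorphD /= rmorph1; field.
Qed.

Lemma seg_bound m h p a M :
  (forall t : R, 0 <= t <= 1 -> normc (h (p + t%:C * a)) <= M) ->
  normc (seg m h p a) <= M.
Proof.
move=> hM; have -> : M = Re (seg m (fun=> M%:C) p a) by rewrite seg_cst.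
by apply: seg_le => t /hM.
Qed.

(** Orthogonality of characters over the 2^m-th roots of unity: an odd power takes
opposite values on the two halves of the segment, and an even power reduces to
half the exponent at the previous level. *)
Lemma seg_char m (psi : R[i] -> R[i]) T (n : nat) :
  {morph psi : x y / x + y >-> x * y} -> psi (T / 2) = -1 ->
  (0 < n < 2 ^ m)%N -> seg m (fun t => psi t ^+ n) 0 T = 0.
Proof.
move=> psiD psiT; elim: m n => [|m IH] n /andP[n0 nm]; first by case: n n0 nm => [|[]].
rewrite /= seg_shift.
rewrite [X in _ + X](_ : _ = (-1) ^+ n * seg m (fun t => psi t ^+ n) 0 (T / 2)); last first.
  by rewrite -segZ; apply: eq_seg => t; rewrite psiD psiT exprMn mulrC.
have [no|ne] := boolP (odd n).
  by rewrite -signr_odd no expr1 mulN1r subrr mul0r.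
rewrite -signr_odd (negbTE ne) mul1r.
have n2 : n = (n./2 * 2)%N by rewrite muln2 -[LHS]odd_double_half (negbTE ne).
have -> : seg m (fun t => psi t ^+ n) 0 (T / 2) = seg m (fun t => psi t ^+ n./2) 0 T.
  have e0 : T = 2 * (T / 2) by rewrite mulrC divfK // pnatr_eq0.
  rewrite [in RHS]e0 -[X in seg _ _ X (2 * _)](mulr0 2) seg_scale; apply: eq_seg => t.
  by rewrite [in LHS]n2 mulnC exprM; congr (_ ^+ _); rewrite mulr_natl mulr2n psiD expr2.
rewrite IH ?addr0 ?mul0r//; apply/andP; split.
  by move: n0; rewrite {1}n2; case: n./2.
by move: nm; rewrite {1}n2 expnS mulnC ltn_pmul2l.
Qed.

(** The Riemann sum of h around the parallelogram with sides a and b at p. *)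
Definition loop m h p a b :=
  a * seg m h p a + b * seg m h (p + a) b
    - a * seg m h (p + b) a - b * seg m h p b.

Lemma loop_quarter m h p a b : loop m.+1 h p a b =
  loop m h p (a / 2) (b / 2) + loop m h (p + a / 2) (a / 2) (b / 2) +
  loop m h (p + b / 2) (a / 2) (b / 2) + loop m h (p + a / 2 + b / 2) (a / 2) (b / 2).
Proof.
rewrite /loop /=.
have e1 : p + a / 2 + a / 2 = p + a by field.
have e2 : p + b / 2 + a / 2 = p + a / 2 + b / 2 by ring.
have e3 : p + a / 2 + b / 2 + a / 2 = p + a + b / 2 by field.
have e4 : p + b / 2 + b / 2 = p + b by field.
have e5 : p + a / 2 + b / 2 + b / 2 = p + b + a / 2 by field.
by rewrite e1 e2 e3 e4 e5; field.
Qed.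

(** The four sums of an affine function cancel exactly at every level m: this is
what replaces the existence of a primitive. *)
Lemma loop_affine m c d p a b : loop m (fun z => c + d * z) p a b = 0.
Proof.
have [tau htau] := seg_id m; rewrite /loop !segD !seg_cst.
rewrite !(segZ _ d id) !htau; ring.
Qed.

Lemma loopB m h k p a b :
  loop m (fun z => h z - k z) p a b = loop m h p a b - loop m k p a b.
Proof. by rewrite /loop !segB; ring. Qed.

Lemma loop_bound m h p a b M :
  (forall s t : R, 0 <= s <= 1 -> 0 <= t <= 1 ->
     normc (h (p + s%:C * a + t%:C * b)) <= M) ->
  normc (loop m h p a b) <= 2 * (normc a + normc b) * M.
Proof.
move=> hM.
have k0 : 0 <= (0 : R) <= 1 by rewrite lexx ler01.
have k1 : 0 <= (1 : R) <= 1 by rewrite lexx ler01.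
have b1 : normc (seg m h p a) <= M.
  by apply: seg_bound => t t1; have := hM t 0 t1 k0; rewrite mul0r addr0.
have b2 : normc (seg m h (p + a) b) <= M.
  by apply: seg_bound => t t1; have := hM 1 t k1 t1; rewrite mul1r.
have b3 : normc (seg m h (p + b) a) <= M.
  by apply: seg_bound => t t1; have := hM t 1 t1 k1; rewrite mul1r addrAC.
have b4 : normc (seg m h p b) <= M.
  by apply: seg_bound => t t1; have := hM 0 t k0 t1; rewrite mul0r addr0.
rewrite /loop; have := (normc_ge0 a, normc_ge0 b) => -[a0 b0].
apply: (@le_trans _ _ (normc a * M + normc b * M + normc a * M + normc b * M)); last by lra.
do 3 (apply: le_trans (le_normcD _ _) _; rewrite ?normcN; apply: lerD; last by rewrite normcM ler_wpM2l).
by rewrite normcM ler_wpM2l.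
Qed.

Definition cdiff h z := exists A, forall e : R, 0 < e -> exists2 d : R, 0 < d &
  forall w, normc (w - z) < d -> normc (h w - h z - A * (w - z)) <= e * normc (w - z).

Lemma nat_lt_pow2 (x : R) : exists n : nat, x < 2 ^+ n.
Proof.
have [n hn] : exists n : nat, x < n%:R.
  by exists (Num.bound `|x|); apply: le_lt_trans (ler_norm x) _; exact: archi_boundP.
exists n; apply: lt_trans hn _; rewrite -natrX ltr_nat; exact: ltn_expl.
Qed.

Lemma nested_intervals (s : nat -> R) :
  (forall n, s n <= s n.+1) -> (forall n, s n.+1 + 2 ^- n.+1 <= s n + 2 ^- n) ->
  exists x, forall n, s n <= x <= s n + 2 ^- n.
Proof.
move=> s1 s2.
have mono : {homo s : m n / (m <= n)%N >-> m <= n}.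
  by apply: homo_leq => //; exact: le_trans.
have anti n (k : nat) : s (n + k)%N + 2 ^- (n + k) <= s n + 2 ^- n.
  by elim: k => [|k IH]; rewrite ?addn0 // addnS (le_trans (s2 _)).
have p2 n : 0 < 2 ^- n :> R by rewrite invr_gt0 exprn_gt0.
have ub m n : s m <= s n + 2 ^- n.
  have [mn|/ltnW nm] := leqP m n.
    by have := mono _ _ mn; have := p2 n; lra.
  by have := anti n (m - n)%N; rewrite subnKC//; have := p2 m; lra.
exists (sup (range s)) => n; apply/andP; split.
  apply: ub_le_sup; last by exists n.
  by exists (s 0%N + 2 ^- 0) => _ [m _ <-].
by apply: ge_sup => [|_ [m _ <-]//]; exists (s 0%N); exists 0%N.
Qed.

Section Goursat.
Variables (h : R[i] -> R[i]) (p a b : R[i]).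
Hypothesis hdiff : forall s t : R, 0 <= s <= 1 -> 0 <= t <= 1 ->
  cdiff h (p + s%:C * a + t%:C * b).
Variable e : R.
Hypothesis e0 : 0 < e.

Let pt (st : R * R) := p + st.1%:C * a + st.2%:C * b.
Let A (k : nat) := a * (2 ^- k)%:C.
Let B (k : nat) := b * (2 ^- k)%:C.
Let bad (k : nat) st := forall N, exists2 m, (N <= m)%N &
  e * 4 ^- k < normc (loop m h (pt st) (A k) (B k)).

Let half_pow (k : nat) : (2 ^- k.+1 : R)%:C = (2 ^- k)%:C / 2.
Proof. by rewrite exprSr invfM halfC. Qed.

Let step (k : nat) st : bad k st -> exists2 uv : bool * bool, 
  true & bad k.+1 (st.1 + uv.1%:R * 2 ^- k.+1, st.2 + uv.2%:R * 2 ^- k.+1).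
Proof.
move=> bk; apply: contrapT => hN.
have good (u v : bool) : exists N, forall m, (N <= m)%N ->
    normc (loop m h (pt (st.1 + u%:R * 2 ^- k.+1, st.2 + v%:R * 2 ^- k.+1)) (A k.+1) (B k.+1)) 
     <= e * 4 ^- k.+1.
  apply: contrapT => h1; apply: hN; exists (u, v) => // N.
  apply: contrapT => h2; apply: h1; exists N => m Nm.
  by rewrite leNgt; apply/negP => lt; apply: h2; exists m.
have [N1 g1] := good false false; have [N2 g2] := good true false.
have [N3 g3] := good false true; have [N4 g4] := good true true.
have [[|m]] := bk (N1 + N2 + N3 + N4).+1 => // Nm.
rewrite ltNge => /negP; apply; rewrite loop_quarter.
have eA : A k / 2 = A k.+1 by rewrite /A half_pow mulrA.
have eB : B k / 2 = B k.+1 by rewrite /B half_pow mulrA.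
rewrite eA eB.
have p1 : pt (st.1 + false%:R * 2 ^- k.+1, st.2 + false%:R * 2 ^- k.+1) = pt st.
  by rewrite /= !mul0r !addr0; case: (st).
have p2 : pt (st.1 + true%:R * 2 ^- k.+1, st.2 + false%:R * 2 ^- k.+1) = pt st + A k.+1.
  by rewrite /pt /A /= mul0r !mul1r addr0 rmorphD /=; ring.
have p3 : pt (st.1 + false%:R * 2 ^- k.+1, st.2 + true%:R * 2 ^- k.+1) = pt st + B k.+1.
  by rewrite /pt /B /= mul0r !mul1r addr0 rmorphD /=; ring.
have p4 : pt (st.1 + true%:R * 2 ^- k.+1, st.2 + true%:R * 2 ^- k.+1) = pt st + A k.+1 + B k.+1.
  by rewrite /pt /A /B /= !mul1r !rmorphD /=; ring.
have m1 : (N1 <= m)%N by lia.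
have m2 : (N2 <= m)%N by lia.
have m3 : (N3 <= m)%N by lia.
have m4 : (N4 <= m)%N by lia.
have := (g1 m m1, g2 m m2, g3 m m3, g4 m m4).
rewrite p1 p2 p3 p4 => -[[[q1 q2] q3] q4].
have -> : e * 4 ^- k = e * 4 ^- k.+1 + e * 4 ^- k.+1 + e * 4 ^- k.+1 + e * 4 ^- k.+1.
  by rewrite exprS; field; rewrite expf_neq0.
by do 3 (apply: le_trans (le_normcD _ _) _; apply: lerD => //).
Qed.

(** If the loop sums exceed e at infinitely many levels, so do those of one of the
four quarters with e / 4, and so on.  At the common point of the nested
parallelograms the function is affine up to a small error, which contradicts
loop_affine. *)
Lemma goursat : exists N, forall m, (N <= m)%N -> normc (loop m h p a b) <= e.
Proof.
apply: contrapT => hN.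
have bad0 : bad 0 (0, 0).
  move=> N; apply: contrapT => h2; apply: hN; exists N => m Nm.
  rewrite leNgt; apply/negP => lt; apply: h2; exists m => //.
  by rewrite /pt /A /B /= expr0 invr1 !mulr1 !mul0r !addr0.
pose nx (k : nat) st := if pselect (bad k st) is left b then
   let uv := s2val (cid2 (step b)) in
   (st.1 + uv.1%:R * 2 ^- k.+1, st.2 + uv.2%:R * 2 ^- k.+1) else st.
pose fix sq (k : nat) : R * R := if k is k'.+1 then nx k' (sq k') else (0, 0).
have badk (k : nat) : bad k (sq k).
  elim: k => [//|k IH]; rewrite /= /nx; case: pselect => // bk.
  by case: cid2.
have st1 (k : nat) : exists uv : bool * bool, 
    sq k.+1 = ((sq k).1 + uv.1%:R * 2 ^- k.+1, (sq k).2 + uv.2%:R * 2 ^- k.+1).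
  rewrite /= {1}/nx; case: pselect => [bk|//]; by exists (s2val (cid2 (step bk))).
have ps (k : nat) : 0 < 2 ^- k.+1 :> R by rewrite invr_gt0 exprn_gt0.
have pd (k : nat) : 2 ^- k = 2 ^- k.+1 + 2 ^- k.+1 :> R by rewrite exprS; field; rewrite expf_neq0.
have [x hx] : exists x, forall n, (sq n).1 <= x <= (sq n).1 + 2 ^- n.
  apply: nested_intervals => n; have [[u v] ->] := st1 n; have := ps n; have := pd n;
  rewrite /=; case: u => /=; lra.
have [y hy] : exists y, forall n, (sq n).2 <= y <= (sq n).2 + 2 ^- n.
  apply: nested_intervals => n; have [[u v] ->] := st1 n; have := ps n; have := pd n;
  rewrite /=; case: v => /=; lra.
have hx0 : 0 <= x <= 1 by have := hx 0%N; rewrite /= expr0 invr1 add0r.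
have hy0 : 0 <= y <= 1 by have := hy 0%N; rewrite /= expr0 invr1 add0r.
have [D hD] := hdiff hx0 hy0.
set L := normc a + normc b.
have L0 : 0 <= L by rewrite addr_ge0 ?normc_ge0.
(* The loop has length at most 2 L 2^-k and the error on it is at most the chosen
   constant times L 2^-k, hence the factor 2 L^2; adding 1 keeps it invertible. *)
have c0 : 0 < e / (2 * L ^+ 2 + 1) by rewrite divr_gt0// ltr_wpDl// mulr_ge0// sqr_ge0.
have [d d0 hd] := hD _ c0.
have [k hk] := nat_lt_pow2 (L / d).
have k2 : 0 < 2 ^- k :> R by rewrite invr_gt0 exprn_gt0.
have hkd : L * 2 ^- k < d.
  by rewrite ltr_pdivrMr ?exprn_gt0// mulrC -ltr_pdivrMr.
have [m _] := badk k 0%N; rewrite ltNge => /negP; apply.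
set q := p + x%:C * a + y%:C * b in hd hD.
pose aff z := h q - D * q + D * z.
rewrite -[loop m h _ _ _]subr0 -(loop_affine m (h q - D * q) D (pt (sq k)) (A k) (B k)) -loopB.
apply: le_trans (@loop_bound _ _ _ _ _ (e / (2 * L ^+ 2 + 1) * (L * 2 ^- k)) _) _.
  move=> s t s1 t1; rewrite (_ : h _ - _ = h (pt (sq k) + s%:C * A k + t%:C * B k) - h q - D * (pt (sq k) + s%:C * A k + t%:C * B k - q)); last by ring.
  have nq : normc (pt (sq k) + s%:C * A k + t%:C * B k - q) <= L * 2 ^- k.
    rewrite (_ : _ - q = ((sq k).1 + s * 2 ^- k - x)%:C * a + ((sq k).2 + t * 2 ^- k - y)%:C * b).
      apply: le_trans (le_normcD _ _) _; rewrite !normcM !normcR /L mulrDl.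
      apply: lerD; rewrite mulrC; apply: ler_wpM2l; rewrite ?normc_ge0//.
        have := hx k; move: s1; rewrite ler_norml => /andP[? ?] /andP[? ?].
        have : s * 2 ^- k <= 2 ^- k by rewrite ler_piMl// ltW.
        have : 0 <= s * 2 ^- k by rewrite mulr_ge0// ltW.
        by move=> *; apply/andP; split; lra.
      have := hy k; move: t1; rewrite ler_norml => /andP[? ?] /andP[? ?].
      have : t * 2 ^- k <= 2 ^- k by rewrite ler_piMl// ltW.
      have : 0 <= t * 2 ^- k by rewrite mulr_ge0// ltW.
      by move=> *; apply/andP; split; lra.
    by rewrite /pt /A /B /q !rmorphB !rmorphD /= !rmorphM /=; ring.
  apply: le_trans (hd _ (le_lt_trans nq hkd)) _.
  by rewrite ler_wpM2l// ltW.
have -> : normc (A k) + normc (B k) = L * 2 ^- k.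
  by rewrite /A /B !normcM !normcR ger0_norm ?(ltW k2)// /L mulrDl.
have -> : 4 ^- k = 2 ^- k * 2 ^- k :> R.
  by rewrite -invfM -exprMn -natrM.
have n0 : 2 * L ^+ 2 + 1 != 0 by rewrite gt_eqF// ltr_wpDl// mulr_ge0// sqr_ge0.
move: k2; set u := 2 ^- k => k2.
have -> : 2 * (L * u) * (e / (2 * L ^+ 2 + 1) * (L * u)) =
    e * (u * u) * (2 * L ^+ 2 / (2 * L ^+ 2 + 1)) by field.
rewrite ler_piMr//; first by rewrite mulr_ge0 ?(ltW e0)// mulr_ge0// ltW.
by rewrite ler_pdivrMr ?mul1r ?lerDl// ltr_wpDl// mulr_ge0// sqr_ge0.
Qed.
End Goursat.

End SegmentAverages.

(** * Complex differentiability and limits along an ultrafilter *)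

Section Cdiff.
Variable R : realType.
Implicit Types (h k : R[i] -> R[i]) (z w : R[i]).

Lemma cdiff_lip h z : cdiff h z -> exists L d : R,
  [/\ 0 < L, 0 < d & forall w, normc (w - z) < d -> normc (h w - h z) <= L * normc (w - z)].
Proof.
move=> [A /(_ 1 ltr01)[d d0 hd]]; exists (normc A + 1), d; split => //.
  by rewrite ltr_wpDl ?normc_ge0.
move=> w /hd; rewrite mul1r => h1.
rewrite -[h w - h z](subrK (A * (w - z))); apply: le_trans (le_normcD _ _) _.
by rewrite addrC mulrDl mul1r normcM; apply: lerD.
Qed.

Lemma cdiff_cont h z : cdiff h z -> forall e : R, 0 < e -> exists2 d : R, 0 < d &
  forall w, normc (w - z) < d -> normc (h w - h z) <= e.
Proof.
move=> /cdiff_lip[L [d [L0 d0 hd]]] e e0; exists (Num.min d (e / L)).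
  by rewrite lt_min d0 divr_gt0.
move=> w; rewrite lt_min => /andP[/hd h1 h2]; apply: le_trans h1 _.
by rewrite mulrC -ler_pdivlMr// ltW.
Qed.

Lemma cdiff_cst c z : cdiff (fun=> c) z.
Proof.
exists 0 => e e0; exists 1 => // w _; rewrite mul0r !subrr normc0.
by rewrite mulr_ge0 ?normc_ge0// ltW.
Qed.

Lemma cdiff_lin c z : cdiff (fun w => c * w) z.
Proof.
exists c => e e0; exists 1 => // w _; rewrite mulrBr subrr normc0.
by rewrite mulr_ge0 ?normc_ge0// ltW.
Qed.

Lemma cdiffM h k z : cdiff h z -> cdiff k z -> cdiff (fun w => h w * k w) z.
Proof.
move=> ch ck; have [L [d1 [L0 d10 hd1]]] := cdiff_lip ch.
have [A hA] := ch; have [B hB] := ck.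
exists (A * k z + h z * B) => e e0.
pose c : R := e / (L * (normc B + 1) + normc (k z) + normc (h z) + 1).
set D := L * _ + _ + _ + _ in c.
have D0 : 0 < D by rewrite ltr_wpDl// !addr_ge0 ?normc_ge0// mulr_ge0 ?addr_ge0 ?normc_ge0// ltW.
have c0 : 0 < c by rewrite divr_gt0.
have [dA dA0 hdA] := hA c c0; have [dB dB0 hdB] := hB c c0.
have [dB1 dB10 hdB1] := hB 1 ltr01.
(* The bounds d1, c and dB1 control the product of the increments, dA and dB the
   two error terms. *)
exists (Num.min (Num.min d1 c) (Num.min (Num.min dA dB) dB1)).
  by rewrite !lt_min d10 c0 dA0 dB0.
move=> w; rewrite !lt_min => /andP[/andP[w1 w2] /andP[/andP[w3 w4] w5]].
rewrite (_ : _ - _ - _ = (h w - h z) * (k w - k z) + (h w - h z - A * (w - z)) * k z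
   + h z * (k w - k z - B * (w - z))); last by ring.
set r := normc (w - z) in w1 w2 w3 w4 w5 *.
have r0 : 0 <= r by exact: normc_ge0.
have q1 : normc (h w - h z) <= L * c by apply: le_trans (hd1 _ w1) _; rewrite ler_pM2l// ltW.
have q2 : normc (k w - k z) <= (normc B + 1) * r.
  rewrite -[k w - k z](subrK (B * (w - z))); apply: le_trans (le_normcD _ _) _.
  by have := hdB1 _ w5; rewrite normcM -/r; lra.
have q3 := hdA _ w3; have q4 := hdB _ w4.
apply: le_trans (le_normcD _ _) _; rewrite !normcM.
have -> : e * r = c * D * r by rewrite /c divfK// gt_eqF.
apply: (@le_trans _ _ (L * c * ((normc B + 1) * r) + (c * r) * normc (k z) + normc (h z) * (c * r))).
  apply: lerD; last by rewrite ler_wpM2l ?normc_ge0.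
  apply: le_trans (le_normcD _ _) _; rewrite !normcM; apply: lerD; last by rewrite ler_wpM2r ?normc_ge0.
  by apply: ler_pM; rewrite ?normc_ge0.
have : 0 <= c * r by rewrite mulr_ge0// ltW.
rewrite /D; move: (normc B) (normc (k z)) (normc (h z)) => b1 b2 b3.
set cr := c * r => cr0.
have -> : L * c * ((b1 + 1) * r) = cr * (L * (b1 + 1)) by rewrite /cr; ring.
have -> : c * (L * (b1 + 1) + b2 + b3 + 1) * r = cr * (L * (b1 + 1) + b2 + b3 + 1).
  by rewrite /cr; ring.
lra.
Qed.

Lemma cdiff_comp h k z : cdiff h z -> cdiff k (h z) -> cdiff (fun w => k (h w)) z.
Proof.
move=> ch [B hB]; have [L [d1 [L0 d10 hd1]]] := cdiff_lip ch.
have [A hA] := ch; exists (B * A) => e e0.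
pose D := L + normc B; have D0 : 0 < D by rewrite ltr_pwDl ?normc_ge0.
have c0 : 0 < e / D by rewrite divr_gt0.
have [dA dA0 hdA] := hA _ c0; have [dB dB0 hdB] := hB _ c0.
exists (Num.min (Num.min d1 dA) (dB / L)).
  by rewrite !lt_min d10 dA0 divr_gt0.
move=> w; rewrite !lt_min => /andP[/andP[w1 w2] w3].
have q1 := hd1 _ w1.
have q2 : normc (h w - h z) < dB by apply: le_lt_trans q1 _; rewrite mulrC -ltr_pdivlMr.
rewrite (_ : _ - _ - _ = (k (h w) - k (h z) - B * (h w - h z)) + B * (h w - h z - A * (w - z))); last by ring.
apply: le_trans (le_normcD _ _) _; rewrite normcM.
have := hdB _ q2; have := hdA _ w2; set r := normc (w - z).
move=> q3 q4.
rewrite (_ : e * r = e / D * (L * r) + normc B * (e / D * r)).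
  apply: lerD; last by rewrite ler_wpM2l ?normc_ge0.
  by apply: le_trans q4 _; rewrite ler_pM2l.
by rewrite /D in D0 *; field; rewrite gt_eqF.
Qed.

Lemma cdiff_expc z : cdiff (@expc R) z.
Proof. by exists (expc z) => e e0; exact: expc_diff. Qed.

Lemma cdiff_horner (p : {poly R[i]}) z : cdiff (horner p) z.
Proof.
elim/poly_ind: p => [|p c IH].
  by have := cdiff_cst 0 z; congr cdiff; apply/funext => w; rewrite horner0.
have -> : horner (p * 'X + c%:P) = (fun w => p.[w] * w + c).
  by apply/funext => w; rewrite !hornerE.
have [A hA] := cdiffM IH (cdiff_lin 1 z).
exists A => e e0; have [d d0 hd] := hA e e0; exists d => // w /hd.
by rewrite !mul1r opprD addrACA subrr addr0.
Qed.

End Cdiff.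

Section UL.
Variables (R : realType) (U : set_system nat).
Hypothesis UU : UltraFilter U.
Implicit Types (u v : nat -> R[i]) (x y : R[i]).

Definition ulim u x := forall d : R, 0 < d -> U (fun n => normc (u n - x) < d).

Lemma ulimD u v x y : ulim u x -> ulim v y -> ulim (fun n => u n + v n) (x + y).
Proof.
move=> hu hv d d0; have d2 : 0 < d / 2 by rewrite divr_gt0.
apply: filterS (filterI (hu _ d2) (hv _ d2)) => n [h1 h2].
rewrite opprD addrACA; apply: le_lt_trans (le_normcD _ _) _.
by rewrite [ltRHS](splitr d) ltrD.
Qed.

Lemma ulim_cst x : ulim (fun=> x) x.
Proof. by move=> d d0; apply: filterE => n; rewrite subrr normc0. Qed.

Lemma ulimZ c u x : ulim u x -> ulim (fun n => c * u n) (c * x).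
Proof.
move=> hu d d0; have c0 : 0 < normc c + 1 by rewrite ltr_wpDl ?normc_ge0.
have := hu (d / (normc c + 1)); rewrite divr_gt0// => /(_ isT).
apply: filterS => n h; rewrite -mulrBr normcM.
apply: (@le_lt_trans _ _ ((normc c + 1) * normc (u n - x))).
  by rewrite ler_wpM2r ?normc_ge0// lerDl.
by rewrite mulrC -ltr_pdivlMr.
Qed.

Lemma ulim_sum (I : Type) (r : seq I) (F : I -> nat -> R[i]) (L : I -> R[i]) :
  (forall i, ulim (F i) (L i)) -> ulim (fun n => \sum_(i <- r) F i n) (\sum_(i <- r) L i).
Proof.
move=> h; elim: r => [|i r IH].
  by rewrite big_nil; have := ulim_cst 0; congr ulim; apply/funext => n; rewrite big_nil.
rewrite big_cons; have := ulimD (h i) IH; congr ulim.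
by apply/funext => n; rewrite big_cons.
Qed.

Lemma ulim_le u x c (M : R) : ulim u x -> U (fun n => normc (u n - c) <= M) ->
  normc (x - c) <= M.
Proof.
move=> hu hM; apply/ler_addgt0Pr => d d0.
have [n [h1 h2]] := filter_ex (filterI (hu _ d0) hM).
apply: le_trans (normc_triangle _ (u n) _) _; rewrite addrC; apply: lerD => //.
by rewrite normcB ltW.
Qed.
End UL.

(** * Fourier coefficients on circles *)

Section Density.
Variable R : realType.
Variable f : disc_algebra R.
Let g : R[i] -> R[i] := valL_ 0 (f : closed_disc R -> R[i]).
Implicit Types (z w t c : R[i]) (m k i j n : nat).

(** The period 2 i pi of the exponential. *)
Definition cperiod : R[i] := 0 +i* (pi *+ 2).
Local Notation T := cperiod.

Lemma half_cperiod : T / 2 = 0 +i* pi.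
Proof.
apply: (mulIf (_ : (2 : R[i]) != 0)); first by rewrite pnatr_eq0.
rewrite divfK ?pnatr_eq0// mulr_natr mulr2n /cperiod.
by apply/eqP; rewrite eq_complex /= addr0 eqxx mulr2n eqxx.
Qed.

Lemma expc_half_cperiod : expc (T / 2) = -1.
Proof. by rewrite half_cperiod expc_pi. Qed.

Lemma expc_cperiod : expc T = 1.
Proof.
have -> : T = T / 2 + T / 2 by field.
by rewrite expcD expc_half_cperiod mulrNN mulr1.
Qed.

Let h c z := g (expc z) * expc (c * z).

Let h_cdiff c z : Re z < 0 -> cdiff (h c) z.
Proof.
move=> z0; apply: cdiffM; last exact: (cdiff_comp (cdiff_lin _ _) (cdiff_expc _)).
apply: cdiff_comp (cdiff_expc _) _.
by apply: disc_ext_diff; rewrite normc_expc expR_lt1.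
Qed.

(** Cauchy's theorem for the periodic function h c on the parallelogram with
vertices x, y and their translates: the side from x to y and its translate carry
the same sum, by periodicity, so that the circle averages at x and y, which are the
other two sides, agree in the limit. *)
Let h_indep c (x y : R[i]) : expc (c * T) = 1 -> Re x < 0 -> Re y < 0 ->
  forall e : R, 0 < e -> exists N, forall m, (N <= m)%N ->
    normc (seg m (h c) y T - seg m (h c) x T) <= e.
Proof.
move=> cT x0 y0 e e0.
have hd (s t : R) : 0 <= s <= 1 -> 0 <= t <= 1 ->
    cdiff (h c) (x + s%:C * (y - x) + t%:C * T).
  move=> /andP[s0 s1] _; apply: h_cdiff.
  have -> : Re (x + s%:C * (y - x) + t%:C * T) = (1 - s) * Re x + s * Re y.
    by case: (x) (y) => [a b] [a' b'] /=; ring.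
  have [->|sn0] := eqVneq s 0; first by rewrite subr0 mul1r mul0r addr0.
  apply: ltr_wnDl; first by rewrite mulr_ge0_le0 ?subr_ge0// ltW.
  by rewrite nmulr_llt0// lt_neqAle eq_sym sn0.
have T0 : 0 < normc T.
  by apply: lt_le_trans (Im_le_normc _); rewrite /= normr_gt0 mulrn_eq0 /= gt_eqF ?pi_gt0.
have [N hN] := goursat hd (mulr_gt0 e0 T0).
exists N => m /hN; rewrite /loop.
have -> : seg m (h c) (x + T) (y - x) = seg m (h c) x (y - x).
  rewrite seg_shift; apply: eq_seg => z.
  by rewrite /h mulrDr !expcD expc_cperiod cT !mulr1.
rewrite (addrC x) subrK.
rewrite (_ : _ - _ - _ = T * (seg m (h c) y T - seg m (h c) x T)); last by ring.
by rewrite normcM mulrC ler_pM2r.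
Qed.

Let expc_nat_period k : expc (k%:R * T) = 1.
Proof. by rewrite expcM expc_cperiod expr1n. Qed.

Let expc_natN_period k : expc (- k%:R * T) = 1.
Proof. by rewrite mulNr expcN expc_nat_period invr1. Qed.

Variable U : set_system nat.
Hypothesis UU : UltraFilter U.
Hypothesis sU : \oo `<=` U.

Let ReT s : Re (s%:C * T) = 0.
Proof. by rewrite /= mul0r mulr0 subr0. Qed.

Let RCnat k : (k%:R : R[i]) = (k%:R : R)%:C.
Proof. by rewrite -(rmorph_nat (real_complex R)). Qed.

Let h_bound M : (forall z, normc z <= 1 -> normc (g z) <= M) ->
  forall c z m, (Re c)%:C = c -> Re z <= 0 ->  normc (seg m (h c) z T) <= M * expR (Re (c * z)).
Proof.
move=> hM c z m cR z0; apply: seg_bound => s _; rewrite /h normcM !normc_expc.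
have -> : Re (c * (z + s%:C * T)) = Re (c * z).
  by rewrite -cR; case: (z) => a b /=; ring.
apply: ler_wpM2r; first exact: expR_ge0.
by apply: hM; rewrite normc_expc -expR0 ler_expR raddfD /= -[X in _ + X]/(Re (s%:C * T)) ReT addr0.
Qed.

(** Averages against positive powers vanish: the average is independent of the
radius exp (Re z) of the circle, and it is small when the radius is small. *)
Let h_pos k z : (0 < k)%N -> Re z < 0 -> ulim U (fun m => seg m (h k%:R) z T) 0.
Proof.
move=> k0 z0 d d0; have [M hM] := disc_ext_bounded f.
have M0 : 0 <= M by apply: le_trans (hM 0 _); rewrite ?normc_ge0// normc0.
(* On the circle of radius exp (- x) the average is at most d / 2. *)
pose x : R := 1 + `|ln (d / (2 * (M + 1)))|.
have x0 : 0 < x by rewrite ltr_pwDl.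
have q0 : 0 < d / (2 * (M + 1)) by rewrite divr_gt0// mulr_gt0// ltr_wpDl.
have ex : expR (- x) <= d / (2 * (M + 1)).
  rewrite -[leRHS](lnK q0) ler_expR /x; have := ler_norm (- ln (d / (2 * (M + 1)))).
  by rewrite normrN; lra.
have d2 : 0 < d / 4 by rewrite divr_gt0.
have Rx : Re (- x)%:C < 0 by rewrite /= oppr_lt0.
have [N hN] := h_indep (expc_nat_period k) z0 Rx d2.
have : U (fun m => (N <= m)%N) by apply: sU; exact: nbhs_infty_ge.
apply: filterS => m /hN hm; rewrite subr0.
have b1 : normc (seg m (h k%:R) (- x)%:C T) <= d / 2.
  apply: le_trans (h_bound hM _ _ (ltW Rx)) _.
    by rewrite RCnat.
  apply: (@le_trans _ _ ((M + 1) * (d / (2 * (M + 1))))).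
    apply: ler_pM; rewrite ?expR_ge0 ?lerDl//.
    apply: le_trans ex; rewrite ler_expR.
    rewrite RCnat -rmorphM /= mulrN lerN2 ler_peMl ?(ltW x0)//.
    by rewrite ler1n.
  by rewrite le_eqVlt; apply/orP; left; apply/eqP; field; rewrite gt_eqF// ltr_wpDl.
rewrite -[seg m _ z T](subrK (seg m (h k%:R) (- x)%:C T)).
apply: le_lt_trans (le_normcD _ _) _; rewrite normcB; lra.
Qed.

Let h_neg k : exists c, forall z, Re z < 0 -> ulim U (fun m => seg m (h (- k%:R)) z T) c.
Proof.
have [M hM] := disc_ext_bounded f.
have R1 : Re (- 1) < 0 :> R by rewrite /= oppr_lt0.
have kR : (Re (- k%:R))%:C = - k%:R :> R[i].
  by rewrite RCnat -rmorphN.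
have [c hc] := @ulim_exC R U UU _ _ (fun m => @h_bound M hM _ _ m kR (ltW R1)).
exists c => z z0 d d0; have d2 : 0 < d / 2 by rewrite divr_gt0.
have [N hN] := h_indep (expc_natN_period k) z0 R1 d2.
have hU : U (fun m => (N <= m)%N) by apply: sU; exact: nbhs_infty_ge.
apply: filterS (filterI (hc _ d2) hU) => m [h1 h2].
apply: le_lt_trans (normc_triangle _ (seg m (h (- k%:R)) (-1) T) _) _.
by rewrite [ltRHS](splitr d) addrC ltr_leD// normcB hN.
Qed.

(** The Fourier coefficients of g on the circle through z, taken along U, are
c_(j-i) z^(j-i) for a sequence c that does not depend on z, and 0 for negative
indices.  Substituting z = exp x turns rotations into translations by the period. *)
Lemma circle_coef : exists c : nat -> R[i], forall i j z, z != 0 -> normc z < 1 ->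
  ulim U (fun m => seg m (fun t => g (z * expc t) * (expc t ^+ i * expc (- t) ^+ j)) 0 T)
    (if (i <= j)%N then c (j - i)%N * z ^+ (j - i) else 0).
Proof.
have [c hc] := choice h_neg; exists c => i j z z0 z1.
have [x xE] := expc_surj z0.
have x0 : Re x < 0 by move: z1; rewrite xE normc_expc expR_lt1.
have ee t : expc t * expc (- t) = 1 by rewrite -expcD subrr expc0.
have [ij|ij] := leqP i j.
  rewrite mulrC; have := ulimZ UU (z ^+ (j - i)) (hc (j - i)%N x x0); congr ulim.
  apply/funext => m; rewrite -[x in LHS]add0r seg_shift -segZ; apply: eq_seg => t.
  have -> : expc t ^+ i * expc (- t) ^+ j = expc (- t) ^+ (j - i).
    by rewrite -{1}(subnKC ij) exprD mulrA -exprMn ee expr1n mul1r.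
  rewrite /h.
  rewrite mulNr (expcN (_ * _)) expcM (addrC t) expcD -xE exprMn invfM expcN exprVn.
  by rewrite mulrCA (mulrA (z ^+ _)) mulfV ?mul1r// expf_neq0.
have k0 : (0 < i - j)%N by rewrite subn_gt0.
have := ulimZ UU (z ^- (i - j)) (h_pos k0 x0); rewrite mulr0; congr ulim.
apply/funext => m; rewrite -[x in LHS]add0r seg_shift -segZ; apply: eq_seg => t.
have -> : expc t ^+ i * expc (- t) ^+ j = expc t ^+ (i - j).
  by rewrite -{1}(subnK (ltnW ij)) exprD -mulrA -exprMn ee expr1n mulr1.
rewrite /h.
rewrite expcM (addrC t) expcD -xE exprMn.
by rewrite mulrCA (mulrA (z ^- _)) mulVf ?mul1r// expf_neq0.
Qed.

End Density.

(** * Density of the polynomials in the disc algebra *)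

Section Fejer.
Variable R : realType.
Implicit Types (z w t u c : R[i]) (m k i j n : nat).
Local Notation T := (cperiod R).

(** The Fejer kernel |1 + u + ... + u^(n-1)|^2 / n at u = exp t, expanded. *)
Definition fejer n t : R[i] :=
  n%:R^-1 * \sum_(i < n) \sum_(j < n) (expc t ^+ i * expc (- t) ^+ j).

Lemma seg_fejer m n : (0 < n <= 2 ^ m)%N -> seg m (fejer n) 0 T = 1.
Proof.
move=> /andP[n0 nm]; rewrite segZ seg_sum.
have ee t : expc t * expc (- t) = 1 :> R[i] by rewrite -expcD subrr expc0.
rewrite (eq_bigr (fun=> 1)); last first.
  move=> i _; rewrite seg_sum (bigD1 i) //= big1 ?addr0.
    by rewrite -[RHS](seg_cst m 1 0 T); apply: eq_seg => t; rewrite -exprMn ee expr1n.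
  move=> j ji; have [ij|ji'] := ltnP i j.
    rewrite -[RHS](@seg_char _ m (fun t => expc (- t)) T (j - i)); last first.
    - by rewrite subn_gt0 ij (leq_ltn_trans (leq_subr _ _))// (leq_trans _ nm).
    - by rewrite expcN expc_half_cperiod invrN1.
    - by move=> x y; rewrite opprD expcD.
    apply: eq_seg => t.
    by rewrite -{1}(subnKC (ltnW ij)) exprD mulrA -exprMn ee expr1n mul1r.
  have ij : (j < i)%N by rewrite ltn_neqAle ji' andbT.
  rewrite -[RHS](@seg_char _ m (@expc R) T (i - j)); last first.
  - by rewrite subn_gt0 ij (leq_ltn_trans (leq_subr _ _))// (leq_trans _ nm).
  - exact: expc_half_cperiod.
  - exact: expcD.
  apply: eq_seg => t.
  by rewrite -{1}(subnK (ltnW ij)) exprD -mulrA -exprMn ee expr1n mulr1.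
by rewrite sumr_const card_ord mulVf// pnatr_eq0 -lt0n.
Qed.

Lemma expcN_conj (s : R) : expc (- (s%:C * T)) = (expc (s%:C * T))^*.
Proof.
rewrite /cperiod /expc /= !mul0r !mulr0 subr0 oppr0 addr0 expR0 !mul1r cosN sinN.
by [].
Qed.

Lemma fejer_ptE n (s : R) : (0 < n)%N ->
  fejer n (s%:C * T) = (normc (\sum_(i < n) expc (s%:C * T) ^+ i) ^+ 2 / n%:R)%:C.
Proof.
move=> n0; rewrite /fejer expcN_conj; set u := expc _.
rewrite mulrC rmorphM rmorphXn /= -normcEc sqr_normc fmorphV /= rmorph_nat; congr (_ / _).
rewrite rmorph_sum /= mulr_suml; apply: eq_bigr => i _; rewrite mulr_sumr.
by apply: eq_bigr => j _; rewrite rmorphXn.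
Qed.

(** Away from u = 1 the geometric sum is (u^n - 1) / (u - 1). *)
Lemma fejer_tail n (s d : R) : 0 < d -> (0 < n)%N ->
  d <= normc (expc (s%:C * T) - 1) ->
  normc (\sum_(i < n) expc (s%:C * T) ^+ i) ^+ 2 / n%:R <= 4 / d ^+ 2 / n%:R.
Proof.
move=> d0 n0; set u := expc _ => du.
have u1 : normc u = 1 by rewrite normc_expc /= mul0r mulr0 subr0 expR0.
rewrite ler_pM2r ?invr_gt0 ?ltr0n// ler_pdivlMr ?exprn_gt0// -exprMn.
have -> : (4 : R) = 2 ^+ 2 by rewrite -natrX.
rewrite ler_pXn2r ?nnegrE ?mulr_ge0 ?normc_ge0 ?(ltW d0)//.
apply: (@le_trans _ _ (normc (\sum_(i < n) u ^+ i) * normc (u - 1))).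
  by rewrite ler_wpM2l ?normc_ge0.
rewrite mulrC -normcM -subrX1; apply: le_trans (le_normcD _ _) _.
by rewrite normcN normcX u1 expr1n normc1.
Qed.

Variable f : disc_algebra R.
Let g : R[i] -> R[i] := valL_ 0 (f : closed_disc R -> R[i]).

(** An approximate identity: the kernel is nonnegative with average 1, and the
part of the average where u is at distance d from 1 is O(1/n).  The estimate is
pointwise, g (z u) - g z being small for u near 1 and the kernel small otherwise. *)
Lemma fejer_approx (e : R) : 0 < e -> exists2 n, (0 < n)%N &
  forall m z, (n <= 2 ^ m)%N -> normc z <= 1 ->
    normc (seg m (fun t => g (z * expc t) * fejer n t) 0 T - g z) <= e.
Proof.
move=> e0; have e2 : 0 < e / 2 by rewrite divr_gt0.
have [d d0 hd] := disc_ext_unif f e2.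
have [M hM] := disc_ext_bounded f.
have M0 : 0 <= M by apply: le_trans (hM 0 _); rewrite ?normc_ge0// normc0.
(* Twice the bound of g times the tail of the kernel. *)
pose b := 2 * M * 4 / d ^+ 2.
have b0 : 0 <= b by rewrite !mulr_ge0// invr_ge0 sqr_ge0.
have [n hn] : exists n : nat, b / (e / 2) < n.+1%:R.
  exists (Num.bound (b / (e / 2))).
  apply: (@lt_trans _ _ (Num.bound (b / (e / 2)))%:R); last by rewrite ltr_nat.
  by apply: archi_boundP; rewrite divr_ge0// ltW.
have hb : b / n.+1%:R <= e / 2.
  by rewrite ler_pdivrMr ?ltr0n// mulrC -ler_pdivrMr// ltW.
exists n.+1 => // m z nm z1.
have -> : g z = seg m (fun t => g z * fejer n.+1 t) 0 T by rewrite segZ seg_fejer ?mulr1.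
rewrite -segB.
have -> : e = Re (seg m (fun t => (e / 2)%:C * fejer n.+1 t + (e / 2)%:C) 0 T).
  by rewrite segD segZ seg_fejer ?mulr1// seg_cst /= -splitr.
apply: seg_le => s _; rewrite add0r -mulrBl normcM fejer_ptE// normcR.
have hT : normc (expc (s%:C * T)) = 1 by rewrite normc_expc /= mul0r mulr0 subr0 expR0.
have zu : normc (z * expc (s%:C * T)) <= 1 by rewrite normcM hT mulr1.
rewrite -rmorphM -rmorphD [Re _]/=.
have F0 : 0 <= normc (\sum_(i < n.+1) expc (s%:C * T) ^+ i) ^+ 2 / n.+1%:R.
  by rewrite divr_ge0// sqr_ge0.
rewrite (ger0_norm F0); have [lt|ge] := ltP (normc (expc (s%:C * T) - 1)) d.
  apply: ler_wpDr; first exact: ltW.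
  apply: ler_wpM2r => //; apply: ltW; apply: hd => //.
  rewrite -{2}(mulr1 z) -mulrBr normcM; apply: le_lt_trans lt.
  by rewrite ler_piMl ?normc_ge0.
apply: ler_wpDl; first by rewrite mulr_ge0// ltW.
apply: le_trans hb.
apply: (@le_trans _ _ (2 * M * (4 / d ^+ 2 / n.+1%:R))); last by rewrite /b !mulrA.
apply: ler_pM => //; rewrite ?normc_ge0//; last exact: fejer_tail.
apply: le_trans (le_normcD _ _) _; rewrite normcN.
by rewrite (_ : 2 * M = M + M); [apply: lerD; exact: hM | ring].
Qed.

(** The Fejer mean of order n is close to g on the disc and its limit along the
ultrafilter is a polynomial in z, by circle_coef.  That argument needs z of
modulus in ]0, 1[; the other points are reached by continuity. *)
Theorem disc_poly_dense (e : R) : 0 < e -> exists p : {poly R[i]},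
  forall z, normc z <= 1 -> normc (g z - p.[z]) <= e.
Proof.
move=> e0; have [n n0 hn] := fejer_approx e0.
have [U UU sU] := ex_ultra_nat.
have [c hc] := circle_coef f UU sU.
pose p : {poly R[i]} := n%:R^-1 *: \sum_(i < n) \sum_(j < n)
  (if (i <= j)%N then c (j - i)%N *: 'X^(j - i) else 0).
have inside z : z != 0 -> normc z < 1 -> normc (g z - p.[z]) <= e.
  move=> z0 z1.
  have : ulim U (fun m => seg m (fun t => g (z * expc t) * fejer n t) 0 T) p.[z].
    rewrite /p hornerZ horner_sum.
    have := ulimZ UU n%:R^-1 (ulim_sum UU (index_enum 'I_n) (fun i : 'I_n =>
      ulim_sum UU (index_enum 'I_n) (fun j : 'I_n => hc i j z z0 z1))).
    congr ulim.
      apply/funext => m; rewrite /fejer.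
      under eq_bigr do rewrite -seg_sum.
      rewrite -seg_sum -segZ; apply: eq_seg => t.
      rewrite mulrCA; congr (_ * _); rewrite mulr_sumr; apply: eq_bigr => i _.
      by rewrite mulr_sumr.
    congr (_ * _); apply: eq_bigr => i _; rewrite horner_sum; apply: eq_bigr => j _.
    by case: ifP => _; rewrite ?horner0 // hornerZ hornerXn.
  move=> hu; rewrite normcB; apply: (ulim_le UU hu).
  have : U (fun m => (n <= m)%N) by apply: sU; exact: nbhs_infty_ge.
  by apply: filterS => m nm; apply: hn (ltW z1); rewrite (leq_trans nm)// ltnW// ltn_expl.
exists p => z z1; apply/ler_addgt0Pr => d d0; have d2 : 0 < d / 2 by rewrite divr_gt0.
have [d1 d10 h1] := disc_ext_cont f z1 d2.
have [d3 d30 h3] := cdiff_cont (cdiff_horner p z) d2.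
pose s := Num.min (Num.min d1 d3 / 2) (1 / 2).
have m0 : 0 < Num.min d1 d3 by rewrite lt_min d10.
have s0 : 0 < s by rewrite lt_min !divr_gt0.
have s1 : s <= 1 / 2 by rewrite ge_min lexx orbT.
have s2 : s < Num.min d1 d3 by rewrite gt_min ltr_pdivrMr// ltr_pMr// ltr1n.
have [w [w0 w1 wz]] : exists w : R[i], [/\ w != 0, normc w < 1 & normc (w - z) <= s].
  have [->|z0] := eqVneq z 0.
    exists s%:C; rewrite subr0 normcR gtr0_norm//; split => //.
      by rewrite eq_complex /= eqxx andbT gt_eqF.
    by apply: le_lt_trans s1 _; lra.
  have e1 : (1 - s)%:C * z - z = (- s)%:C * z by rewrite rmorphB rmorphN rmorph1; ring.
  exists ((1 - s)%:C * z); rewrite e1 !normcM !normcR normrN (gtr0_norm s0) (@ger0_norm _ (1 - s)); last lra.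
  split; last by rewrite ler_piMr// ltW.
    by rewrite mulf_neq0// eq_complex /= eqxx andbT; apply/eqP; lra.
  apply: (@le_lt_trans _ _ ((1 - s) * 1)); last lra.
  by rewrite ler_wpM2l//; lra.
have wlt : normc (w - z) < Num.min d1 d3 by exact: le_lt_trans wz s2.
move: wlt; rewrite lt_min => /andP[k1 k3].
have := h1 _ (ltW w1) k1; have := h3 _ k3; have := inside _ w0 w1.
rewrite (_ : g z - p.[z] = (g w - p.[w]) + (g z - g w) + (p.[w] - p.[z])); last by ring.
move=> q1 q2 q3; apply: le_trans (le_normcD _ _) _.
have q4 := le_normcD (g w - p.[w]) (g z - g w); rewrite [normc (g z - _)]normcB in q4.
lra.
Qed.

End Fejer.

(** * Real inner products and the Hilbert space of square-summable sequences *)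

Section InnerProduct.
Variable R : realType.

(** A complex inner product encoded by its real part, which determines it; the
rule ipZl expresses sesquilinearity.  Only real numbers enter the estimates. *)
Record is_ip (V : lmodType R[i]) (ip : V -> V -> R) : Prop := IsIp {
  ipC : forall u v, ip u v = ip v u ;
  ipDl : forall u v w, ip (u + v) w = ip u w + ip v w ;
  ipZl : forall c u v, ip (c *: u) v = ip u (c^* *: v) ;
  ipRl : forall (r : R) u v, ip (r%:C *: u) v = r * ip u v ;
  ip_ge0 : forall u, 0 <= ip u u ;
  ip_eq0 : forall u, ip u u = 0 -> u = 0
}.

Variables (V : lmodType R[i]) (ip : V -> V -> R).
Hypothesis hip : is_ip ip.
Implicit Types (u v w : V) (c : R[i]).

Lemma ip0l v : ip 0 v = 0.
Proof. by rewrite -(scale0r (0 : V)) (ipRl hip 0) mul0r. Qed.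

Lemma ip0r v : ip v 0 = 0.
Proof. by rewrite ipC // ip0l. Qed.

Lemma ipNl u v : ip (- u) v = - ip u v.
Proof.
have -> : - u = (-1)%:C *: u by rewrite rmorphN rmorph1 scaleN1r.
by rewrite ipRl // mulN1r.
Qed.

Lemma ipNr u v : ip u (- v) = - ip u v.
Proof. by rewrite ipC // ipNl ipC. Qed.

Lemma ipDr u v w : ip u (v + w) = ip u v + ip u w.
Proof. by rewrite ipC // ipDl // !(ipC hip u). Qed.

Lemma ipBl u v w : ip (u - v) w = ip u w - ip v w.
Proof. by rewrite ipDl // ipNl. Qed.

Lemma ipBr u v w : ip u (v - w) = ip u v - ip u w.
Proof. by rewrite ipDr // ipNr. Qed.

Lemma ipZr c u v : ip u (c *: v) = ip (c^* *: u) v.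
Proof. by rewrite ipC // ipZl // ipC. Qed.

Lemma ipRr (r : R) u v : ip u (r%:C *: v) = r * ip u v.
Proof. by rewrite ipC // ipRl // ipC. Qed.

Lemma ip_ext u v : (forall w, ip u w = ip v w) -> u = v.
Proof.
move=> h; apply/eqP; rewrite -subr_eq0; apply/eqP; apply: (ip_eq0 hip).
by rewrite ipBl h subrr.
Qed.

Definition nrm u : R := Num.sqrt (ip u u).

Lemma nrm_ge0 u : 0 <= nrm u. Proof. exact: sqrtr_ge0. Qed.

Lemma nrm_sqr u : nrm u ^+ 2 = ip u u.
Proof. by rewrite sqr_sqrtr// (ip_ge0 hip). Qed.

Lemma nrm0 : nrm 0 = 0. Proof. by rewrite /nrm ip0l sqrtr0. Qed.

Lemma nrm0_eq0 u : nrm u = 0 -> u = 0.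
Proof. by move=> h; apply: (ip_eq0 hip); rewrite -nrm_sqr h expr0n. Qed.

Lemma nrmN u : nrm (- u) = nrm u.
Proof. by rewrite /nrm ipNl ipNr opprK. Qed.

Lemma nrmZ c u : nrm (c *: u) = normc c * nrm u.
Proof.
rewrite /nrm ipZl // scalerA.
have -> : c^* * c = (normc c ^+ 2)%:C by rewrite rmorphXn /= -normcEc sqr_normc mulrC.
by rewrite ipRr sqrtrM ?sqr_ge0// sqrtr_sqr ger0_norm// normc_ge0.
Qed.

Lemma cauchy_schwarz u v : ip u v <= nrm u * nrm v.
Proof.
have [u0|u0] := eqVneq (nrm u) 0.
  by rewrite (nrm0_eq0 u0) ip0l nrm0 mul0r.
have [v0|v0] := eqVneq (nrm v) 0.
  by rewrite (nrm0_eq0 v0) ip0r nrm0 mulr0.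
have up : 0 < nrm u by rewrite lt_neqAle eq_sym u0 nrm_ge0.
have vp : 0 < nrm v by rewrite lt_neqAle eq_sym v0 nrm_ge0.
have := ip_ge0 hip ((nrm v)%:C *: u - (nrm u)%:C *: v).
rewrite ipBl !ipBr !(ipRl hip) !ipRr -!nrm_sqr (ipC hip v u) => h.
have : 0 <= (2 * nrm u * nrm v) * (nrm u * nrm v - ip u v).
  by move: h; rewrite (_ : _ - _ - _ = (2 * nrm u * nrm v) * (nrm u * nrm v - ip u v)); last by ring.
by rewrite pmulr_rge0 ?subr_ge0// !mulr_gt0.
Qed.

Lemma nrmD u v : nrm (u + v) <= nrm u + nrm v.
Proof.
rewrite -(@ler_pXn2r _ 2) ?nnegrE ?addr_ge0 ?nrm_ge0//.
rewrite nrm_sqr ipDl // !ipDr -!nrm_sqr (ipC hip v u).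
have := cauchy_schwarz u v; rewrite sqrrD; lra.
Qed.

Lemma nrmB u v : nrm (u - v) = nrm (v - u).
Proof. by rewrite -nrmN opprB. Qed.

Lemma nrm_triangle u v w : nrm (u - w) <= nrm (u - v) + nrm (v - w).
Proof. by rewrite -{1}(subrK v u) -addrA; exact: nrmD. Qed.

End InnerProduct.

Section ProdIp.
Variables (R : realType) (V : lmodType R[i]) (ip : V -> V -> R) (n : nat).
Hypothesis hip : is_ip ip.

Definition ipn (u v : 'I_n -> V) : R := \sum_(i < n) ip (u i) (v i).

Lemma ipn_is_ip : is_ip ipn.
Proof.
split.
- by move=> u v; apply: eq_bigr => i _; exact: ipC.
- by move=> u v w; rewrite -big_split; apply: eq_bigr => i _; exact: ipDl.
- by move=> c u v; apply: eq_bigr => i _; exact: ipZl.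
- by move=> r u v; rewrite /ipn mulr_sumr; apply: eq_bigr => i _; exact: ipRl.
- by move=> u; apply: sumr_ge0 => i _; exact: ip_ge0.
- move=> u /eqP; rewrite psumr_eq0; last by move=> i _; exact: ip_ge0.
  move=> /allP h; apply/funext => i; apply: (ip_eq0 hip).
  by apply/eqP; have := h i; rewrite mem_index_enum; apply.
Qed.
End ProdIp.

Section L2.
Variable R : realType.

Definition l2_pred : {pred nat -> R[i]} :=
  fun u => `[< exists M : R, forall n, \sum_(k < n) normc (u k) ^+ 2 <= M >].

Lemma l2_submod : submod_closed l2_pred.
Proof.
split.
  by apply/asboolP; exists 0 => n; rewrite big1// => k _; rewrite normc0 expr0n.
move=> c u v /asboolP[M hM] /asboolP[N hN]; apply/asboolP.
exists (2 * (normc c ^+ 2 * M + N)) => n.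
apply: (@le_trans _ _ (2 * (normc c ^+ 2 * (\sum_(k < n) normc (u k) ^+ 2) +
  \sum_(k < n) normc (v k) ^+ 2))).
  rewrite mulr_sumr -big_split mulr_sumr; apply: ler_sum => k _ /=.
  have h1 := le_normcD (c * u k) (v k); have h0 := normc_ge0 (c * u k + v k).
  have : normc (c * u k + v k) ^+ 2 <= (normc (c * u k) + normc (v k)) ^+ 2.
    by rewrite ler_pXn2r ?nnegrE ?addr_ge0 ?normc_ge0.
  rewrite -exprMn -normcM; have := sqr_ge0 (normc (c * u k) - normc (v k)).
  rewrite [(c *: u + v) k]/(c * u k + v k).
  set a := normc (c * u k); set b := normc (v k); set d := normc _.
  rewrite sqrrB sqrrD; lra.
by rewrite ler_pM2l// lerD// ler_wpM2l// sqr_ge0.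
Qed.

HB.instance Definition _ := GRing.isSubmodClosed.Build R[i] (nat -> R[i]) l2_pred l2_submod.

Record l2 := L2 { l2_val :> nat -> R[i] ; l2_valP : l2_val \in l2_pred }.

HB.instance Definition _ := [isSub for l2_val].
HB.instance Definition _ := [Choice of l2 by <:].
HB.instance Definition _ := [SubChoice_isSubLmodule of l2 by <:].

Implicit Types (u v w : l2) (c : R[i]).

Lemma l2P u v : (forall k, u k = v k) -> u = v.
Proof. by move=> h; apply: val_inj; apply/funext. Qed.

Lemma l2_addE u v k : (u + v) k = u k + v k. Proof. by []. Qed.
Lemma l2_oppE u k : (- u) k = - u k. Proof. by []. Qed.
Lemma l2_scaleE c u k : (c *: u) k = c * u k. Proof. by []. Qed.

Let term (a b : R[i]) : R := Re a * Re b + Im a * Im b.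
Let psum u v (n : nat) : R := \sum_(k < n) term (u k) (v k).

Let psum_sqr u n : psum u u n = \sum_(k < n) normc (u k) ^+ 2.
Proof. by apply: eq_bigr => k _; rewrite normc_sqr /term !expr2. Qed.

Let psum_mono u : nondecreasing_seq (psum u u).
Proof.
apply/nondecreasing_seqP => n; rewrite !psum_sqr big_ord_recr /= lerDl sqr_ge0 //.
Qed.

Let psum_cvg_sqr u : cvgn (psum u u).
Proof.
apply: nondecreasing_is_cvgn; first exact: psum_mono.
have /asboolP[M hM] := l2_valP u.
by exists M => _ [n _ <-]; rewrite psum_sqr.
Qed.

Let psumC u v n : psum u v n = psum v u n.
Proof. by apply: eq_bigr => k _; rewrite /term mulrC [in X in _ + X]mulrC. Qed.

Let psumD u v w n : psum (u + v) w n = psum u w n + psum v w n.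
Proof.
rewrite -big_split; apply: eq_bigr => k _; rewrite /term [(u + v) k]/(u k + v k).
by case: (u k) (v k) => a b [c d] /=; ring.
Qed.

Let psumZ c u v n : psum (c *: u) v n = psum u (c^* *: v) n.
Proof.
apply: eq_bigr => k _; rewrite /term [(c *: u) k]/(c * u k) [(c^* *: v) k]/(c^* * v k).
by case: c (u k) (v k) => a b [a1 b1] [a2 b2] /=; ring.
Qed.

Let psumR (r : R) u v n : psum (r%:C *: u) v n = r * psum u v n.
Proof.
rewrite mulr_sumr; apply: eq_bigr => k _; rewrite /term [(r%:C *: u) k]/(r%:C * u k).
by case: (u k) (v k) => a1 b1 [a2 b2] /=; ring.
Qed.

Let psumN u v n : psum (- u) v n = - psum u v n.
Proof.
by rewrite -mulN1r -psumR rmorphN rmorph1 scaleN1r.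
Qed.

Let psum_cvg u v : cvgn (psum u v).
Proof.
have -> : psum u v = (fun n => 4^-1 * (psum (u + v) (u + v) n - psum (u - v) (u - v) n)).
  apply/funext => n.
  have E x y z : psum x (y + z) n = psum x y n + psum x z n.
    by rewrite psumC psumD !(psumC _ x).
  by rewrite !psumD !E !psumN !(psumC _ (- v)) !psumN (psumC v u); field.
apply: cvgP; apply: cvgM; first exact: cvg_cst.
by apply: cvgB; exact: psum_cvg_sqr.
Qed.

(** The real part of the inner product of l2. *)
Definition rip u v : R := limn (psum u v).

Let rip_cvg u v : psum u v @ \oo --> rip u v.
Proof. exact: psum_cvg. Qed.

Lemma rip_partial u v :
  (fun n => \sum_(k < n) (Re (u k) * Re (v k) + Im (u k) * Im (v k))) @ \oo --> rip u v.
Proof. exact: rip_cvg. Qed.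

Lemma rip_is_ip : is_ip rip.
Proof.
split.
- by move=> u v; rewrite /rip; congr (limn _); apply/funext => n; exact: psumC.
- move=> u v w; apply: cvg_lim => //.
  have -> : psum (u + v) w = (fun n => psum u w n + psum v w n).
    by apply/funext => n; exact: psumD.
  by apply: cvgD; exact: rip_cvg.
- by move=> c u v; rewrite /rip; congr (limn _); apply/funext => n; exact: psumZ.
- move=> r u v; apply: cvg_lim => //.
  have -> : psum (r%:C *: u) v = (fun n => r * psum u v n).
    by apply/funext => n; exact: psumR.
  by apply: cvgM; [exact: cvg_cst | exact: rip_cvg].
- move=> u; apply: limr_ge; first exact: psum_cvg.
  by apply: nearW => n; rewrite psum_sqr sumr_ge0// => k _; rewrite sqr_ge0.
- move=> u h; apply: l2P => k.
  have : psum u u k.+1 <= 0.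
    rewrite -h; exact: (nondecreasing_cvgn_le (@psum_mono u) (@psum_cvg u u)).
  rewrite psum_sqr big_ord_recr /= => hk.
  have q : 0 <= \sum_(i < k) normc (u i) ^+ 2 by apply: sumr_ge0 => i _; rewrite sqr_ge0.
  apply: eq0_normc; apply/eqP; rewrite -sqrf_eq0 eq_le sqr_ge0 andbT.
  by apply: le_trans hk; rewrite lerDr.
Qed.

Definition hn u : R := nrm rip u.

Lemma psum_le_hn u n : \sum_(k < n) normc (u k) ^+ 2 <= hn u ^+ 2.
Proof.
rewrite (nrm_sqr rip_is_ip) -psum_sqr.
exact: (nondecreasing_cvgn_le (@psum_mono u) (@psum_cvg u u)).
Qed.

Lemma hn_le u (M : R) : 0 <= M ->
  (forall n, \sum_(k < n) normc (u k) ^+ 2 <= M ^+ 2) -> hn u <= M.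
Proof.
move=> M0 h; rewrite -(@ler_pXn2r _ 2) ?nnegrE ?nrm_ge0// (nrm_sqr rip_is_ip).
by apply: limr_le; [exact: psum_cvg | apply: nearW => n; rewrite psum_sqr].
Qed.

Lemma coord_le_hn u k : normc (u k) <= hn u.
Proof.
rewrite -(@ler_pXn2r _ 2) ?nnegrE ?nrm_ge0 ?normc_ge0//.
apply: le_trans (psum_le_hn u k.+1); rewrite big_ord_recr /= lerDr.
by apply: sumr_ge0 => i _; rewrite sqr_ge0.
Qed.

Lemma rip_fin u v n : (forall k, (n <= k)%N -> v k = 0) ->
  rip u v = \sum_(k < n) (Re (u k) * Re (v k) + Im (u k) * Im (v k)).
Proof.
move=> hv; apply: cvg_lim => //.
apply: (cvg_trans _ (@cvg_cst _ (psum u v n) nat \oo _)).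
apply: near_eq_cvg; exists n => // m /= nm; rewrite /psum.
rewrite -(subnKC nm) big_split_ord /= [X in _ + X]big1 ?addr0// => k _.
by rewrite /term hv ?leq_addr //= !mulr0 addr0.
Qed.

Definition fin_pred n (u : nat -> R[i]) := forall k, (n <= k)%N -> u k = 0.

Lemma fin_in_l2 n (u : nat -> R[i]) : fin_pred n u -> u \in l2_pred.
Proof.
move=> hu; apply/asboolP; exists (\sum_(k < n) normc (u k) ^+ 2) => m.
have [mn|/ltnW nm] := leqP m n.
  pose S N := \sum_(k < N) normc (u k) ^+ 2; rewrite -/(S m) -/(S n) -(subnKC mn).
  rewrite /S big_split_ord /= lerDl.
  by apply: sumr_ge0 => i _; rewrite sqr_ge0.
pose S N := \sum_(k < N) normc (u k) ^+ 2; rewrite -/(S m) -/(S n) -(subnKC nm).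
rewrite /S big_split_ord /= [X in _ + X]big1 ?addr0// => k _.
by rewrite hu ?leq_addr// normc0 expr0n.
Qed.

Definition ev_fun (n : nat) (k : nat) : R[i] := (k == n)%:R.

Lemma ev_fin n : fin_pred n.+1 (ev_fun n).
Proof. by move=> k nk; rewrite /ev_fun gtn_eqF. Qed.

Definition ev n : l2 := L2 (fin_in_l2 (@ev_fin n)).

Lemma ev_val n k : ev n k = (k == n)%:R.
Proof. by []. Qed.

Lemma rip_ev u n : rip u (ev n) = Re (u n).
Proof.
rewrite (@rip_fin u (ev n) n.+1 (@ev_fin n)) big_ord_recr big1 /= ?add0r; last first.
  by move=> k _; rewrite /ev_fun ltn_eqF //= !mulr0 addr0.
by rewrite /ev_fun eqxx /= mulr1 mulr0 addr0.
Qed.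

Lemma hn_ev n : hn (ev n) = 1.
Proof. by rewrite /hn /nrm rip_ev ev_val eqxx sqrtr1. Qed.

(** Completeness with explicit rates: the limit is taken coordinatewise along an
ultrafilter, and the bounds pass to finite partial sums. *)
Lemma l2_complete (x : nat -> l2) (c : nat -> R) :
  (forall n m, (n <= m)%N -> hn (x m - x n) <= c n) ->
  exists y, forall n, hn (y - x n) <= c n.
Proof.
move=> hx; have [U UU sU] := ex_ultra_nat.
have c0 n : 0 <= c n by apply: le_trans (hx n n (leqnn _)); exact: nrm_ge0.
have hb n k : normc (x n k) <= c 0%N + hn (x 0%N).
  apply: le_trans (coord_le_hn _ _) _.
  rewrite -[x n](subrK (x 0%N)); apply: le_trans (nrmD rip_is_ip _ _) _.
  by rewrite lerD2r hx.
have /choice[y hy] k := @ulim_exC R U UU (fun n => x n k) _ (fun n => hb n k).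
have part n N : \sum_(k < N) normc (y k - x n k) ^+ 2 <= c n ^+ 2.
  apply/ler_addgt0Pr => e e0.
  pose M := c 0%N + hn (x 0%N) + c 0%N + hn (x 0%N) + 1.
  have hM : 0 < M.
    by rewrite /M ltr_wpDl// !addr_ge0// ?nrm_ge0.
  pose d := Num.min 1 (e / (N.+1%:R * (2 * M + 1))).
  have q0 : 0 < N.+1%:R * (2 * M + 1) by rewrite mulr_gt0 ?ltr0n// ltr_wpDl// mulr_ge0// ltW.
  have d0 : 0 < d by rewrite lt_min ltr01 divr_gt0.
  have d1 : d <= 1 by rewrite ge_min lexx.
  have dE : d * (2 * M + 1) * N.+1%:R <= e.
    by rewrite -mulrA (mulrC (2 * M + 1)) -ler_pdivlMr// ge_min lexx orbT.
  have : U (fun m => forall k, (k < N)%N -> normc (x m k - y k) < d).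
    elim: (N) => [|K IH]; first by apply: filterE.
    apply: filterS (filterI IH (hy K d d0)) => m [h1 h2] k.
    by rewrite ltnS leq_eqVlt => /orP[/eqP ->|/h1].
  have hU : U (fun m => (n <= m)%N) by apply: sU; exact: nbhs_infty_ge.
  move=> h1; have [m [h2 h3]] := filter_ex (filterI h1 hU).
  have := psum_le_hn (x m - x n) N.
  have : hn (x m - x n) ^+ 2 <= c n ^+ 2.
    by rewrite ler_pXn2r ?nnegrE ?nrm_ge0// hx.
  move=> q1 q2; apply: (@le_trans _ _ (\sum_(k < N) (normc (x m k - x n k) ^+ 2 + d * (2 * M + 1)))).
    apply: ler_sum => k _.
    have t : normc (y k - x n k) <= normc (x m k - x n k) + d.
      apply: le_trans (normc_triangle _ (x m k) _) _; rewrite addrC lerD2l ltW// normcB.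
      exact: h2.
    have t2 : normc (x m k - x n k) <= M.
      apply: le_trans (le_normcD _ _) _; rewrite normcN.
      by have := hb m k; have := hb n k; rewrite /M; lra.
    apply: (@le_trans _ _ ((normc (x m k - x n k) + d) ^+ 2)).
      by rewrite ler_pXn2r ?nnegrE ?addr_ge0 ?normc_ge0 ?(ltW d0).
    rewrite sqrrD -addrA lerD2l.
    have : d * normc (x m k - x n k) <= d * M by rewrite ler_pM2l.
    have : d ^+ 2 <= d by rewrite expr2 ler_piMl// ltW.
    by lra.
  rewrite big_split /= sumr_const card_ord -[_ *+ N]mulr_natr; apply: lerD; first exact: le_trans q1.
  apply: le_trans dE; apply: ler_wpM2l; last by rewrite ler_nat.
  by rewrite mulr_ge0 ?(ltW d0)// addr_ge0// mulr_ge0// ltW.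
have yl2 : y \in l2_pred.
  have z2 : (fun k => y k - x 0%N k) \in l2_pred by apply/asboolP; exists (c 0%N ^+ 2).
  have -> : y = (fun k => y k - x 0%N k) + l2_val (x 0%N).
    by apply/funext => k; rewrite !fctE subrK.
  by apply: rpredD z2 (l2_valP _).
exists (L2 yl2) => n; apply: hn_le => // N.
exact: part.
Qed.

End L2.

(** * The C*-algebra of bounded families of operators *)

Section OperatorFamilies.
Variables (R : realType) (I : Type) (V : lmodType R[i]) (ip : V -> V -> R).
Hypothesis hip : is_ip ip.
Implicit Types (S T : I -> V -> V) (u v w : V) (c : R[i]) (M : R).
Local Notation nm := (nrm ip).

Definition bnd T M := forall i u, nm (T i u) <= M * nm u.
Definition adjoint T T' := forall i u v, ip (T i u) v = ip u (T' i v).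
Definition lin T := forall i, linear (T i).
(** A uniformly bounded family of linear operators that have adjoints.  The
adjoints are part of the condition, so that their existence has to be proved only
for the concrete families at hand. *)
Definition adjointable T := exists M T', [/\ 0 <= M, lin T, bnd T M & adjoint T T'].
Definition onrm T : R := sup [set x | exists i u, nm u <= 1 /\ x = nm (T i u)].

Lemma adjoint_lin T T' : lin T -> adjoint T T' -> lin T'.
Proof.
move=> l a i c u v; apply: (ip_ext hip) => w.
have -> : ip (T' i (c *: u + v)) w = ip (c^* *: T i w) u + ip (T i w) v.
  by rewrite (ipC hip) -a (ipDr hip) (ipZr hip).
rewrite (ipDl hip) (ipZl hip) !(ipC hip (T' i _)) -!a; congr (ip _ _ + _).
have l0 : T i 0 = 0.
  by have := l i (-1) 0 0; rewrite scaleN1r oppr0 addr0 scaleN1r addNr.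
by have := l i c^* w 0; rewrite !addr0 l0 addr0.
Qed.

Lemma adjoint_sym T T' : adjoint T T' -> adjoint T' T.
Proof. by move=> a i u v; rewrite (ipC hip) -a (ipC hip). Qed.

Lemma adjoint_uniq T T1 T2 : adjoint T T1 -> adjoint T T2 -> T1 = T2.
Proof.
move=> a1 a2; apply/funext => i; apply/funext => u; apply: (ip_ext hip) => w.
by rewrite (ipC hip) -a1 a2 (ipC hip).
Qed.

Lemma adjoint_bnd T T' M : 0 <= M -> bnd T M -> adjoint T T' -> bnd T' M.
Proof.
move=> M0 b a i u; have [h|h] := eqVneq (nm (T' i u)) 0.
  by rewrite h mulr_ge0// nrm_ge0.
have p : 0 < nm (T' i u) by rewrite lt_neqAle eq_sym h nrm_ge0.
rewrite -(ler_pM2l p) -expr2 nrm_sqr// -a.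
apply: le_trans (cauchy_schwarz hip _ _) _.
by rewrite mulrA (mulrC _ M); apply: ler_wpM2r; rewrite ?nrm_ge0.
Qed.

Let onrm_ub T M : 0 <= M -> bnd T M ->
  ubound [set x | exists i u, nm u <= 1 /\ x = nm (T i u)] M.
Proof.
move=> M0 b _ [i [u [u1 ->]]]; apply: le_trans (b i u) _.
by rewrite ler_piMr.
Qed.

Lemma onrm_le T M : 0 <= M -> bnd T M -> onrm T <= M.
Proof.
move=> M0 b; rewrite /onrm; set A := [set _ | _].
have [->|ne] := eqVneq A set0; first by rewrite sup0.
by apply: ge_sup; [exact/set0P | exact: onrm_ub].
Qed.

Lemma onrm_ge0 T : 0 <= onrm T.
Proof.
rewrite /onrm; set A := [set _ | _]; have [hA|/sup_out -> //] := pselect (has_sup A).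
have [[_ [i [u [u1 _]]]] ub] := hA.
apply: le_trans (nrm_ge0 ip (T i u)) _; apply: ub_le_sup => //.
by exists i, u.
Qed.

Lemma onrm_bnd T : adjointable T -> bnd T (onrm T).
Proof.
move=> [M [T' [M0 l b a]]] i u; have [h|h] := eqVneq (nm u) 0.
  by apply: le_trans (b i u) _; rewrite h !mulr0.
have p : 0 < nm u by rewrite lt_neqAle eq_sym h nrm_ge0.
rewrite -ler_pdivrMr//.
have -> : nm (T i u) / nm u = nm (T i ((nm u)^-1%:C *: u)).
  have := l i (nm u)^-1%:C u 0.
  have T0 : T i 0 = 0.
    by have := l i (-1) 0 0; rewrite scaleN1r oppr0 addr0 scaleN1r addNr.
  rewrite T0 !addr0 => ->; rewrite nrmZ// normcR ger0_norm ?invr_ge0 ?nrm_ge0//.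
  by rewrite mulrC.
apply: ub_le_sup; first by exists M; exact: onrm_ub.
exists i, ((nm u)^-1%:C *: u); split => //.
by rewrite nrmZ// normcR ger0_norm ?invr_ge0 ?nrm_ge0// mulVf.
Qed.

Lemma adjointableD S T : adjointable S -> adjointable T -> adjointable (S + T).
Proof.
move=> [M [S' [M0 l b a]]] [N [T' [N0 l' b' a']]]; exists (M + N), (S' + T'); split.
- exact: addr_ge0.
- by move=> i c u v; rewrite [LHS]/(S i _ + T i _) [(S + T) i u]/(S i u + T i u) [(S + T) i v]/(S i v + T i v) l l' scalerDr addrACA.
- by move=> i u; rewrite mulrDl; apply: le_trans (nrmD hip _ _) _; exact: lerD.
- by move=> i u v; rewrite [(S + T) i u]/(S i u + T i u) ipDl// a a' -ipDr.
Qed.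

Lemma adjointableZ c T : adjointable T -> adjointable (c *: T).
Proof.
move=> [M [T' [M0 l b a]]]; exists (normc c * M), (c^* *: T'); split.
- by rewrite mulr_ge0// normc_ge0.
- move=> i d u v; change (c *: T i (d *: u + v) = d *: (c *: T i u) + c *: T i v).
  by rewrite l scalerDr !scalerA mulrC.
- by move=> i u; rewrite nrmZ// -mulrA ler_wpM2l ?normc_ge0.
- move=> i u v; rewrite [(c *: T) i u]/(c *: T i u) [(c^* *: T') i v]/(c^* *: T' i v).
  have l' := adjoint_lin l a.
  rewrite ipZl// a; congr ip; have := l' i c^* v 0; rewrite !addr0 => ->.
  by have := l' i (-1) 0 0; rewrite scaleN1r oppr0 addr0 scaleN1r addNr => ->; rewrite addr0.
Qed.

Lemma adjointable0 : adjointable 0.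
Proof.
exists 0, 0; split => // [i c u v|i u|i u v].
- by change (0 = c *: 0 + 0 :> V); rewrite scaler0 addr0.
- by rewrite mul0r nrm0.
- by rewrite ip0l// ip0r.
Qed.

Definition ocomp S T : I -> V -> V := fun i u => S i (T i u).

Lemma bnd_comp S T M N : 0 <= M -> bnd S M -> bnd T N -> bnd (ocomp S T) (M * N).
Proof.
by move=> M0 b b' i u; apply: le_trans (b _ _) _; rewrite -mulrA ler_wpM2l.
Qed.

Lemma adjoint_comp S S' T T' : adjoint S S' -> adjoint T T' ->
  adjoint (ocomp S T) (ocomp T' S').
Proof. by move=> a a' i u v; rewrite /ocomp a a'. Qed.

Lemma adjointable_comp S T : adjointable S -> adjointable T -> adjointable (ocomp S T).
Proof.
move=> [M [S' [M0 l b a]]] [N [T' [N0 l' b' a']]]; exists (M * N), (ocomp T' S'); split.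
- exact: mulr_ge0.
- by move=> i c u v; rewrite /ocomp l' l.
- exact: bnd_comp.
- exact: adjoint_comp.
Qed.

Lemma adjointable_adj T T' : adjointable T -> adjoint T T' -> adjointable T'.
Proof.
move=> [M [T1 [M0 l b a1]]] a; exists M, T; split=> //.
- exact: adjoint_lin a.
- exact: adjoint_bnd b a.
- exact: adjoint_sym.
Qed.

Lemma onrmD S T : adjointable S -> adjointable T -> onrm (S + T) <= onrm S + onrm T.
Proof.
move=> hS hT; apply: onrm_le; first by rewrite addr_ge0 ?onrm_ge0.
move=> i u; rewrite mulrDl; apply: le_trans (nrmD hip _ _) _.
by apply: lerD; exact: onrm_bnd.
Qed.

Let onrmZ_le c T : adjointable T -> onrm (c *: T) <= normc c * onrm T.
Proof.
move=> hT; apply: onrm_le; first by rewrite mulr_ge0 ?normc_ge0 ?onrm_ge0.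
by move=> i u; rewrite nrmZ// -mulrA ler_wpM2l ?normc_ge0// onrm_bnd.
Qed.

Lemma onrmZ c T : adjointable T -> onrm (c *: T) = normc c * onrm T.
Proof.
move=> hT; apply/eqP; rewrite eq_le onrmZ_le//=.
have [->|c0] := eqVneq c 0; first by rewrite normc0 mul0r onrm_ge0.
have n0 : 0 < normc c.
  by rewrite lt_neqAle normc_ge0 andbT eq_sym; apply: contra c0 => /eqP/eq0_normc ->.
rewrite mulrC -ler_pdivlMr// mulrC -normcV.
have := @onrmZ_le c^-1 _ (adjointableZ c hT).
by rewrite scalerA mulVf// scale1r.
Qed.

Lemma onrm0_eq0 T : adjointable T -> onrm T = 0 -> T = 0.
Proof.
move=> hT h; apply/funext => i; apply/funext => u; apply: (nrm0_eq0 hip).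
by apply/eqP; rewrite eq_le nrm_ge0 andbT; have := onrm_bnd hT i u; rewrite h mul0r.
Qed.

Lemma onrm_comp S T : adjointable S -> adjointable T ->
  onrm (ocomp S T) <= onrm S * onrm T.
Proof.
move=> hS hT; apply: onrm_le; first by rewrite mulr_ge0 ?onrm_ge0.
by apply: bnd_comp; rewrite ?onrm_ge0//; exact: onrm_bnd.
Qed.

Lemma onrm_adj_le T T' : adjointable T -> adjoint T T' -> onrm T' <= onrm T.
Proof.
move=> hT a; apply: onrm_le; first exact: onrm_ge0.
by apply: adjoint_bnd a; [exact: onrm_ge0 | exact: onrm_bnd].
Qed.

(** The C*-identity, from |T u|^2 = <T^* T u, u> and the inequality of Cauchy and
Schwarz. *)
Lemma onrm_cstar T T' : adjointable T -> adjoint T T' ->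
  onrm (ocomp T' T) = onrm T ^+ 2.
Proof.
move=> hT a; have hT' := adjointable_adj hT a.
apply/eqP; rewrite eq_le; apply/andP; split.
  apply: le_trans (onrm_comp hT' hT) _; rewrite expr2 ler_wpM2r ?onrm_ge0//.
  exact: onrm_adj_le.
set K := onrm (ocomp T' T); have K0 : 0 <= K by exact: onrm_ge0.
rewrite -[leRHS](sqr_sqrtr K0) ler_pXn2r ?nnegrE ?onrm_ge0 ?sqrtr_ge0//.
apply: onrm_le; first exact: sqrtr_ge0.
move=> i u; rewrite -(@ler_pXn2r _ 2) ?nnegrE ?mulr_ge0 ?sqrtr_ge0//.
rewrite exprMn (sqr_sqrtr K0) [X in X <= _](nrm_sqr hip) a.
apply: le_trans (cauchy_schwarz hip _ _) _; rewrite mulrC expr2 mulrA ler_wpM2r ?nrm_ge0//.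
exact: (onrm_bnd (adjointable_comp hT' hT)).
Qed.

End OperatorFamilies.

(** Completeness reduced to sequences with prescribed rates, the form provided by
l2_complete. *)
Lemma normed_complete (R : realType) (V : normedModType R[i]) :
  (forall x : nat -> V, (forall n m, (n <= m)%N -> `|x m - x n| <= (n.+1%:R^-1)%:C) ->
     exists y, forall n, `|y - x n| <= (n.+1%:R^-1)%:C) ->
  forall F : set_system V, ProperFilter F -> cauchy F -> cvg F.
Proof.
move=> h F FF cF.
have e0 n : 0 < ((2 * n.+1%:R)^-1 : R)%:C by rewrite ltcR invr_gt0 mulr_gt0// ltr0n.
have [x hx] := choice (fun n => (cauchyP F).1 cF _ (e0 n)).
have hF n : F [set y | `|x n - y| < ((2 * n.+1%:R)^-1 : R)%:C].
  by have := hx n; rewrite -ball_normE.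
have [|y hy] := h x.
  move=> n m nm; have [z [/= h1 h2]] := filter_ex (filterI (hF n) (hF m)).
  rewrite (_ : x m - x n = (x m - z) - (x n - z)); last by rewrite opprB addrA subrK.
  apply: le_trans (ler_normB _ _) _; apply: le_trans (lerD (ltW h2) (ltW h1)) _.
  rewrite -rmorphD /= lecR.
  have : ((2 * m.+1%:R)^-1 : R) <= (2 * n.+1%:R)^-1.
    by rewrite lef_pV2 ?posrE ?mulr_gt0 ?ltr0n// ler_pM2l// ler_nat.
  have -> : (n.+1%:R^-1 : R) = (2 * n.+1%:R)^-1 + (2 * n.+1%:R)^-1.
    have : (n.+1%:R : R) != 0 by rewrite pnatr_eq0.
    by move: n.+1%:R => q q0; field.
  by move=> *; rewrite lerD2r.
apply/cvg_ex; exists y; apply/cvgrPdist_le => _ /cpos[e e1 ->].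
have [n hn] : exists n : nat, (e / 2)^-1 < n.+1%:R.
  exists (Num.bound (e / 2)^-1); apply: (@lt_trans _ _ (Num.bound (e / 2)^-1)%:R).
    by apply: archi_boundP; rewrite invr_ge0 divr_ge0// ltW.
  by rewrite ltr_nat.
have hn' : n.+1%:R^-1 <= e / 2.
  by rewrite -[leRHS]invrK lef_pV2 ?posrE ?invr_gt0 ?divr_gt0 ?ltr0n// ltW.
apply: filterS (hF n) => z /= hz.
rewrite (_ : y - z = (y - x n) + (x n - z)); last by rewrite addrA subrK.
apply: le_trans (ler_normD _ _) _; apply: le_trans (lerD (hy n) (ltW hz)) _.
rewrite -rmorphD /= lecR [leRHS](splitr e); apply: lerD => //.
apply: le_trans hn'; rewrite lef_pV2 ?posrE ?mulr_gt0 ?ltr0n//.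
by rewrite ler_peMl// ler1n.
Qed.

Section Bop.
Variables (R : realType) (I : pointedType).
Local Notation H := (l2 R).
Local Notation hip := (rip_is_ip R).

Definition bop_pred : {pred I -> H -> H} := fun T => `[< adjointable (@rip R) T >].

Lemma bop_submod : submod_closed bop_pred.
Proof.
split; first by apply/asboolP; exact: (adjointable0 _ hip).
move=> c S T /asboolP hS /asboolP hT; apply/asboolP.
by apply: (adjointableD hip) hT; exact: (adjointableZ hip).
Qed.

HB.instance Definition _ := GRing.isSubmodClosed.Build R[i] (I -> H -> H) bop_pred bop_submod.

(** The C*-algebra of bounded families of operators on l2 indexed by I, that is,
the product of I copies of B(l2). *)
Record bop := Bop { bop_val :> I -> H -> H ; bop_valP : bop_val \in bop_pred }.

HB.instance Definition _ := [isSub for bop_val].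
HB.instance Definition _ := [Choice of bop by <:].
HB.instance Definition _ := [SubChoice_isSubLmodule of bop by <:].

Implicit Types (a b : bop) (c : R[i]) (i : I) (u v : H).

Lemma bopP a b : (forall i u, a i u = b i u) -> a = b.
Proof. by move=> h; apply: val_inj; apply/funext => i; apply/funext => u; exact: h. Qed.

Lemma bop_adj a : adjointable (@rip R) a.
Proof. by have /asboolP := bop_valP a. Qed.

Lemma bop_linear a i : linear (a i).
Proof. by have [M [T' [_ l _ _]]] := bop_adj a; exact: l. Qed.

Lemma bop0 a i : a i 0 = 0.
Proof. by have := bop_linear a i (-1) 0 0; rewrite scaleN1r oppr0 addr0 scaleN1r addNr. Qed.

Lemma bopD a i u v : a i (u + v) = a i u + a i v.
Proof. by have := bop_linear a i 1 u v; rewrite !scale1r. Qed.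

Lemma bopZ a i c u : a i (c *: u) = c *: a i u.
Proof. by have := bop_linear a i c u 0; rewrite bop0 !addr0. Qed.

Lemma bopN a i u : a i (- u) = - a i u.
Proof. by rewrite -scaleN1r bopZ scaleN1r. Qed.

Lemma bopB a i u v : a i (u - v) = a i u - a i v.
Proof. by rewrite bopD bopN. Qed.

Lemma bop_sum a i (J : Type) (r : seq J) (P : pred J) (F : J -> H) :
  a i (\sum_(j <- r | P j) F j) = \sum_(j <- r | P j) a i (F j).
Proof. by elim/big_ind2: _ => [|x y z w <- <-|//]; rewrite ?bop0 ?bopD. Qed.

Lemma bop_addE a b i u : (a + b) i u = a i u + b i u. Proof. by []. Qed.
Lemma bop_scaleE c a i u : (c *: a) i u = c *: a i u. Proof. by []. Qed.
Lemma bop_oppE a i u : (- a) i u = - a i u. Proof. by []. Qed.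
Lemma bop_zeroE i u : (0 : bop) i u = 0. Proof. by []. Qed.

Definition bonrm a : R := onrm (@rip R) a.

Lemma bonrm_bnd a i u : hn (a i u) <= bonrm a * hn u.
Proof. exact: (onrm_bnd hip (bop_adj a)). Qed.

Lemma bonrm_le a (M : R) : 0 <= M -> (forall i u, hn (a i u) <= M * hn u) -> bonrm a <= M.
Proof. by move=> M0 h; apply: onrm_le. Qed.

Definition bop_norm a : R[i] := (bonrm a)%:C.

Let bop_normD a b : bop_norm (a + b) <= bop_norm a + bop_norm b.
Proof. by rewrite -rmorphD lecR; apply: (onrmD hip); exact: bop_adj. Qed.

Let bop_normZ c a : bop_norm (c *: a) = `|c| * bop_norm a.
Proof. by rewrite normcEc -rmorphM; congr (_%:C); apply: (onrmZ hip); exact: bop_adj. Qed.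

Let bop_norm0 a : bop_norm a = 0 -> a = 0.
Proof.
move=> [h]; apply: val_inj; apply: (onrm0_eq0 hip (bop_adj a)); exact: h.
Qed.

HB.instance Definition _ := @Lmodule_isNormed.Build R[i] bop bop_norm
  bop_normD bop_normZ bop_norm0.

Lemma bop_normE a : `|a| = (bonrm a)%:C. Proof. by []. Qed.

Definition bmul a b : bop := Bop (introT (asboolP _) (adjointable_comp (bop_adj a) (bop_adj b))).

Lemma bmulE a b i u : bmul a b i u = a i (b i u). Proof. by []. Qed.

Lemma bone_adjointable : adjointable (@rip R) (fun (_ : I) u => u).
Proof.
by exists 1, (fun=> id); split => // i u; rewrite mul1r.
Qed.

Definition bone : bop := Bop (introT (asboolP _) bone_adjointable).

Fact bstar_key a : exists T', adjoint (@rip R) a T' /\ adjointable (@rip R) T'.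
Proof.
have [M [T' [M0 l b h]]] := bop_adj a; exists T'; split => //.
exact: (adjointable_adj hip (bop_adj a)).
Qed.

Definition bstar a : bop := Bop (introT (asboolP _) (projT2 (cid (bstar_key a))).2).

Lemma bstarP a i u v : rip (a i u) v = rip u (bstar a i v).
Proof. exact: (projT2 (cid (bstar_key a))).1. Qed.

Lemma bstar_uniq a b : (forall i u v, rip (a i u) v = rip u (b i v)) -> bstar a = b.
Proof.
move=> h; apply: val_inj; apply: (adjoint_uniq hip _ h) => i u v; exact: bstarP.
Qed.

Lemma bop_complete (F : set_system bop) : ProperFilter F -> cauchy F -> cvg F.
Proof.
apply: normed_complete => x hx.
pose r n : R := n.+1%:R^-1.
have r0 n : 0 < r n by rewrite invr_gt0 ltr0n.
have rlim (e : R) : 0 < e -> exists n, r n < e.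
  move=> e0; have [n hn] : exists n : nat, e^-1 < n.+1%:R.
    exists (Num.bound e^-1); apply: (@lt_trans _ _ (Num.bound e^-1)%:R).
      by apply: archi_boundP; rewrite invr_ge0 ltW.
    by rewrite ltr_nat.
  by exists n; rewrite /r -[ltRHS]invrK ltf_pV2 ?posrE ?invr_gt0 ?ltr0n.
have hx1 n m i u : (n <= m)%N -> hn (x m i u - x n i u) <= r n * hn u.
  move=> nm; have := bonrm_bnd (x m - x n) i u; move/le_trans; apply.
  apply: ler_wpM2r; first exact: nrm_ge0.
  by have := hx n m nm; rewrite bop_normE lecR.
have hx2 n m i u : (n <= m)%N -> hn (bstar (x m) i u - bstar (x n) i u) <= r n * hn u.
  move=> nm; apply: (@adjoint_bnd _ _ _ _ hip (x m - x n) (bstar (x m) - bstar (x n))).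
  - exact: ltW.
  - by move=> j w; exact: hx1.
  - by move=> j w z; rewrite bop_addE bop_oppE (ipBl hip) !bstarP -(ipBr hip).
have L1 i u := l2_complete (fun n m nm => hx1 n m i u nm).
have L2 i u := l2_complete (fun n m nm => hx2 n m i u nm).
pose T i u := projT1 (cid (L1 i u)); pose T' i u := projT1 (cid (L2 i u)).
have hT i u n : hn (T i u - x n i u) <= r n * hn u by exact: (projT2 (cid (L1 i u))).
have hT' i u n : hn (T' i u - bstar (x n) i u) <= r n * hn u by exact: (projT2 (cid (L2 i u))).
have aT : adjoint (@rip R) T T'.
  move=> i u v; apply/eqP; rewrite -subr_eq0 -normr_eq0; apply/eqP/le_anti.
  rewrite normr_ge0 andbT; apply/ler_addgt0Pl => e e0; rewrite addr0.
  have q0 : 0 < 2 * (hn u * hn v) + 1 by rewrite ltr_wpDl// !mulr_ge0// nrm_ge0.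
  have [n hn1] := rlim _ (divr_gt0 e0 q0).
  have -> : rip (T i u) v - rip u (T' i v) =
      rip (T i u - x n i u) v - rip u (T' i v - bstar (x n) i v).
    by rewrite (ipBl hip) (ipBr hip) bstarP; ring.
  have cs (x1 y1 : H) : `|rip x1 y1| <= hn x1 * hn y1.
    rewrite ler_norml; apply/andP; split; last exact: (cauchy_schwarz hip).
    rewrite lerNl -(ipNl hip); apply: le_trans (cauchy_schwarz hip _ _) _.
    by rewrite (nrmN hip).
  apply: le_trans (ler_normB _ _) _.
  apply: le_trans (lerD (cs _ _) (cs _ _)) _.
  have : hn (T i u - x n i u) * hn v <= r n * hn u * hn v by rewrite ler_wpM2r// nrm_ge0.
  have : hn u * hn (T' i v - bstar (x n) i v) <= hn u * (r n * hn v) by rewrite ler_wpM2l// nrm_ge0.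
  have := ltW hn1; rewrite ler_pdivlMr// => h1 h2 h3.
  apply: (le_trans (lerD h3 h2)); have := r0 n; move: h1.
  set a := r n; set b := hn u; set c := hn v; rewrite mulrDr mulr1 => h1 a0.
  by rewrite (_ : a * b * c + b * (a * c) = a * (2 * (b * c))); [lra | ring].
have lT : lin T.
  move=> i c u v; apply/eqP; rewrite -subr_eq0; apply/eqP; apply: (nrm0_eq0 hip).
  apply/le_anti; rewrite nrm_ge0 andbT; apply/ler_addgt0Pl => e e0; rewrite addr0.
  pose q := hn (c *: u + v) + normc c * hn u + hn v.
  have q0 : 0 < q + 1 by rewrite ltr_wpDl// !addr_ge0 ?mulr_ge0 ?normc_ge0 ?nrm_ge0.
  have [n hn1] := rlim _ (divr_gt0 e0 q0).
  have -> : T i (c *: u + v) - (c *: T i u + T i v) = (T i (c *: u + v) - x n i (c *: u + v))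
      - c *: (T i u - x n i u) - (T i v - x n i v).
    rewrite bop_linear; apply: l2P => k.
    by rewrite !(l2_addE, l2_oppE, l2_scaleE); ring.
  apply: le_trans (nrmD hip _ _) _; rewrite (nrmN hip).
  apply: le_trans (lerD (nrmD hip _ _) (lexx _)) _; rewrite (nrmN hip).
  apply: le_trans (lerD (lerD (hT _ _ n) (lexx _)) (hT _ _ n)) _.
  rewrite (nrmZ hip); have := hT i u n; move: hn1; rewrite ltr_pdivlMr// => h1 h2.
  have : normc c * hn (T i u - x n i u) <= normc c * (r n * hn u).
    by rewrite ler_wpM2l ?normc_ge0.
  have gen (A B C D E X y : R) : 0 < A -> A * (B + C * D + E + 1) < y ->
      C * X <= C * (A * D) -> A * B + C * X + A * E <= y by move=> *; lra.
  exact: gen (r0 n) h1.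
have bT : adjointable (@rip R) T.
  exists (r 0%N + bonrm (x 0%N)), T'; split => //.
    by rewrite addr_ge0 ?onrm_ge0// ltW.
  move=> i u; rewrite -[T i u](subrK (x 0%N i u)); apply: le_trans (nrmD hip _ _) _.
  by rewrite mulrDl; apply: lerD; [exact: hT | exact: bonrm_bnd].
exists (Bop (introT (asboolP _) bT)) => n; rewrite bop_normE lecR.
by apply: bonrm_le; [exact: ltW | move=> i u; exact: hT].
Qed.

HB.instance Definition _ := Uniform_isComplete.Build bop bop_complete.

Let bmulA : associative bmul. Proof. by move=> a b d; exact: bopP. Qed.
Let bmul1l : left_id bone bmul. Proof. by move=> a; exact: bopP. Qed.
Let bmul1r : right_id bone bmul. Proof. by move=> a; exact: bopP. Qed.
Let bmulDl : left_distributive bmul +%R. Proof. by move=> a b d; exact: bopP. Qed.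
Let bmulDr : right_distributive bmul +%R.
Proof. by move=> a b d; apply: bopP => i u; rewrite bop_addE !bmulE bop_addE bopD. Qed.
Let bone_neq0 : bone != 0.
Proof.
apply/eqP => h; have := hn_ev R 0; have -> : ev R 0 = bone point (ev R 0) by [].
by rewrite h bop_zeroE /hn (nrm0 hip) => /eqP; rewrite eq_sym oner_eq0.
Qed.

HB.instance Definition _ := GRing.Zmodule_isNzRing.Build bop bmulA bmul1l bmul1r
  bmulDl bmulDr bone_neq0.

Let bmulZl c a b : c *: (a * b) = (c *: a) * b. Proof. exact: bopP. Qed.
HB.instance Definition _ := GRing.Lmodule_isLalgebra.Build R[i] bop bmulZl.
Let bmulZr c a b : c *: (a * b) = a * (c *: b).
Proof. by apply: bopP => i u; rewrite -[RHS]/(a i (c *: b i u)) bopZ. Qed.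
HB.instance Definition _ := GRing.Lalgebra_isAlgebra.Build R[i] bop bmulZr.

Lemma bop_mulE a b i u : (a * b) i u = a i (b i u). Proof. by []. Qed.
Lemma bop_oneE i u : (1 : bop) i u = u. Proof. by []. Qed.

Let bmul_linearl b : linear (bmul^~ b).
Proof. by move=> c a d; exact: bopP. Qed.
Let bmul_linearr a : linear (bmul a).
Proof. by move=> c b d; apply: bopP => i u; rewrite !bmulE bop_linear. Qed.
Let bnorm_mul a b : `|bmul a b| <= `|a| * `|b|.
Proof. by rewrite !bop_normE -rmorphM lecR; apply: (onrm_comp hip); exact: bop_adj. Qed.
Let bstarK : involutive bstar.
Proof. by move=> a; apply: bstar_uniq => i u v; rewrite (ipC hip) -bstarP (ipC hip). Qed.
Let bstar_antilinear c a b : bstar (c *: a + b) = c^* *: bstar a + bstar b.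
Proof.
apply: bstar_uniq => i u v; rewrite !bop_addE !bop_scaleE (ipDl hip) (ipZl hip).
by rewrite !bstarP (ipDr hip) bopZ.
Qed.
Let bstar_mul a b : bstar (bmul a b) = bmul (bstar b) (bstar a).
Proof. by apply: bstar_uniq => i u v; rewrite !bmulE !bstarP. Qed.
Let bnorm_starM a : `|bmul (bstar a) a| = `|a| ^+ 2.
Proof.
rewrite !bop_normE -rmorphXn; congr (_%:C).
by apply: (onrm_cstar hip (bop_adj a)) => i u v; exact: bstarP.
Qed.

Definition bop_cstar : cstarAlgebra R := @CStarAlgebra R bop bmul bstar bmulA
  bmul_linearl bmul_linearr bnorm_mul bstarK bstar_antilinear bstar_mul bnorm_starM.

End Bop.

(** * Real-valued norms and unitaries in a C*-algebra *)

Section RealNorm.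
Variables (R : realType) (V : normedModType R[i]).
Implicit Types (x y z : V).

(** The norm as a real number; the norm of a complex normed module takes its values
in the complex numbers. *)
Definition cn x : R := Re `|x|.

Lemma cnE x : `|x| = (cn x)%:C.
Proof. by rewrite /cn RRe_real// ger0_real. Qed.

Lemma cn_ge0 x : 0 <= cn x.
Proof. by rewrite -ler0c -cnE. Qed.

Lemma cn0 : cn 0 = 0 :> R. Proof. by rewrite /cn normr0. Qed.

Lemma cn_eq0 x : cn x = 0 -> x = 0.
Proof. by move=> h; apply/eqP; rewrite -normr_eq0 cnE h. Qed.

Lemma cnD x y : cn (x + y) <= cn x + cn y.
Proof. by rewrite -lecR rmorphD /= -!cnE; exact: ler_normD. Qed.

Lemma cnN x : cn (- x) = cn x. Proof. by rewrite /cn normrN. Qed.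

Lemma cnB x y : cn (x - y) = cn (y - x). Proof. by rewrite -cnN opprB. Qed.

Lemma cnZ c x : cn (c *: x) = normc c * cn x.
Proof. by apply: complexI; rewrite rmorphM /= -!cnE normrZ. Qed.

Lemma cn_triangle x y z : cn (x - z) <= cn (x - y) + cn (y - z).
Proof. by rewrite -{1}(subrK y x) -addrA; exact: cnD. Qed.

Lemma cn_small x K : (forall e : R, 0 < e -> e <= 1 -> cn x <= K * e) -> x = 0.
Proof.
move=> h; apply: cn_eq0; apply/eqP; rewrite eq_le cn_ge0 andbT leNgt; apply/negP => x0.
have K0 : 0 < K.
  by have := h 1 ltr01 (lexx _); rewrite mulr1; exact: lt_le_trans.
have e0 : 0 < Num.min 1 (cn x / (2 * K)) by rewrite lt_min ltr01 divr_gt0// mulr_gt0.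
have := h _ e0; rewrite ge_min lexx => /(_ isT); apply/negP; rewrite -ltNge.
apply: (@le_lt_trans _ _ (K * (cn x / (2 * K)))).
  by rewrite ler_pM2l// ge_min lexx orbT.
have -> : K * (cn x / (2 * K)) = cn x / 2 by field; rewrite gt_eqF.
by rewrite ltr_pdivrMr// ltr_pMr// ltr1n.
Qed.

Lemma closed_cnP (S : set V) :
  closed S <-> (forall x, (forall e : R, 0 < e -> exists2 y, S y & cn (x - y) <= e) -> S x).
Proof.
split=> [cS x h|h].
  apply: cS => B /nbhs_normP[_ /cpos[d d0 ->] hd].
  have d2 : 0 < d / 2 by rewrite divr_gt0.
  have [y Sy xy] := h _ d2; exists y; split=> //; apply: hd => /=.
  by rewrite cnE ltcR; apply: le_lt_trans xy _; rewrite ltr_pdivrMr// ltr_pMr// ltr1n.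
move=> x clx; apply: h => e e0.
have : nbhs x [set y | cn (x - y) < e].
  apply/nbhs_normP; exists e%:C; first by rewrite /= ltcR.
  by move=> y /=; rewrite cnE ltcR.
by move=> /clx[y [Sy /ltW xy]]; exists y.
Qed.
End RealNorm.

Lemma cseq_cvg (R : realType) (V : completeNormedModType R[i]) (x : nat -> V) :
  (forall e : R, 0 < e -> exists N, forall n m, (N <= n)%N -> (N <= m)%N -> cn (x n - x m) <= e) ->
  exists l, forall e : R, 0 < e -> exists N, forall n, (N <= n)%N -> cn (x n - l) <= e.
Proof.
move=> h; have : cvg (x @ \oo).
  apply: cauchy_cvg; apply: cauchy_exP => _ /cpos[e e0 ->].
  have e2 : 0 < e / 2 by rewrite divr_gt0.
  have [N hN] := h _ e2; exists (x N); exists N => // n /= Nn.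
  rewrite -ball_normE /= cnE ltcR; apply: le_lt_trans (hN N n (leqnn _) Nn) _.
  by rewrite ltr_pdivrMr// ltr_pMr// ltr1n.
move=> /cvg_ex[l hl]; exists l => e e0.
have /cvgrPdist_le/(_ e%:C) := hl; rewrite ltcR => /(_ e0)[N _ hN].
by exists N => n Nn; have := hN n Nn; rewrite cnE lecR cnB.
Qed.

Section CStarBasics.
Variables (R : realType) (A : cstarAlgebra R).
Implicit Types (a b d : A) (k : R[i]).
Local Notation "a ⋅ b" := (cs_mul a b) (at level 40, left associativity).

Lemma cs_mulDl a b d : (a + b) ⋅ d = a ⋅ d + b ⋅ d.
Proof. by have := cs_mul_linearl d 1 a b; rewrite !scale1r. Qed.
Lemma cs_mulDr a b d : a ⋅ (b + d) = a ⋅ b + a ⋅ d.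
Proof. by have := cs_mul_linearr a 1 b d; rewrite !scale1r. Qed.
Lemma cs_mul0l a : 0 ⋅ a = 0.
Proof. by apply: (addrI (0 ⋅ a)); rewrite -cs_mulDl !addr0. Qed.
Lemma cs_mul0r a : a ⋅ 0 = 0.
Proof. by apply: (addrI (a ⋅ 0)); rewrite -cs_mulDr !addr0. Qed.
Lemma cs_mulZl k a b : (k *: a) ⋅ b = k *: (a ⋅ b).
Proof. by have := cs_mul_linearl b k a 0; rewrite cs_mul0l !addr0. Qed.
Lemma cs_mulZr k a b : a ⋅ (k *: b) = k *: (a ⋅ b).
Proof. by have := cs_mul_linearr a k b 0; rewrite cs_mul0r !addr0. Qed.
Lemma cs_mulNl a b : (- a) ⋅ b = - (a ⋅ b).
Proof. by rewrite -scaleN1r cs_mulZl scaleN1r. Qed.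
Lemma cs_mulNr a b : a ⋅ (- b) = - (a ⋅ b).
Proof. by rewrite -scaleN1r cs_mulZr scaleN1r. Qed.
Lemma cs_mulBl a b d : (a - b) ⋅ d = a ⋅ d - b ⋅ d.
Proof. by rewrite cs_mulDl cs_mulNl. Qed.
Lemma cs_mulBr a b d : a ⋅ (b - d) = a ⋅ b - a ⋅ d.
Proof. by rewrite cs_mulDr cs_mulNr. Qed.
Let conj1 : (1 : R[i])^* = 1.
Proof. by apply/eqP; rewrite eq_complex /= oppr0 !eqxx. Qed.

Let conjN1 : (- 1 : R[i])^* = - 1.
Proof. by apply/eqP; rewrite eq_complex /= !oppr0 !eqxx. Qed.

Let cs_anti k a b : cs_star (k *: a + b) = (conjc k) *: cs_star a + cs_star b.
Proof. exact: cs_star_antilinear. Qed.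

Lemma cs_starD a b : cs_star (a + b) = cs_star a + cs_star b.
Proof. by have := cs_anti 1 a b; rewrite conj1 !scale1r. Qed.
Lemma cs_star0 : cs_star (0 : A) = 0.
Proof. by apply: (addrI (cs_star (0 : A))); rewrite -cs_starD !addr0. Qed.
Lemma cs_starZ k a : cs_star (k *: a) = conjc k *: cs_star a.
Proof. by have := cs_anti k a 0; rewrite cs_star0 !addr0. Qed.
Lemma cs_starN a : cs_star (- a) = - cs_star a.
Proof. by rewrite -scaleN1r cs_starZ conjN1 scaleN1r. Qed.
Lemma cs_starB a b : cs_star (a - b) = cs_star a - cs_star b.
Proof. by rewrite cs_starD cs_starN. Qed.

Lemma cn_mul a b : cn (a ⋅ b) <= cn a * cn b.
Proof. by rewrite -lecR rmorphM /= -!cnE; exact: cs_norm_mul. Qed.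
Lemma cn_starM a : cn (cs_star a ⋅ a) = cn a ^+ 2.
Proof. by apply: complexI; rewrite rmorphXn /= -!cnE; exact: cs_norm_starM. Qed.

Let cn_star_le a : cn a <= cn (cs_star a).
Proof.
have [->|a0] := eqVneq (cn a) 0; first exact: cn_ge0.
have p : 0 < cn a by rewrite lt_neqAle eq_sym a0 cn_ge0.
by rewrite -(ler_pM2r p) -expr2 -cn_starM; exact: cn_mul.
Qed.

Lemma cn_star a : cn (cs_star a) = cn a.
Proof. by apply/eqP; rewrite eq_le cn_star_le andbT -{2}(cs_starK a) cn_star_le. Qed.

Definition is_unit (e : A) := forall a, e ⋅ a = a /\ a ⋅ e = a.

Lemma unit_self_adjoint e : is_unit e -> cs_star e = e.
Proof.
move=> h; have q : e ⋅ cs_star e = cs_star e := (h _).1.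
by rewrite -[RHS]cs_starK -[in RHS]q cs_star_mul cs_starK q.
Qed.

Lemma unit_norm_le1 e : is_unit e -> cn e <= 1.
Proof.
move=> h; have := cn_starM e; rewrite (unit_self_adjoint h) (h e).1 => he.
have [->//|e0] := eqVneq (cn e) 0.
have E : cn e * cn e = cn e * 1 by rewrite mulr1 -expr2 -he.
by rewrite (mulfI e0 E).
Qed.

(** A self-adjoint h with |h| < 1 is the mean of the unitary h + i d and of its
adjoint, where d^2 = e - h^2.  Writing d = e - u, the equation becomes
u = (h^2 + u^2) / 2, and u is the fixed point of a contraction; being a limit of
polynomials in h, it commutes with h and is self-adjoint. *)
Lemma unitary_average e (h : A) : is_unit e -> cs_star h = h -> cn h < 1 ->
  exists2 w, cs_star w ⋅ w = e & h = 2^-1 *: (w + cs_star w).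
Proof.
move=> ue hs h1; have h0 := cn_ge0 h.
pose a := h ⋅ h; pose al : R := cn h ^+ 2.
have al1 : al < 1 by rewrite /al expr_lt1.
have al0 : 0 <= al by rewrite sqr_ge0.
have ha : cn a <= al by rewrite /al expr2; exact: cn_mul.
(* The ball of radius rho is stable under f since al <= 1, and f is a
   rho-contraction on it. *)
pose rho : R := (1 + al) / 2.
have rho0 : 0 <= rho by rewrite divr_ge0// addr_ge0.
have rho1 : rho < 1 by rewrite /rho; lra.
have rhoE : (al + rho ^+ 2) / 2 <= rho.
  have : 0 <= (1 - al) * (3 + al) by rewrite mulr_ge0//; lra.
  by rewrite /rho; lra.
pose f u := 2^-1 *: (a + u ⋅ u).
pose x n := iter n f 0.
have half2 : normc (2^-1 : R[i]) = 2^-1.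
  have -> : (2 : R[i]) = (2 : R)%:C by rewrite rmorph_nat.
  by rewrite normcV normcR ger0_norm.
have xb n : cn (x n) <= rho.
  elim: n => [|n IH]; first by rewrite cn0.
  apply: le_trans rhoE; rewrite /= cnZ half2 mulrC ler_pM2r ?invr_gt0//.
  apply: le_trans (cnD _ _) _; apply: lerD => //; rewrite expr2.
  by apply: le_trans (cn_mul _ _) _; apply: ler_pM; rewrite ?cn_ge0.
have sq (u v : A) : u ⋅ u - v ⋅ v = u ⋅ (u - v) + (u - v) ⋅ v.
  by rewrite cs_mulBr cs_mulBl addrA subrK.
have flip (u v : A) : cn u <= rho -> cn v <= rho -> cn (f u - f v) <= rho * cn (u - v).
  move=> hu hv; rewrite /f -scalerBr cnZ half2 opprD addrACA subrr add0r sq.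
  rewrite ler_pdivrMl//; apply: le_trans (cnD _ _) _.
  have := cn_mul u (u - v); have := cn_mul (u - v) v; have q := cn_ge0 (u - v).
  have : cn u * cn (u - v) <= rho * cn (u - v) by rewrite ler_wpM2r.
  have : cn (u - v) * cn v <= cn (u - v) * rho by rewrite ler_wpM2l.
  by lra.
have step n : cn (x n.+1 - x n) <= rho ^+ n.
  elim: n => [|n IH].
    by rewrite /x /= subr0 expr0 (le_trans (xb 1%N))// ltW.
  rewrite exprS; apply: le_trans (flip _ _ (xb n.+1) (xb n)) _.
  by rewrite ler_wpM2l.
have r1 : 0 < 1 - rho by rewrite subr_gt0.
have dist n m : cn (x (n + m)%N - x n) <= rho ^+ n / (1 - rho) * (1 - rho ^+ m).
  elim: m => [|m IH]; first by rewrite addn0 subrr cn0 expr0 subrr mulr0.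
  rewrite addnS; apply: le_trans (cn_triangle _ (x (n + m)%N) _) _.
  apply: le_trans (lerD (step _) IH) _; rewrite exprD exprS le_eqVlt; apply/orP; left.
  by apply/eqP; field; rewrite gt_eqF.
have dist' n m : (n <= m)%N -> cn (x m - x n) <= rho ^+ n / (1 - rho).
  move=> nm; rewrite -(subnKC nm); apply: le_trans (dist _ _) _.
  rewrite ler_piMr ?divr_ge0 ?exprn_ge0 ?(ltW r1)//.
  by rewrite gerBl exprn_ge0.
have small (e' : R) := @small_expr _ rho e' (introT andP (conj rho0 rho1)).
have [u hu] : exists l, forall e' : R, 0 < e' -> exists N, forall n, (N <= n)%N -> cn (x n - l) <= e'.
  apply: cseq_cvg => e' e0.
  have [N hN] := small _ (mulr_gt0 (divr_gt0 e0 (ltr0Sn _ 1)) r1).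
  exists N => n m Nn Nm; apply: le_trans (cn_triangle _ (x N) _) _.
  rewrite [leRHS](splitr e') (cnB (x N)); apply: lerD.
    by apply: le_trans (dist' _ _ Nn) _; rewrite ler_pdivrMr//; exact: hN.
  by apply: le_trans (dist' _ _ Nm) _; rewrite ler_pdivrMr//; exact: hN.
have lim_eq (F : A -> A) (K : R) : (forall n, F (x n) = 0) ->
    (forall v, cn (F v - F u) <= K * (1 + cn (v - u)) * cn (v - u)) -> 0 <= K -> F u = 0.
  move=> F0 Flip K0; apply: (@cn_small _ _ _ (K * 2)) => e' e0 e1.
  have [N hN] := hu _ e0; have := Flip (x N); rewrite F0 sub0r cnN => /le_trans; apply.
  have := hN N (leqnn _); set t := cn _ => te; have t0 : 0 <= t by exact: cn_ge0.
  rewrite -!mulrA ler_wpM2l//; apply: ler_pM => //; first by rewrite addr_ge0.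
  by rewrite (_ : 2 = 1 + 1 :> R)// lerD2l (le_trans te).
have us : cs_star u = u.
  apply/eqP; rewrite -subr_eq0; apply/eqP.
  apply: (lim_eq (fun v => cs_star v - v) 2) => // [n|v].
    apply/eqP; rewrite subr_eq0; apply/eqP; elim: n => [|n IH]; first exact: cs_star0.
    rewrite /x /= /f cs_starZ cs_starD cs_star_mul.
    by rewrite [cs_star (iter n f 0)]IH /a cs_star_mul hs conjc_inv conjc_nat.
  rewrite opprD opprK addrACA -cs_starB (addrC (- v)); apply: le_trans (cnD _ _) _.
  rewrite cn_star (cnB u v).
  have := cn_ge0 (v - u); set t := cn _ => t0; have : 0 <= t * t by rewrite mulr_ge0.
  by lra.
have uh : u ⋅ h = h ⋅ u.
  apply/eqP; rewrite -subr_eq0; apply/eqP.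
  apply: (lim_eq (fun v => v ⋅ h - h ⋅ v) (2 * cn h)) => [n|v|]; last by rewrite mulr_ge0.
    apply/eqP; rewrite subr_eq0; apply/eqP; elim: n => [|n IH]; first by rewrite cs_mul0l cs_mul0r.
    rewrite /x /= /f cs_mulZl cs_mulZr cs_mulDl cs_mulDr; congr (_ *: (_ + _)).
      by rewrite /a cs_mulA.
    by rewrite -[LHS]cs_mulA [iter n f 0 ⋅ h]IH !cs_mulA [iter n f 0 ⋅ h]IH.
  rewrite opprD opprK addrACA -cs_mulBl (_ : - (h ⋅ v) + h ⋅ u = - (h ⋅ (v - u))); last first.
    by rewrite cs_mulBr opprB addrC.
  apply: le_trans (cnD _ _) _; rewrite cnN.
  have := cn_mul (v - u) h; have := cn_mul h (v - u).
  have := cn_ge0 (v - u); set t := cn (v - u) => t0.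
  have : 0 <= cn h * (t * t) by rewrite !mulr_ge0.
  by lra.
have uf : u = f u.
  apply/eqP; rewrite -subr_eq0; apply/eqP; apply: (@cn_small _ _ _ (2 + cn u)) => e' e0 e1.
  have [N hN] := hu _ e0.
  have -> : u - f u = (u - x N.+1) + (f (x N) - f u) by rewrite addrA subrK.
  apply: le_trans (cnD _ _) _; rewrite cnB.
  have h3 := hN N.+1 (leqnSn _); have h4 := hN N (leqnn _).
  have ub : cn u <= rho + cn u by rewrite lerDr.
  have : cn (f (x N) - f u) <= (1 + cn u) * cn (x N - u).
    rewrite /f -scalerBr cnZ half2 opprD addrACA subrr add0r sq ler_pdivrMl//.
    apply: le_trans (cnD _ _) _.
    have := cn_mul (x N) (x N - u); have := cn_mul (x N - u) u.
    have q := cn_ge0 (x N - u); have := cn_ge0 u; have := xb N.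
    set A1 := cn (x N); set B1 := cn u; set t := cn (x N - u) => q1 q2 q3 q4.
    have : A1 * t <= t by rewrite ler_piMl// (le_trans q1)// ltW.
    have : 0 <= t * B1 by rewrite mulr_ge0.
    by lra.
  have : (1 + cn u) * cn (x N - u) <= (1 + cn u) * e' by rewrite ler_wpM2l// addr_ge0// cn_ge0.
  by lra.
have es := unit_self_adjoint ue.
pose d := e - u.
have ds : cs_star d = d by rewrite cs_starB es us.
have dh : d ⋅ h = h ⋅ d by rewrite cs_mulBl cs_mulBr (ue h).1 (ue h).2 uh.
have conji : ('i : R[i])^* = - 'i.
  by apply/eqP; rewrite eq_complex /= oppr0 !eqxx.
exists (h + 'i *: d); last first.
  rewrite cs_starD cs_starZ hs ds conji scaleNr addrACA subrr addr0.
  by rewrite -[h + h]mulr2n -[h *+ 2]scaler_nat scalerA mulVf ?scale1r// pnatr_eq0.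
rewrite cs_starD cs_starZ hs ds conji scaleNr.
have E1 : h ⋅ ('i *: d) = 'i *: (h ⋅ d) by rewrite cs_mulZr.
have E2 : ('i *: d) ⋅ h = 'i *: (h ⋅ d) by rewrite cs_mulZl dh.
have E3 : ('i *: d) ⋅ ('i *: d) = - (d ⋅ d).
  by rewrite cs_mulZl cs_mulZr scalerA -[_ * _]expr2 sqr_i scaleN1r.
rewrite cs_mulBl !cs_mulDr E1 E2 E3 opprB addrACA subrr addr0.
have -> : d ⋅ d = e - u - (u - u ⋅ u).
  by rewrite /d cs_mulBl !cs_mulBr !(ue _).1 (ue _).2.
have : 2 *: u = a + u ⋅ u by rewrite {1}uf scalerA mulfV ?scale1r// pnatr_eq0.
rewrite scaler_nat mulr2n => E.
have -> : h ⋅ h = u + (u - u ⋅ u) by rewrite addrA E addrK.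
by rewrite -[e - u - _]addrA -opprD addrC subrK.
Qed.

End CStarBasics.

(** * Star-homomorphisms, generated subalgebras and extension by density *)

Section StarHom.
Variable R : realType.
Implicit Types (A B Z : cstarAlgebra R).
Local Notation "a ⋅ b" := (cs_mul a b) (at level 40, left associativity).

Section HomBasics.
Variables (A Z : cstarAlgebra R) (s : A -> Z).
Hypothesis hs : star_hom s.

Lemma shD a b : s (a + b) = s a + s b.
Proof. by have := star_hom_linear hs 1 a b; rewrite !scale1r. Qed.
Lemma sh0 : s 0 = 0.
Proof. by apply: (addrI (s 0)); rewrite -shD !addr0. Qed.
Lemma shZ k a : s (k *: a) = k *: s a.
Proof. by have := star_hom_linear hs k a 0; rewrite sh0 !addr0. Qed.
Lemma shN a : s (- a) = - s a.
Proof. by rewrite -scaleN1r shZ scaleN1r. Qed.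
Lemma shB a b : s (a - b) = s a - s b.
Proof. by rewrite shD shN. Qed.

(** A unitary has norm at most 1 in any unital C*-algebra, hence so does the image
of a self-adjoint h with |h| < 1; the C*-identity gives the general case. *)
Lemma star_hom_contractive eA eZ : is_unit eA -> is_unit eZ -> s eA = eZ ->
  forall a, cn (s a) <= cn a.
Proof.
move=> uA uZ se.
have key h : cs_star h = h -> cn h < 1 -> cn (s h) <= 1.
  move=> h1 h2; have [w ww hw] := unitary_average uA h1 h2.
  have sw : cn (s w) <= 1.
    rewrite -(@expr_le1 _ 2)// ?cn_ge0// -cn_starM -(star_hom_star hs) -(star_hom_mul hs) ww se.
    exact: unit_norm_le1.
  rewrite hw shZ shD (star_hom_star hs) cnZ.
  have -> : normc (2^-1 : R[i]) = 2^-1.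
    have -> : (2 : R[i]) = (2 : R)%:C by rewrite rmorph_nat.
    by rewrite normcV normcR ger0_norm.
  rewrite ler_pdivrMl// mulr1; apply: le_trans (cnD _ _) _.
  by rewrite cn_star; lra.
move=> a; rewrite -(@ler_pXn2r _ 2) ?nnegrE ?cn_ge0// -cn_starM -(star_hom_star hs) -(star_hom_mul hs).
apply/ler_addgt0Pr => e e0; set c := cn a ^+ 2 + e.
have c0 : 0 < c by rewrite ltr_wpDl// sqr_ge0.
pose h := c^-1%:C *: (cs_star a ⋅ a).
have hh : cs_star h = h.
  by rewrite /h cs_starZ conjc_real cs_star_mul cs_starK.
have ch : cn h < 1.
  rewrite /h cnZ normcR ger0_norm ?invr_ge0 ?(ltW c0)// cn_starM ltr_pdivrMl// mulr1.
  by rewrite /c ltrDl.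
have := key _ hh ch; rewrite /h shZ cnZ normcR ger0_norm ?invr_ge0 ?(ltW c0)//.
by rewrite ler_pdivrMl// mulr1.
Qed.
End HomBasics.

Lemma star_hom_id A : star_hom (@id A).
Proof. by split. Qed.

Lemma star_hom_comp A B Z (s : A -> B) (t : B -> Z) :
  star_hom s -> star_hom t -> star_hom (t \o s).
Proof.
move=> hs ht; split => [k a b|a b|a] /=.
- by rewrite (star_hom_linear hs) (star_hom_linear ht).
- by rewrite (star_hom_mul hs) (star_hom_mul ht).
- by rewrite (star_hom_star hs) (star_hom_star ht).
Qed.

Lemma cs_mul_approx A (a b a' b' : A) (e : R) : cn (a - a') <= e -> cn (b - b') <= e -> e <= 1 ->
  cn (a ⋅ b - a' ⋅ b') <= (cn a' + cn b' + 1) * e.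
Proof.
move=> ha hb e1.
have -> : a ⋅ b - a' ⋅ b' = (a - a') ⋅ (b - b') + (a - a') ⋅ b' + a' ⋅ (b - b').
  by rewrite -cs_mulDr subrK cs_mulBl cs_mulBr addrA subrK.
apply: le_trans (cnD _ _) _; apply: le_trans (lerD (cnD _ _) (lexx _)) _.
have q1 : cn ((a - a') ⋅ (b - b')) <= 1 * e.
  apply: le_trans (cn_mul _ _) _; apply: ler_pM; rewrite ?cn_ge0//; exact: le_trans e1.
have q2 : cn ((a - a') ⋅ b') <= e * cn b'.
  by apply: le_trans (cn_mul _ _) _; rewrite ler_wpM2r ?cn_ge0.
have q3 : cn (a' ⋅ (b - b')) <= cn a' * e.
  by apply: le_trans (cn_mul _ _) _; rewrite ler_wpM2l ?cn_ge0.
by lra.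
Qed.

Lemma equalizer_subalgebra A Z (s t : A -> Z) : star_hom s -> star_hom t ->
  (forall a, cn (s a) <= cn a) -> (forall a, cn (t a) <= cn a) ->
  cstar_subalgebra [set a | s a = t a].
Proof.
move=> hs ht cs ct; split => [|k a b /= ea eb|a b /= ea eb|a /= ea|].
- by rewrite /= (sh0 hs) (sh0 ht).
- by rewrite (star_hom_linear hs) (star_hom_linear ht) ea eb.
- by rewrite (star_hom_mul hs) (star_hom_mul ht) ea eb.
- by rewrite (star_hom_star hs) (star_hom_star ht) ea.
- apply/closed_cnP => x h /=; apply/eqP; rewrite -subr_eq0; apply/eqP.
  apply: (@cn_small _ _ _ 2) => e e0 _; have [y /= yE xy] := h e e0.
  rewrite (_ : s x - t x = s (x - y) - t (x - y)); last first.
    by rewrite (shB hs) (shB ht) yE opprB addrA subrK.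
  apply: le_trans (cnD _ _) _; rewrite cnN.
  by have := cs (x - y); have := ct (x - y); lra.
Qed.

Lemma generated_sub A (G S : set A) : cstar_subalgebra S -> G `<=` S ->
  cstar_generated G = setT -> forall a, S a.
Proof.
move=> hS GS gen a; have : (setT : set A) a by [].
by rewrite -gen => /(_ S); apply; split.
Qed.

Lemma cstar_generated_subalgebra A (G : set A) : cstar_subalgebra (cstar_generated G).
Proof.
split => [|k a b ha hb|a b ha hb|a ha|].
- by move=> S [hS _]; exact: csub0.
- by move=> S [hS GS]; apply: (csub_linear hS); [exact: ha | exact: hb].
- by move=> S [hS GS]; apply: (csub_mul hS); [exact: ha | exact: hb].
- by move=> S [hS GS]; apply: (csub_star hS); exact: ha.
- apply/closed_cnP => x h S [hS GS].
  apply: (closed_cnP S).1 (csub_closed hS) _ _ => e e0.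
  by have [y yG xy] := h e e0; exists y => //; exact: yG.
Qed.

Lemma preimage_subalgebra A Z (s : A -> Z) (S : set Z) : star_hom s ->
  (forall a, cn (s a) <= cn a) -> cstar_subalgebra S -> cstar_subalgebra (s @^-1` S).
Proof.
move=> hs cs hS; split => [|k a b /= ea eb|a b /= ea eb|a /= ea|].
- by rewrite /= (sh0 hs); exact: csub0.
- by rewrite (star_hom_linear hs); exact: csub_linear.
- by rewrite (star_hom_mul hs); exact: csub_mul.
- by rewrite (star_hom_star hs); exact: csub_star.
- apply/closed_cnP => x h /=; apply: (closed_cnP S).1 (csub_closed hS) _ _ => e e0.
  have [y yS xy] := h e e0; exists (s y) => //.
  by rewrite -(shB hs); apply: le_trans (cs _) _.
Qed.

(** The value at b is the limit of s a_n for any a_n such that r a_n -> b; it is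
pinned down by the inequality |s a - t b| <= |r a - b|, from which the algebraic
identities follow. *)
Lemma hom_extend A B Z (r : A -> B) (s : A -> Z) : star_hom r -> star_hom s ->
  (forall a, cn (s a) <= cn (r a)) ->
  (forall b (e : R), 0 < e -> exists a, cn (r a - b) <= e) ->
  exists2 t : B -> Z, star_hom t & forall a, t (r a) = s a.
Proof.
move=> hr hs sr dense.
have ex b : exists z, forall a, cn (s a - z) <= cn (r a - b).
  have e0 n : 0 < n.+1%:R^-1 :> R by rewrite invr_gt0 ltr0n.
  have [x hx] := choice (fun n => dense b _ (e0 n)).
  have small (e : R) : 0 < e -> exists N, forall n, (N <= n)%N -> cn (r (x n) - b) <= e.
    move=> ep; have [N hN] := small_natSinv ep.
    by exists N => n /hN; apply: le_trans.
  have [z hz] : exists l, forall e : R, 0 < e -> exists N, forall n, (N <= n)%N -> cn (s (x n) - l) <= e.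
    apply: cseq_cvg => e ep; have e2 : 0 < e / 2 by rewrite divr_gt0.
    have [N hN] := small _ e2; exists N => n m Nn Nm.
    rewrite -(shB hs); apply: le_trans (sr _) _; rewrite (shB hr).
    apply: le_trans (cn_triangle _ b _) _; rewrite [leRHS](splitr e) (cnB b).
    by apply: lerD; exact: hN.
  exists z => a; apply/ler_addgt0Pr => e ep; have e2 : 0 < e / 2 by rewrite divr_gt0.
  have [N1 h1] := small _ e2; have [N2 h2] := hz _ e2; pose n := maxn N1 N2.
  apply: le_trans (cn_triangle _ (s (x n)) _) _; rewrite -(shB hs).
  have := h2 n (leq_maxr _ _); have := h1 n (leq_maxl _ _); have := sr (a - x n).
  rewrite (shB hr); have := cn_triangle (r a) b (r (x n)); rewrite (cnB b); lra.
have [t ht] := choice ex.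
have tE a : t (r a) = s a.
  apply/esym/eqP; rewrite -subr_eq0; apply/eqP; apply: (@cn_small _ _ _ 0) => e _ _.
  by have := ht (r a) a; rewrite subrr cn0 mul0r.
exists t => //; split.
- move=> k b b'; apply/eqP; rewrite -subr_eq0; apply/eqP.
  apply: (@cn_small _ _ _ (2 * (normc k + 1))) => e e0 _.
  have [a ha] := dense b _ e0; have [a' ha'] := dense b' _ e0.
  have h1 := ht (k *: b + b') (k *: a + a'); have h2 := ht b a; have h3 := ht b' a'.
  have lin (V : lmodType R[i]) (x y u v : V) : k *: x + y - (k *: u + v) = k *: (x - u) + (y - v).
    by rewrite scalerBr opprD addrACA.
  apply: le_trans (cn_triangle _ (s (k *: a + a')) _) _; rewrite cnB.
  move: h1; rewrite (star_hom_linear hr) [s (_ + _)](star_hom_linear hs) !lin => h1.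
  have := cnD (k *: (r a - b)) (r a' - b'); have := cnD (k *: (s a - t b)) (s a' - t b').
  rewrite !cnZ; have n0 := normc_ge0 k.
  have : normc k * cn (r a - b) <= normc k * e by rewrite ler_wpM2l.
  have : normc k * cn (s a - t b) <= normc k * e by rewrite ler_wpM2l// (le_trans h2).
  by lra.
- move=> b b'; apply/eqP; rewrite -subr_eq0; apply/eqP.
  apply: (@cn_small _ _ _ (cn b + cn b' + 1 + (cn (t b) + cn (t b') + 1))) => e e0 e1.
  have [a ha] := dense b _ e0; have [a' ha'] := dense b' _ e0.
  have h1 := ht (b ⋅ b') (a ⋅ a'); have h2 := ht b a; have h3 := ht b' a'.
  apply: le_trans (cn_triangle _ (s (a ⋅ a')) _) _; rewrite cnB mulrDl; apply: lerD.
    by apply: le_trans h1 _; rewrite (star_hom_mul hr); exact: cs_mul_approx.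
  by rewrite (star_hom_mul hs); apply: cs_mul_approx => //; [exact: le_trans ha | exact: le_trans ha'].
- move=> b; apply/eqP; rewrite -subr_eq0; apply/eqP.
  apply: (@cn_small _ _ _ 2) => e e0 _; have [a ha] := dense b _ e0.
  have h1 := ht (cs_star b) (cs_star a); have h2 := ht b a.
  apply: le_trans (cn_triangle _ (s (cs_star a)) _) _; rewrite cnB.
  move: h1; rewrite (star_hom_star hr) (star_hom_star hs) -!cs_starB !cn_star.
  by move=> h1; lra.
Qed.

End StarHom.

Section SubCStar.
Variables (R : realType) (B : cstarAlgebra R) (S : set B).
Hypothesis hS : cstar_subalgebra S.

Definition subcs_pred (_ : cstar_subalgebra S) : {pred B} := fun x => x \in S.

Lemma subcs_submod : submod_closed (subcs_pred hS).
Proof.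
split; first by rewrite unfold_in inE; exact: csub0.
by move=> k a b; rewrite !unfold_in !inE; exact: csub_linear.
Qed.

HB.instance Definition _ :=
  GRing.isSubmodClosed.Build R[i] (B : lmodType R[i]) (subcs_pred hS) subcs_submod.

Record subcs := SubCs { subcs_val :> B ; subcs_valP : subcs_val \in subcs_pred hS }.

HB.instance Definition _ := [isSub for subcs_val].
HB.instance Definition _ := [Choice of subcs by <:].
HB.instance Definition _ := [SubChoice_isSubLmodule of subcs by <:].

Definition subcs_norm (x : subcs) : R[i] := `|subcs_val x|.
Let subcs_normD (x y : subcs) : subcs_norm (x + y) <= subcs_norm x + subcs_norm y.
Proof. exact: ler_normD. Qed.
Let subcs_normZ (c : R[i]) (x : subcs) : subcs_norm (c *: x) = `|c| * subcs_norm x.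
Proof. exact: normrZ. Qed.
Let subcs_norm0 (x : subcs) : subcs_norm x = 0 -> x = 0.
Proof. by move=> /normr0_eq0 h; exact: val_inj. Qed.

HB.instance Definition _ := @Lmodule_isNormed.Build R[i] subcs subcs_norm
  subcs_normD subcs_normZ subcs_norm0.

Lemma subcs_cn (x : subcs) : cn x = cn (subcs_val x). Proof. by []. Qed.

Lemma subcsP (x : subcs) : S (subcs_val x).
Proof. by have := subcs_valP x; rewrite unfold_in inE. Qed.

Definition mk_subcs (x : B) (hx : S x) : subcs.
Proof. by refine (@SubCs x _); rewrite unfold_in inE. Defined.

Lemma subcs_complete (F : set_system subcs) : ProperFilter F -> cauchy F -> cvg F.
Proof.
apply: normed_complete => x hx.
have hx1 n m : (n <= m)%N -> cn (subcs_val (x m) - subcs_val (x n)) <= n.+1%:R^-1.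
  by move=> /hx; rewrite cnE lecR.
have small := @small_natSinv R.
have [l hl] : exists l, forall e : R, 0 < e -> exists N, forall n, (N <= n)%N ->
    cn (subcs_val (x n) - l) <= e.
  apply: cseq_cvg => e e0; have [N hN] := small _ e0.
  exists N => n m Nn Nm; have [nm|/ltnW mn] := leqP n m.
    by rewrite cnB; apply: le_trans (hx1 _ _ nm) _; exact: hN.
  by apply: le_trans (hx1 _ _ mn) _; exact: hN.
have Sl : S l.
  apply: (closed_cnP S).1 (csub_closed hS) _ _ => e e0.
  have [N hN] := hl _ e0; exists (subcs_val (x N)); first exact: subcsP.
  by rewrite cnB hN.
exists (mk_subcs Sl) => n; rewrite cnE lecR subcs_cn.
apply/ler_addgt0Pr => e e0; have [N hN] := hl _ e0.
rewrite -[subcs_val _]/(l - subcs_val (x n)).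
apply: le_trans (cn_triangle _ (subcs_val (x (maxn n N))) _) _.
rewrite [leRHS]addrC; apply: lerD.
  by rewrite cnB; exact: hN (leq_maxr n N).
exact: hx1 (leq_maxl n N).
Qed.

HB.instance Definition _ := Uniform_isComplete.Build subcs subcs_complete.

Local Notation "a ⋅ b" := (cs_mul a b) (at level 40, left associativity).
Definition subcs_mul (a b : subcs) : subcs := mk_subcs (csub_mul hS (subcsP a) (subcsP b)).
Definition subcs_star (a : subcs) : subcs := mk_subcs (csub_star hS (subcsP a)).

Let mA : associative subcs_mul. Proof. by move=> a b d; apply: val_inj; exact: cs_mulA. Qed.
Let ml b : linear (subcs_mul^~ b).
Proof. by move=> k a d; apply: val_inj; exact: cs_mul_linearl. Qed.
Let mr a : linear (subcs_mul a).
Proof. by move=> k b d; apply: val_inj; exact: cs_mul_linearr. Qed.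
Let nm (a b : subcs) : `|subcs_mul a b| <= `|a| * `|b|.
Proof. exact: cs_norm_mul. Qed.
Let sK : involutive subcs_star.
Proof. by move=> a; apply: val_inj; exact: cs_starK. Qed.
Let sl (k : R[i]) a b : subcs_star (k *: a + b) = (conjc k) *: subcs_star a + subcs_star b.
Proof. by apply: val_inj; exact: cs_star_antilinear. Qed.
Let sm a b : subcs_star (subcs_mul a b) = subcs_mul (subcs_star b) (subcs_star a).
Proof. by apply: val_inj; exact: cs_star_mul. Qed.
Let ns (a : subcs) : `|subcs_mul (subcs_star a) a| = `|a| ^+ 2.
Proof. exact: cs_norm_starM. Qed.

Definition sub_cstar : cstarAlgebra R :=
  @CStarAlgebra R subcs subcs_mul subcs_star mA ml mr nm sK sl sm ns.

Lemma sub_incl_hom : star_hom (subcs_val : sub_cstar -> B).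
Proof. by split. Qed.

End SubCStar.

Section GeneratedSub.
Variables (R : realType) (B : cstarAlgebra R) (G : set B).
Let hS := cstar_generated_subalgebra G.

(** A set of generators still generates when everything takes place inside the
subalgebra that it generates. *)
Lemma sub_generated (T : Type) (j : T -> sub_cstar hS) :
  (forall g, G g -> exists t, subcs_val (j t) = g) -> cstar_generated (range j) = setT.
Proof.
move=> hj; apply/seteqP; split => // x _ S [sS jS].
pose S' : set B := [set b | exists2 y : sub_cstar hS, S y & subcs_val y = b].
have : S' (subcs_val x).
  apply: (subcsP x); split; last first.
    by move=> g /hj[t tg]; exists (j t) => //; apply: jS; exists t.
  split => [|k _ _ [a Sa <-] [b Sb <-]|_ _ [a Sa <-] [b Sb <-]|_ [a Sa <-]|].
  - by exists 0 => //; exact: csub0.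
  - by exists (k *: a + b) => //; exact: csub_linear.
  - by exists (cs_mul a b) => //; exact: csub_mul.
  - by exists (cs_star a) => //; exact: csub_star.
  apply/closed_cnP => z h.
  have Gz : cstar_generated G z.
    apply: (closed_cnP _).1 (csub_closed hS) _ _ => e e0.
    have [_ [y Sy <-] zy] := h e e0.
    by exists (subcs_val y) => //; exact: subcsP.
  exists (mk_subcs hS Gz) => //.
  apply: (closed_cnP S).1 (csub_closed sS) _ _ => e e0.
  by have [_ [y Sy <-] zy] := h e e0; exists y.
by case=> y Sy /val_inj <-.
Qed.
End GeneratedSub.

(** * The operator norm and von Neumann's inequality for weighted shifts *)

Section OpNorm.
Variable R : realType.
Implicit Types (n : nat).

Lemma eucl_sqr n (v : 'cV[R[i]]_n) : eucl_norm v ^+ 2 = \sum_(i < n) normc (v i 0) ^+ 2.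
Proof. by rewrite sqr_sqrtr// sumr_ge0// => i _; rewrite sqr_ge0. Qed.

Lemma eucl_ge0 n (v : 'cV[R[i]]_n) : 0 <= eucl_norm v.
Proof. exact: sqrtr_ge0. Qed.

Lemma eucl_entry n (v : 'cV[R[i]]_n) i : normc (v i 0) <= eucl_norm v.
Proof.
rewrite -(@ler_pXn2r _ 2) ?nnegrE ?normc_ge0 ?eucl_ge0// eucl_sqr (bigD1 i) //= lerDl.
by apply: sumr_ge0 => j _; rewrite sqr_ge0.
Qed.

Lemma eucl_le_sum n (v : 'cV[R[i]]_n) : eucl_norm v <= \sum_(i < n) normc (v i 0).
Proof.
have s0 : 0 <= \sum_(i < n) normc (v i 0) by apply: sumr_ge0 => i _; exact: normc_ge0.
rewrite -(@ler_pXn2r _ 2) ?nnegrE ?eucl_ge0// eucl_sqr expr2 mulr_suml.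
apply: ler_sum => i _; rewrite expr2 ler_wpM2l ?normc_ge0// (bigD1 i) //= lerDl.
by apply: sumr_ge0 => j _; exact: normc_ge0.
Qed.

Lemma euclZ n c (v : 'cV[R[i]]_n) : eucl_norm (c *: v) = normc c * eucl_norm v.
Proof.
rewrite /eucl_norm (eq_bigr (fun i => normc c ^+ 2 * normc (v i 0) ^+ 2)).
  by rewrite -mulr_sumr sqrtrM ?sqr_ge0// sqrtr_sqr ger0_norm ?normc_ge0.
by move=> i _; rewrite mxE normcM exprMn.
Qed.

Lemma eucl0_eq0 n (v : 'cV[R[i]]_n) : eucl_norm v = 0 -> v = 0.
Proof.
move=> h; apply/matrixP => i j; rewrite (ord1 j) mxE; apply: eq0_normc.
by apply/eqP; rewrite eq_le normc_ge0 andbT -h eucl_entry.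
Qed.

Let opset n (A : 'M[R[i]]_n) :=
  [set eucl_norm (A *m v) | v in [set v : 'cV[R[i]]_n | eucl_norm v <= 1]].

Lemma eucl_mul_bound n (A : 'M[R[i]]_n) v :
  eucl_norm (A *m v) <= (\sum_(i < n) \sum_(j < n) normc (A i j)) * eucl_norm v.
Proof.
apply: le_trans (eucl_le_sum _) _; rewrite mulr_suml; apply: ler_sum => i _.
rewrite mxE; apply: le_trans (normc_sum _ _ _) _; rewrite mulr_suml.
by apply: ler_sum => j _; rewrite normcM ler_wpM2l ?normc_ge0// eucl_entry.
Qed.

Let opset_ub n (A : 'M[R[i]]_n) : ubound (opset A) (\sum_(i < n) \sum_(j < n) normc (A i j)).
Proof.
move=> _ [v /= v1 <-]; apply: le_trans (eucl_mul_bound _ _) _.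
by rewrite ler_piMr// !sumr_ge0// => i _; rewrite sumr_ge0// => j _; exact: normc_ge0.
Qed.

Lemma opnorm_ge0 n (A : 'M[R[i]]_n) : 0 <= opnorm A.
Proof.
apply: (@le_trans _ _ (eucl_norm (A *m 0))); first exact: eucl_ge0.
apply: ub_le_sup; first by exists (\sum_(i < n) \sum_(j < n) normc (A i j)); exact: opset_ub.
by exists 0 => //=; rewrite /eucl_norm big1 ?sqrtr0// => i _; rewrite mxE normc0 expr0n.
Qed.

Lemma opnorm_bnd n (A : 'M[R[i]]_n) v : eucl_norm (A *m v) <= opnorm A * eucl_norm v.
Proof.
have [v0|v0] := eqVneq (eucl_norm v) 0.
  by apply: le_trans (eucl_mul_bound _ _) _; rewrite v0 !mulr0.
have vp : 0 < eucl_norm v by rewrite lt_neqAle eq_sym v0 eucl_ge0.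
have ni : normc (eucl_norm v)^-1%:C = (eucl_norm v)^-1.
  by rewrite normcR ger0_norm// invr_ge0 eucl_ge0.
rewrite -ler_pdivrMr// mulrC -ni -euclZ scalemxAr.
apply: ub_le_sup; first by exists (\sum_(i < n) \sum_(j < n) normc (A i j)); exact: opset_ub.
by exists ((eucl_norm v)^-1%:C *: v) => //=; rewrite euclZ ni mulVf.
Qed.

Lemma opnorm_le n (A : 'M[R[i]]_n) M : 0 <= M ->
  (forall v, eucl_norm (A *m v) <= M * eucl_norm v) -> opnorm A <= M.
Proof.
move=> M0 h; apply: ge_sup.
  by exists (eucl_norm (A *m 0)); exists 0 => //=; rewrite /eucl_norm big1 ?sqrtr0// => i _; rewrite mxE normc0 expr0n.
by move=> _ [v /= v1 <-]; apply: le_trans (h v) _; rewrite ler_piMr.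
Qed.

Lemma opnorm_entries n (A : 'M[R[i]]_n) : opnorm A <= \sum_(i < n) \sum_(j < n) normc (A i j).
Proof.
apply: opnorm_le; last exact: eucl_mul_bound.
by apply: sumr_ge0 => i _; apply: sumr_ge0 => j _; exact: normc_ge0.
Qed.

(** The bilinear form of A is bounded by |A| |x| |y|, and 2 |x| |y| <= |x|^2 + |y|^2.
The quadratic right-hand side can be averaged, which the product cannot. *)
Lemma opnorm_form n (A : 'M[R[i]]_n) (x y : 'I_n -> R[i]) :
  2 * normc (\sum_(k < n) \sum_(l < n) A k l * x l * conjc (y k)) <=
  opnorm A * (\sum_(l < n) normc (x l) ^+ 2 + \sum_(k < n) normc (y k) ^+ 2).
Proof.
pose v := \col_l x l; pose w := \col_l y l.
have vE : eucl_norm v ^+ 2 = \sum_(l < n) normc (x l) ^+ 2.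
  by rewrite eucl_sqr; apply: eq_bigr => l _; rewrite mxE.
have wE : eucl_norm w ^+ 2 = \sum_(l < n) normc (y l) ^+ 2.
  by rewrite eucl_sqr; apply: eq_bigr => l _; rewrite mxE.
have cs (a b : 'cV[R[i]]_n) : normc (\sum_(k < n) a k 0 * conjc (b k 0)) <= eucl_norm a * eucl_norm b.
  have : normc (\sum_(k < n) a k 0 * conjc (b k 0)) <= \sum_(k < n) normc (a k 0) * normc (b k 0).
    apply: le_trans (normc_sum _ _ _) _; apply: ler_sum => k _.
    by rewrite normcM normc_conj.
  move/le_trans; apply.
  have sc (r s : R) : 0 <= r * r * (eucl_norm a ^+ 2) + s * s * (eucl_norm b ^+ 2) - 2 * (r * s * \sum_(k < n) normc (a k 0) * normc (b k 0)).
    rewrite !eucl_sqr !mulr_sumr -big_split -sumrB; apply: sumr_ge0 => k _ /=.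
    rewrite (_ : _ - _ = (r * normc (a k 0) - s * normc (b k 0)) ^+ 2); first exact: sqr_ge0.
    by ring.
  have [a0|a0] := eqVneq (eucl_norm a) 0.
    by rewrite (eucl0_eq0 a0) big1 ?mulr_ge0 ?eucl_ge0// => k _; rewrite mxE normc0 mul0r.
  have [b0|b0] := eqVneq (eucl_norm b) 0.
    by rewrite (eucl0_eq0 b0) big1 ?mulr_ge0 ?eucl_ge0// => k _; rewrite mxE normc0 mulr0.
  have := sc (eucl_norm b) (eucl_norm a); set Q := \sum_(k < n) _.
  have ap : 0 < eucl_norm a by rewrite lt_neqAle eq_sym a0 eucl_ge0.
  have bp : 0 < eucl_norm b by rewrite lt_neqAle eq_sym b0 eucl_ge0.
  set p := eucl_norm a in ap *; set q := eucl_norm b in bp *.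
  rewrite (_ : _ - _ = 2 * (p * q) * (p * q - Q)); last by ring.
  by rewrite pmulr_rge0 ?subr_ge0// !mulr_gt0.
have -> : \sum_(k < n) \sum_(l < n) A k l * x l * conjc (y k) = \sum_(k < n) (A *m v) k 0 * conjc (w k 0).
  apply: eq_bigr => k _; rewrite !mxE mulr_suml; apply: eq_bigr => l _.
  by rewrite !mxE.
rewrite -vE -wE; have h1 := cs (A *m v) w; have h2 := opnorm_bnd A v.
have h3 : eucl_norm (A *m v) * eucl_norm w <= opnorm A * eucl_norm v * eucl_norm w.
  by rewrite ler_wpM2r ?eucl_ge0.
have h4 : 0 <= opnorm A * (eucl_norm v - eucl_norm w) ^+ 2.
  by rewrite mulr_ge0 ?sqr_ge0 ?opnorm_ge0.
have h5 : opnorm A * (eucl_norm v - eucl_norm w) ^+ 2 = opnorm A * (eucl_norm v ^+ 2 + eucl_norm w ^+ 2)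
  - 2 * (opnorm A * eucl_norm v * eucl_norm w) by ring.
by lra.
Qed.

End OpNorm.

Lemma conjcMr (R : realType) (r : R) (z : R[i]) : conjc (r%:C * z) = r%:C * conjc z.
Proof. by case: z => a b; apply/eqP; rewrite eq_complex /=; apply/andP; split; apply/eqP; ring. Qed.

Lemma conjcM (R : realType) (a b : R[i]) : conjc (a * b) = conjc a * conjc b.
Proof. exact: rmorphM. Qed.

Lemma conjcX (R : realType) (a : R[i]) n : conjc (a ^+ n) = conjc a ^+ n.
Proof. exact: rmorphXn. Qed.

Lemma realcM (R : realType) (a b : R) : (a * b)%:C = a%:C * b%:C :> R[i].
Proof. exact: rmorphM. Qed.

Lemma realcD (R : realType) (a b : R) : (a + b)%:C = a%:C + b%:C :> R[i].
Proof. exact: rmorphD. Qed.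

Lemma realc_sum (R : realType) (I : Type) (r : seq I) (P : pred I) (F : I -> R) :
  (\sum_(i <- r | P i) F i)%:C = \sum_(i <- r | P i) (F i)%:C :> R[i].
Proof. exact: rmorph_sum. Qed.

Section VonNeumann.
Variables (R : realType) (w : nat -> R).
Hypothesis w01 : forall j, 0 <= w j <= 1.
Implicit Types (x y : nat -> R[i]) (p : {poly R[i]}) (m i j k D : nat).

Definition wshift x : nat -> R[i] := fun j => if j is j'.+1 then (w j')%:C * x j' else 0.

Lemma iter_wshift_lt k x i : (i < k)%N -> iter k wshift x i = 0.
Proof.
elim: k i => [//|k IH] [|i] //= ik.
by rewrite IH ?mulr0.
Qed.

(** The polynomial p evaluated at the weighted shift, on arbitrary sequences; a
lower triangular operator, so that no convergence is involved. *)
Definition pshift p x : nat -> R[i] :=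
  fun i => \sum_(m < size p) p`_m * iter m wshift x i.

Variable D : nat.
Let S x y : R[i] := \sum_(i < D) x i * conjc (y i).
Let del i : R := if (i.+1 < D)%N then 1 - w i ^+ 2 else 1.
Let B x y : R[i] := \sum_(i < D) (del i)%:C * (x i * conjc (y i)).

Let del_ge0 i : 0 <= del i.
Proof.
rewrite /del; case: ifP => // _; rewrite subr_ge0; have /andP[a b] := w01 i.
by rewrite expr_le1.
Qed.

(** The defect form <x, y> - <Wx, Wy> of the contraction W, cut off at the
coordinate D, is diagonal with nonnegative entries del i. *)
Let BE x y : B x y = S x y - S (wshift x) (wshift y).
Proof.
rewrite /B /S /del; case: D => [|d]; first by rewrite !big_ord0 subr0.
rewrite [X in _ = _ - X]big_ord_recl /= mul0r add0r big_ord_recr [X in _ = X - _]big_ord_recr /=.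
rewrite ltnn mul1r addrAC; congr (_ + _).
rewrite -sumrB; apply: eq_bigr => i _; rewrite /bump /= add0n ltnS ltn_ord.
by rewrite rmorphB rmorph1 rmorphXn conjcMr; ring.
Qed.

Let Bshift k l x y := B (iter k wshift x) (iter l wshift y).

(** The operator-valued Poisson kernel of W in terms of the defect form. *)
Let Pkern m x y (t : R[i]) : R[i] :=
  \sum_(j < D) \sum_(k < D) expc t ^+ m * (expc (- t) ^+ j * expc t ^+ k) * Bshift j k x y.

(** The defect forms of the iterates telescope, and the remainder vanishes since
W^D sends everything beyond the first D coordinates. *)
Let telescope m x y : \sum_(k < D) (if (k + m < D)%N then Bshift (k + m) k x y else 0) =
  S (iter m wshift x) y.
Proof.
have E k : Bshift (k + m) k x y = S (iter (k + m) wshift x) (iter k wshift y)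
    - S (iter (k.+1 + m) wshift x) (iter k.+1 wshift y).
  by rewrite /Bshift BE.
have [mD|Dm] := ltnP m D; last first.
  rewrite big1; last by move=> k _; rewrite ltnNge (leq_trans Dm) // leq_addl.
  by rewrite /S big1// => i _; rewrite iter_wshift_lt ?mul0r// (leq_trans (ltn_ord i)).
have S0 k : (D <= k + m)%N -> S (iter (k + m) wshift x) (iter k wshift y) = 0.
  move=> Dk; rewrite /S big1// => i _; rewrite iter_wshift_lt ?mul0r//.
  by rewrite (leq_trans (ltn_ord i)).
have Q n : \sum_(k < n) (if (k + m < D)%N then Bshift (k + m) k x y else 0) =
    S (iter m wshift x) y - S (iter (n + m) wshift x) (iter n wshift y).
  elim: n => [|n IH]; first by rewrite big_ord0 add0n subrr.
  rewrite big_ord_recr /= IH; case: ltnP => nm; first by rewrite E addrA subrK.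
  by rewrite addr0 (S0 n nm) (S0 n.+1) ?(leq_trans nm)// addSn.
by rewrite Q S0 ?leq_addr// subr0.
Qed.

Let T := cperiod R.

Let seg_expc (M m j k : nat) : (m + k + j < 2 ^ M)%N ->
  seg M (fun t => expc t ^+ m * (expc (- t) ^+ j * expc t ^+ k)) 0 T =
  (if j == (k + m)%N then 1 else 0).
Proof.
move=> big; have ee t : expc t * expc (- t) = 1 :> R[i] by rewrite -expcD subrr expc0.
have [->|jk] := eqVneq.
  rewrite -[RHS](seg_cst M 1 0 T); apply: eq_seg => t.
  by rewrite mulrCA -exprD (addnC m) mulrC -exprMn ee expr1n.
have [lt|ge] := ltnP j (k + m).
  rewrite -[RHS](@seg_char _ M (@expc R) T (k + m - j)).
  - apply: eq_seg => t; rewrite mulrCA -exprD (addnC m) -{1}(subnK (ltnW lt)) exprD.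
    by rewrite mulrCA -exprMn [_ * expc t]mulrC ee expr1n mulr1.
  - exact: expcD.
  - exact: expc_half_cperiod.
  - by rewrite subn_gt0 lt /=; apply: leq_ltn_trans big; rewrite leq_subLR; lia.
have gt : (k + m < j)%N by rewrite ltn_neqAle eq_sym jk.
rewrite -[RHS](@seg_char _ M (fun t => expc (- t)) T (j - (k + m))).
- apply: eq_seg => t; rewrite mulrCA -exprD (addnC m) -{1}(subnK ge) exprD.
  by rewrite -mulrA -exprMn [_ * expc t]mulrC ee expr1n mulr1.
- by move=> a b; rewrite opprD expcD.
- by rewrite expcN expc_half_cperiod invrN1.
- by rewrite subn_gt0 gt /=; apply: leq_ltn_trans big; rewrite leq_subLR; lia.
Qed.

Let seg_Pkern M m x y : (m + 2 * D < 2 ^ M)%N ->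
  seg M (Pkern m x y) 0 T = S (iter m wshift x) y.
Proof.
move=> big; rewrite /Pkern seg_sum -telescope.
under [LHS]eq_bigr do rewrite seg_sum.
rewrite exchange_big /=; apply: eq_bigr => k _.
have st j : seg M (fun t => expc t ^+ m * (expc (- t) ^+ j * expc t ^+ k) * Bshift j k x y) 0 T =
   Bshift j k x y * seg M (fun t => expc t ^+ m * (expc (- t) ^+ j * expc t ^+ k)) 0 T.
  by rewrite -segZ; apply: eq_seg => t; rewrite mulrC.
case: ltnP => km.
  rewrite (bigD1 (Ordinal km)) //= st seg_expc ?eqxx ?mulr1 ?big1 ?addr0//.
    move=> j jk; rewrite st seg_expc.
      by rewrite -val_eqE /= in jk; rewrite (negbTE jk) mulr0.
    by have := ltn_ord j; have := ltn_ord k; lia.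
  by have := ltn_ord k; lia.
rewrite big1// => j _; rewrite st seg_expc; last by have := ltn_ord j; have := ltn_ord k; lia.
by rewrite ltn_eqF ?mulr0// (leq_trans (ltn_ord j)).
Qed.

Let Lt (t : R[i]) x : nat -> R[i] := fun i => \sum_(j < D) expc (- t) ^+ j * iter j wshift x i.

Let Pkern_pt m x y (s : R) : Pkern m x y (s%:C * T) =
  expc (s%:C * T) ^+ m * B (Lt (s%:C * T) x) (Lt (s%:C * T) y).
Proof.
set t := s%:C * T.
have ec : conjc (expc (- t)) = expc t by rewrite /t expcN_conj conjcK.
rewrite /Pkern /B mulr_sumr.
under eq_bigr => j _.
  under eq_bigr => k _ do rewrite /Bshift /B mulr_sumr.
  rewrite exchange_big /=.
  over.
rewrite exchange_big /=; apply: eq_bigr => i _.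
rewrite /Lt rmorph_sum /= mulr_suml !mulr_sumr; apply: eq_bigr => j _.
rewrite !mulr_sumr; apply: eq_bigr => k _.
by rewrite conjcM conjcX ec; ring.
Qed.

(** With L_t = sum_j exp(-t)^j W^j one has the Poisson formula
<p(W) x, y> = average over t of p(exp t) B(L_t x, L_t y), exact for averages over
sufficiently many roots of unity.  The form B being positive and diagonal, the
bound on p at exp t applies under the average, and the case p = 1 evaluates what
remains as C (|x|^2 + |y|^2) / 2.  Working with the first D coordinates is
harmless, W being lower triangular. *)
Lemma von_neumann n (F : 'M[{poly R[i]}]_n) (C : R) :
  (forall z, normc z <= 1 -> opnorm (map_mx (fun p => p.[z]) F) <= C) ->
  forall x : 'I_n -> nat -> R[i],
  \sum_(k < n) \sum_(i < D) normc (\sum_(l < n) pshift (F k l) (x l) i) ^+ 2 <=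
  C ^+ 2 * \sum_(l < n) \sum_(i < D) normc (x l i) ^+ 2.
Proof.
move=> hC x.
have C0 : 0 <= C by apply: le_trans (hC 0 _); rewrite ?opnorm_ge0// normc0.
pose dg := \max_(kl : 'I_n * 'I_n) size (F kl.1 kl.2).
(* Exponents up to dg + 2 D occur, and there are more roots of unity than that. *)
pose M := (dg + 2 * D)%N.
have big m : (m <= dg)%N -> (m + 2 * D < 2 ^ M)%N.
  by move=> md; apply: leq_ltn_trans (ltn_expl _ _) => //; rewrite leq_add2r.
have sq_norm (z : R[i]) : z * conjc z = (normc z ^+ 2)%:C.
  by rewrite rmorphXn /= -normcEc sqr_normc.
have main (y : 'I_n -> nat -> R[i]) :
    2 * normc (\sum_(k < n) \sum_(l < n) S (pshift (F k l) (x l)) (y k)) <=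
    C * (\sum_(l < n) \sum_(i < D) normc (x l i) ^+ 2 + \sum_(l < n) \sum_(i < D) normc (y l i) ^+ 2).
  pose G t := \sum_(k < n) \sum_(l < n) \sum_(m < size (F k l)) (F k l)`_m * Pkern m (x l) (y k) t.
  have GE : \sum_(k < n) \sum_(l < n) S (pshift (F k l) (x l)) (y k) = seg M G 0 T.
    rewrite /G seg_sum; apply: eq_bigr => k _; rewrite seg_sum; apply: eq_bigr => l _.
    rewrite seg_sum.
    under [RHS]eq_bigr => m _.
      rewrite segZ seg_Pkern; first over.
      by apply: big; rewrite ltnW// (leq_trans (ltn_ord m))//; apply: (leq_bigmax (k, l)).
    rewrite /S /pshift; under [RHS]eq_bigr do rewrite mulr_sumr.
    rewrite [RHS]exchange_big /=; apply: eq_bigr => i _; rewrite mulr_suml.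
    by apply: eq_bigr => m _; rewrite mulrA.
  pose K t := (C%:C / 2) * (\sum_(l < n) Pkern 0 (x l) (x l) t + \sum_(l < n) Pkern 0 (y l) (y l) t).
  have SS z : S z z = (\sum_(i < D) normc (z i) ^+ 2)%:C.
    by rewrite /S realc_sum; apply: eq_bigr => i _; exact: sq_norm.
  have KE : seg M K 0 T = (C / 2 * (\sum_(l < n) \sum_(i < D) normc (x l i) ^+ 2 +
       \sum_(l < n) \sum_(i < D) normc (y l i) ^+ 2))%:C.
    rewrite /K segZ segD !seg_sum realcM halfC realcD !realc_sum.
    by congr (_ * (_ + _)); apply: eq_bigr => l _; rewrite seg_Pkern ?big//= SS.
  suff : normc (seg M G 0 T) <= Re (seg M K 0 T).
    by rewrite KE GE /= => h; lra.
  apply: seg_le => s _; rewrite add0r; set t := s%:C * T.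
  have zt : normc (expc t) <= 1 by rewrite normc_expc /t /= mul0r mulr0 subr0 expR0.
  have Gt : G t = \sum_(i < D) (del i)%:C * \sum_(k < n) \sum_(l < n)
      (map_mx (fun p => p.[expc t]) F) k l * Lt t (x l) i * conjc (Lt t (y k) i).
    rewrite /G.
    under [RHS]eq_bigr do rewrite mulr_sumr.
    rewrite [RHS]exchange_big /=; apply: eq_bigr => k _.
    under [RHS]eq_bigr do rewrite mulr_sumr.
    rewrite [RHS]exchange_big /=; apply: eq_bigr => l _.
    rewrite mxE horner_coef.
    under eq_bigr do rewrite /t Pkern_pt -/t mulrA.
    rewrite -mulr_suml /B mulr_sumr; apply: eq_bigr => i _.
    by ring.
  have Kt : Re (K t) = C / 2 * \sum_(i < D) del i * (\sum_(l < n) normc (Lt t (x l) i) ^+ 2 +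
      \sum_(k < n) normc (Lt t (y k) i) ^+ 2).
    have P0 z : Pkern 0 z z t = (\sum_(i < D) del i * normc (Lt t z i) ^+ 2)%:C.
      rewrite /t Pkern_pt expr0 mul1r -/t /B realc_sum; apply: eq_bigr => i _.
      by rewrite sq_norm -realcM.
    rewrite /K; under eq_bigr do rewrite P0.
    under [X in _ * (_ + X)]eq_bigr do rewrite P0.
    rewrite -!realc_sum -realcD -halfC -realcM [LHS]/=; congr (_ * _).
    rewrite [X in X + _ = _]exchange_big [X in _ + X = _]exchange_big /= -big_split.
    by apply: eq_bigr => i _ /=; rewrite mulrDr !mulr_sumr.
  rewrite Gt Kt; apply: le_trans (normc_sum _ _ _) _; rewrite mulr_sumr.
  apply: ler_sum => i _; rewrite normcM normcR ger0_norm// mulrCA ler_wpM2l//.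
  have := opnorm_form (map_mx (fun p => p.[expc t]) F) (fun l => Lt t (x l) i) (fun k : 'I_n => Lt t (y k) i).
  set Q := normc _; set V := _ + _ => h1.
  have V0 : 0 <= V by rewrite addr_ge0// sumr_ge0// => j _; rewrite sqr_ge0.
  have : opnorm (map_mx (fun p => p.[expc t]) F) * V <= C * V by rewrite ler_wpM2r// hC.
  by move=> h2; lra.
pose y0 (k : 'I_n) i := \sum_(l < n) pshift (F k l) (x l) i.
set X := \sum_(l < n) \sum_(i < D) normc (x l i) ^+ 2.
set Y := \sum_(k < n) _.
have X0 : 0 <= X by apply: sumr_ge0 => l _; apply: sumr_ge0 => i _; rewrite sqr_ge0.
have Y0 : 0 <= Y by apply: sumr_ge0 => l _; apply: sumr_ge0 => i _; rewrite sqr_ge0.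
have ineq (s : R) : 0 <= s -> 2 * s * Y <= C * (X + s ^+ 2 * Y).
  move=> s0; have := main (fun (k : 'I_n) i => s%:C * y0 k i).
  have -> : \sum_(k < n) \sum_(l < n) S (pshift (F k l) (x l)) (fun i => s%:C * y0 k i) = (s * Y)%:C.
    rewrite realcM /Y realc_sum mulr_sumr; apply: eq_bigr => k _.
    rewrite /S exchange_big /= realc_sum mulr_sumr; apply: eq_bigr => i _ /=.
    by rewrite -mulr_suml -/(y0 k i) conjcMr mulrCA sq_norm.
  rewrite normcR ger0_norm ?mulr_ge0// mulrA => /le_trans; apply.
  rewrite ler_wpM2l// lerD2l /Y mulr_sumr; apply: ler_sum => k _; rewrite mulr_sumr.
  by apply: ler_sum => i _; rewrite normcM normcR exprMn real_normK ?num_real.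
(* The choice y = C^-1 p(W) x makes the two sides of the main inequality
   comparable. *)
have [C00|Cn0] := eqVneq C 0.
  by have := ineq 1 ler01; rewrite C00 mul0r expr0n mul0r; lra.
have Cp : 0 < C by rewrite lt_neqAle eq_sym Cn0.
have := ineq C^-1; rewrite invr_ge0 => /(_ C0) h.
have : C * (2 * C^-1 * Y) <= C * (C * (X + C^-1 ^+ 2 * Y)) by rewrite ler_wpM2l.
rewrite (_ : C * (2 * C^-1 * Y) = 2 * Y); last by field.
rewrite (_ : C * (C * (X + C^-1 ^+ 2 * Y)) = C ^+ 2 * X + Y); last by field.
by lra.
Qed.

End VonNeumann.

(** * The model family and its polynomial calculus *)

Section Index.
Variable R : realType.
(** The fibers: the points of the disc, the truncated shifts inr (Some n), and the
full shift inr None. *)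
Definition idx : Type := (closed_disc R + option nat)%type.
HB.instance Definition _ := Choice.on idx.
HB.instance Definition _ := isPointed.Build idx (inr None).
End Index.

Section ModelOperator.
Variable R : realType.
Local Notation H := (l2 R).
Local Notation hip := (rip_is_ip R).
Implicit Types (u v : H).

(** The weights of the full shift (None) and of its truncations (Some n). *)
Definition wt (k : option nat) (j : nat) : R :=
  if k is Some n then if (j <= n)%N then 2 ^- j else 0 else 2 ^- j.

Lemma wt01 (k : option nat) j : 0 <= wt k j <= 1.
Proof.
have h : 0 <= (2 ^- j : R) <= 1.
  by rewrite invr_ge0 exprn_ge0//= invf_le1 ?exprn_gt0// exprn_ege1// ler1n.
by case: k => [n|//] /=; case: ifP => // _; rewrite lexx ler01.
Qed.

Lemma wshift_sum_le (k : option nat) (u : nat -> R[i]) n :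
  \sum_(j < n) normc (wshift (wt k) u j) ^+ 2 <= \sum_(j < n) normc (u j) ^+ 2.
Proof.
case: n => [|n]; first by rewrite !big_ord0.
rewrite big_ord_recl (_ : normc (wshift (wt k) u ord0) = 0); last exact: normc0.
rewrite expr0n add0r [leRHS]big_ord_recr.
apply: ler_wpDr; first exact: sqr_ge0.
apply: ler_sum => j _; rewrite [wshift _ _ _]/((wt k j)%:C * u j) normcM normcR exprMn; have /andP[a b] := wt01 k j.
by rewrite ler_piMl ?sqr_ge0// ger0_norm// expr_le1.
Qed.

Fact shift_fwd_l2 (k : option nat) u : wshift (wt k) u \in @l2_pred R.
Proof.
have /asboolP[M hM] := l2_valP u; apply/asboolP; exists M => n.
by apply: le_trans (hM n); exact: wshift_sum_le.
Qed.

Definition shift_fwd (k : option nat) u : H := L2 (shift_fwd_l2 k u).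

Fact shift_bwd_l2 (k : option nat) u : (fun j => (wt k j)%:C * u j.+1) \in @l2_pred R.
Proof.
have /asboolP[M hM] := l2_valP u; apply/asboolP; exists M => n.
apply: le_trans (hM n.+1); rewrite [leRHS]big_ord_recl /=.
apply: ler_wpDl; first exact: sqr_ge0.
apply: ler_sum => j _; rewrite normcM normcR exprMn; have /andP[a b] := wt01 k j.
by rewrite ler_piMl ?sqr_ge0// ger0_norm// expr_le1.
Qed.

Definition shift_bwd (k : option nat) u : H := L2 (shift_bwd_l2 k u).

Lemma shift_fwd_linear (k : option nat) : linear (shift_fwd k).
Proof.
move=> c u v; apply: l2P => -[|j]; rewrite l2_addE l2_scaleE.
  by change (0 = c * 0 + 0 :> R[i]); rewrite mulr0 addr0.
change ((wt k j)%:C * (c * u j + v j) = c * ((wt k j)%:C * u j) + (wt k j)%:C * v j).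
by ring.
Qed.

Lemma shift_fwd_le (k : option nat) u : hn (shift_fwd k u) <= hn u.
Proof.
apply: hn_le => [|n]; first exact: nrm_ge0.
by apply: le_trans (psum_le_hn u n); exact: wshift_sum_le.
Qed.

Lemma shift_fwd_adj (k : option nat) u v : rip (shift_fwd k u) v = rip u (shift_bwd k v).
Proof.
have h1 := @rip_partial R (shift_fwd k u) v; have h2 := @rip_partial R u (shift_bwd k v).
move: h1; rewrite -(cvg_shiftS _) => h1.
suff E : [sequence \sum_(j < n.+1) (Re (shift_fwd k u j) * Re (v j) + Im (shift_fwd k u j) * Im (v j))]_n =
    (fun n => \sum_(j < n) (Re (u j) * Re (shift_bwd k v j) + Im (u j) * Im (shift_bwd k v j))).
  by move: h1; rewrite E => /cvg_lim <- //; move: h2 => /cvg_lim <-.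
apply/funext => n; rewrite /= big_ord_recl /= !mul0r !add0r.
apply: eq_bigr => j _; rewrite /bump /= add1n.
by case: (u j) (v j.+1) => a b [c d] /=; ring.
Qed.

Definition model_op (i : idx R) : H -> H :=
  match i with inl z => fun u => set_val z *: u | inr k => shift_fwd k end.

Definition model_adj (i : idx R) : H -> H :=
  match i with inl z => fun u => conjc (set_val z) *: u | inr k => shift_bwd k end.

Lemma closed_discP (z : closed_disc R) : normc (set_val z) <= 1.
Proof. by have := set_valP z; rewrite /closed_disc /= normcEc lecR. Qed.

Lemma model_adjP : adjoint (@rip R) model_op model_adj.
Proof.
move=> [z|k] u v /=; last exact: shift_fwd_adj.
exact: (ipZl hip).
Qed.

Lemma model_adjointable : adjointable (@rip R) model_op.
Proof.
exists 1, model_adj; split => //.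
- move=> [z|k] c u v /=; last exact: shift_fwd_linear.
  by rewrite scalerDr !scalerA mulrC.
- move=> [z|k] u /=; rewrite mul1r; last exact: shift_fwd_le.
  by rewrite (nrmZ hip) ler_piMl ?nrm_ge0// closed_discP.
- exact: model_adjP.
Qed.

Definition model : bop R (idx R) := Bop (introT (asboolP _) model_adjointable).

Lemma model_star i u : bstar model i u = model_adj i u.
Proof.
apply: (ip_ext hip) => v; rewrite (ipC hip) -bstarP [RHS](ipC hip).
exact: model_adjP.
Qed.

Definition pcalc (p : {poly R[i]}) : bop R (idx R) := horner_alg model p.

Lemma pcalcE p : pcalc p = \sum_(m < size p) p`_m *: model ^+ m.
Proof.
rewrite /pcalc -{1}(coefK p) poly_def linear_sum; apply: eq_bigr => m _ /=.
by rewrite linearZ_LR rmorphXn /= horner_algX mulr_algl.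
Qed.

Lemma pcalcB p q : pcalc (p - q) = pcalc p - pcalc q.
Proof. exact: rmorphB. Qed.

Lemma pcalc_lin k p q : pcalc (k *: p + q) = k *: pcalc p + pcalc q.
Proof. by rewrite /pcalc linearD linearZ_LR /= mulr_algl. Qed.

Lemma pcalcM p q : pcalc (p * q) = pcalc p * pcalc q.
Proof. exact: rmorphM. Qed.

Lemma pcalc1 : pcalc 1 = 1.
Proof. exact: rmorph1. Qed.

Lemma pcalcX : pcalc 'X = model.
Proof. exact: horner_algX. Qed.

Lemma bop_sumE (I : pointedType) (J : Type) (r : seq J) (P : pred J) (F : J -> bop R I) i u :
  (\sum_(j <- r | P j) F j) i u = \sum_(j <- r | P j) F j i u.
Proof. by elim/big_ind2: _ => // [x a y b <- <-]. Qed.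

Lemma l2_sumE (J : Type) (r : seq J) (P : pred J) (F : J -> H) j :
  (\sum_(i <- r | P i) F i) j = \sum_(i <- r | P i) F i j.
Proof. by elim/big_ind2: _ => // [x a y b <- <-]. Qed.

Lemma model_expE m i u : (model ^+ m) i u = iter m (model_op i) u.
Proof. by elim: m u => [//|m IH] u; rewrite exprS bop_mulE IH. Qed.

Lemma pcalc_disc p z u : pcalc p (inl z) u = p.[set_val z] *: u.
Proof.
rewrite pcalcE bop_sumE horner_coef scaler_suml; apply: eq_bigr => m _.
rewrite bop_scaleE model_expE -scalerA; congr (_ *: _).
elim: (nat_of_ord m) => [|j IH]; first by rewrite expr0 scale1r.
by rewrite /= IH scalerA exprS.
Qed.

Lemma pcalc_shift p (k : option nat) u j : pcalc p (inr k) u j = pshift (wt k) p u j.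
Proof.
rewrite pcalcE bop_sumE l2_sumE; apply: eq_bigr => m _.
rewrite bop_scaleE model_expE l2_scaleE /=; congr (_ * _).
elim: (nat_of_ord m) j => [//|i IH] j; rewrite !iterS.
have -> // : iter i (wshift (wt k)) u = l2_val (iter i (shift_fwd k) u).
by apply/funext => j'; rewrite IH.
Qed.

Lemma sum_cvgn (J : Type) (r : seq J) (F : J -> nat -> R) (L : J -> R) :
  (forall i, F i @ \oo --> L i) ->
  (fun n => \sum_(i <- r) F i n) @ \oo --> \sum_(i <- r) L i.
Proof.
move=> h; elim: r => [|i r IH].
  rewrite big_nil (_ : (fun n => _) = (fun=> 0)); first exact: cvg_cst.
  by apply/funext => n; rewrite big_nil.
rewrite big_cons (_ : (fun n => _) = (fun n => F i n + \sum_(j <- r) F j n)).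
  exact: cvgD.
by apply/funext => n; rewrite big_cons.
Qed.

Section Ampl.
Variables (n : nat).
Local Notation hipn := (ipn_is_ip n hip).

Lemma ipn_partial_le (x : 'I_n -> H) D :
  \sum_(k < n) \sum_(j < D) normc (x k j) ^+ 2 <= ipn (@rip R) x x.
Proof.
by apply: ler_sum => k _; apply: le_trans (psum_le_hn _ _) _; rewrite (nrm_sqr hip).
Qed.

Lemma ipn_le (x : 'I_n -> H) K :
  (forall D, \sum_(k < n) \sum_(j < D) normc (x k j) ^+ 2 <= K) -> ipn (@rip R) x x <= K.
Proof.
move=> h.
have : (fun D => \sum_(k < n) \sum_(j < D) (Re (x k j) * Re (x k j) + Im (x k j) * Im (x k j))) @ \oo
    --> ipn (@rip R) x x.
  by apply: sum_cvgn => k; exact: rip_partial.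
move=> /cvg_lim <- //; apply: limr_le.
  by apply: cvgP; apply: sum_cvgn => k; exact: rip_partial.
apply: nearW => D; apply: le_trans (h D); rewrite le_eqVlt; apply/orP; left; apply/eqP.
by apply: eq_bigr => k _; apply: eq_bigr => j _; rewrite normc_sqr !expr2.
Qed.

(** The action of a matrix of families on the n-fold direct sum, which carries the
C*-norm of the matrix algebra. *)
Definition ampl (I : pointedType) (a : 'M[bop R I]_n) (i : I) (x : 'I_n -> H) : 'I_n -> H :=
  fun k => \sum_(l < n) a k l i (x l).

Lemma nrm_ipn_le_sum (x : 'I_n -> H) : nrm (@ipn R _ (@rip R) _) x <= \sum_(k < n) hn (x k).
Proof.
have s0 : 0 <= \sum_(k < n) hn (x k) by apply: sumr_ge0 => k _; exact: nrm_ge0.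
rewrite -(@ler_pXn2r _ 2) ?nnegrE ?nrm_ge0// (nrm_sqr hipn) expr2 mulr_suml.
apply: ler_sum => k _; rewrite -(nrm_sqr hip) expr2 ler_wpM2l ?nrm_ge0//.
by rewrite (bigD1 k) //= lerDl sumr_ge0// => l _; exact: nrm_ge0.
Qed.

Lemma hn_le_ipn (x : 'I_n -> H) k : hn (x k) <= nrm (@ipn R _ (@rip R) _) x.
Proof.
rewrite -(@ler_pXn2r _ 2) ?nnegrE ?nrm_ge0// (nrm_sqr hipn) (nrm_sqr hip).
rewrite /ipn (bigD1 k) //= lerDl sumr_ge0// => l _; exact: (ip_ge0 hip).
Qed.

Lemma ampl_bnd (I : pointedType) (a : 'M[bop R I]_n) i x :
  nrm (@ipn R _ (@rip R) _) (ampl a i x) <=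
  (\sum_(k < n) \sum_(l < n) bonrm (a k l)) * nrm (@ipn R _ (@rip R) _) x.
Proof.
apply: le_trans (nrm_ipn_le_sum _) _; rewrite mulr_suml.
apply: ler_sum => k _; rewrite mulr_suml /ampl.
elim/big_ind2: _ => [|b a' d c h1 h2|l _]; first by rewrite /hn (nrm0 hip).
  by apply: le_trans (nrmD hip _ _) _; exact: lerD.
apply: le_trans (bonrm_bnd _ _ _) _; apply: ler_wpM2l; first exact: onrm_ge0.
exact: hn_le_ipn.
Qed.

Lemma ampl_adjointable (I : pointedType) (a : 'M[bop R I]_n) :
  adjointable (@ipn R _ (@rip R) _) (ampl a).
Proof.
exists (\sum_(k < n) \sum_(l < n) bonrm (a k l)), (ampl (\matrix_(k, l) bstar (a l k))); split.
- by apply: sumr_ge0 => k _; apply: sumr_ge0 => l _; exact: onrm_ge0.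
- move=> i c x y; apply/funext => k.
  change (\sum_(l < n) a k l i ((c *: x + y) l) =
    c *: (\sum_(l < n) a k l i (x l)) + \sum_(l < n) a k l i (y l)).
  rewrite scaler_sumr -big_split; apply: eq_bigr => l _ /=.
  by rewrite [(c *: x + y) l]/(c *: x l + y l) bop_linear.
- by move=> i x; exact: ampl_bnd.
- move=> i x y; rewrite /ipn /ampl.
  have ripsl (F : 'I_n -> H) v : rip (\sum_(l < n) F l) v = \sum_(l < n) rip (F l) v.
    by elim/big_ind2: _ => [|b a' d c <- <-|//]; rewrite ?(ip0l hip) ?(ipDl hip).
  under eq_bigr do rewrite ripsl.
  rewrite exchange_big /=; apply: eq_bigr => l _.
  rewrite (ipC hip) ripsl; apply: eq_bigr => k _.
  by rewrite mxE bstarP (ipC hip).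
Qed.

Definition mxnrm (I : pointedType) (a : 'M[bop R I]_n) : R := onrm (@ipn R _ (@rip R) _) (ampl a).

Lemma mxnrm_is_cstar (I : pointedType) : @is_cstar_norm R (bop_cstar R I) n (@mxnrm I).
Proof.
split.
- move=> a /(onrm0_eq0 hipn (ampl_adjointable a)) h; apply/matrixP => k l.
  rewrite mxE; apply: bopP => i u; rewrite bop_zeroE.
  have := congr1 (fun F => F i (fun m => if m == l then u else 0) k) h.
  rewrite /ampl (bigD1 l) //= eqxx big1; first by rewrite addr0.
  by move=> m /negbTE ->; rewrite bop0.
- move=> a b; rewrite /mxnrm.
  have -> : ampl (a + b) = ampl a + ampl b.
    apply/funext => i; apply/funext => x; apply/funext => k.
    change (\sum_(l < n) (a + b) k l i (x l) =
      \sum_(l < n) a k l i (x l) + \sum_(l < n) b k l i (x l)).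
    rewrite -big_split; by apply: eq_bigr => l _; rewrite mxE.
  by apply: (onrmD hipn); exact: ampl_adjointable.
- move=> c a; rewrite /mxnrm.
  have -> : ampl (map_mx ( *:%R c) a) = c *: ampl a.
    apply/funext => i; apply/funext => x; apply/funext => k.
    change (\sum_(l < n) map_mx ( *:%R c) a k l i (x l) =
      c *: (\sum_(l < n) a k l i (x l))).
    rewrite scaler_sumr.
    by apply: eq_bigr => l _; rewrite mxE.
  by apply: (onrmZ hipn); exact: ampl_adjointable.
- move=> a b; rewrite /mxnrm.
  have -> : ampl (cs_mulmx (a : 'M[bop_cstar R I]_n) b) = ocomp (ampl a) (ampl b).
    apply/funext => i; apply/funext => x; apply/funext => k.
    rewrite /ocomp /ampl.
    under [RHS]eq_bigr do rewrite bop_sum.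
    rewrite exchange_big /=; apply: eq_bigr => l _.
    by rewrite mxE bop_sumE.
  by apply: (onrm_comp hipn); exact: ampl_adjointable.
- move=> a; rewrite /mxnrm.
  have -> : ampl (cs_mulmx (cs_starmx (a : 'M[bop_cstar R I]_n)) a) =
      ocomp (ampl (cs_starmx (a : 'M[bop_cstar R I]_n))) (ampl a).
    apply/funext => i; apply/funext => x; apply/funext => k.
    rewrite /ocomp /ampl.
    under [RHS]eq_bigr do rewrite bop_sum.
    rewrite exchange_big /=; apply: eq_bigr => l _.
    by rewrite mxE bop_sumE.
  apply: (onrm_cstar hipn (ampl_adjointable a)).
  move=> i x y; rewrite /ipn /ampl.
  have ripsl (F : 'I_n -> H) v : rip (\sum_(l < n) F l) v = \sum_(l < n) rip (F l) v.
    by elim/big_ind2: _ => [|b a' d c <- <-|//]; rewrite ?(ip0l hip) ?(ipDl hip).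
  under eq_bigr do rewrite ripsl.
  rewrite exchange_big /=; apply: eq_bigr => l _.
  rewrite (ipC hip) ripsl; apply: eq_bigr => k _.
  by rewrite mxE /= bstarP (ipC hip).
Qed.

(** On the disc this is the hypothesis, coordinate by coordinate; on the shifts it
is von Neumann's inequality. *)
Lemma pcalc_ampl_le (P : 'M[{poly R[i]}]_n) (C : R) :
  (forall z, normc z <= 1 -> opnorm (map_mx (fun p => p.[z]) P) <= C) ->
  forall i x, nrm (@ipn R _ (@rip R) _) (ampl (map_mx pcalc P) i x) <= C * nrm (@ipn R _ (@rip R) _) x.
Proof.
move=> hC i x.
have C0 : 0 <= C by apply: le_trans (hC 0 _); rewrite ?opnorm_ge0// normc0.
rewrite -(@ler_pXn2r _ 2) ?nnegrE ?mulr_ge0 ?nrm_ge0// exprMn !(nrm_sqr hipn).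
apply: ipn_le => D; apply: (@le_trans _ _ (C ^+ 2 * \sum_(k < n) \sum_(j < D) normc (x k j) ^+ 2)); last first.
  by rewrite ler_wpM2l ?sqr_ge0// ipn_partial_le.
case: i => [z|k0].
  rewrite exchange_big [X in _ * X]exchange_big /= mulr_sumr; apply: ler_sum => j _.
  have := opnorm_bnd (map_mx (fun p => p.[set_val z]) P) (\col_l x l j).
  set A := map_mx _ _; set v := \col_l _ => h.
  have -> : \sum_(k < n) normc (x k j) ^+ 2 = eucl_norm v ^+ 2.
    by rewrite eucl_sqr; apply: eq_bigr => k _; rewrite mxE.
  have -> : \sum_(k < n) normc (ampl (map_mx pcalc P) (inl z) x k j) ^+ 2 = eucl_norm (A *m v) ^+ 2.
    rewrite eucl_sqr; apply: eq_bigr => k _; rewrite mxE /ampl l2_sumE.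
    congr (normc _ ^+ 2); apply: eq_bigr => l _.
    by rewrite !mxE pcalc_disc l2_scaleE.
  rewrite -exprMn ler_pXn2r ?nnegrE ?mulr_ge0 ?eucl_ge0//; apply: le_trans h _.
  by rewrite ler_wpM2r ?eucl_ge0// hC// closed_discP.
have := @von_neumann R (wt k0) (wt01 k0) D n P C hC (fun l j => x l j).
move/(le_trans _); apply; rewrite le_eqVlt; apply/orP; left; apply/eqP.
apply: eq_bigr => k _; apply: eq_bigr => j _; congr (normc _ ^+ 2).
by rewrite /ampl l2_sumE; apply: eq_bigr => l _; rewrite mxE pcalc_shift.
Qed.

End Ampl.

Lemma pcalc_norm_le p (C : R) : (forall z, normc z <= 1 -> normc p.[z] <= C) ->
  bonrm (pcalc p) <= C.
Proof.
move=> hC; have C0 : 0 <= C by apply: le_trans (hC 0 _); rewrite ?normc_ge0// normc0.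
apply: bonrm_le => // i u.
have := @pcalc_ampl_le 1 (const_mx p) C _ i (fun=> u).
have e1 (x : 'I_1 -> H) : nrm (@ipn R _ (@rip R) _) x = hn (x 0) by rewrite /nrm /ipn big_ord1.
rewrite !e1 /ampl big_ord1 !mxE; apply=> z z1.
apply: le_trans (opnorm_entries _) _; rewrite !big_ord1 !mxE; exact: hC.
Qed.

End ModelOperator.

(** * The disc algebra calculus and the covers that it generates *)

Section EuclTriangle.
Variable R : realType.

Lemma ReIm_is_ip : @is_ip R R[i]^o (fun a b => Re a * Re b + Im a * Im b).
Proof.
split.
- by move=> [a b] [c d] /=; ring.
- by move=> [a b] [c d] [x y] /=; ring.
- by move=> [k l] [a b] [c d] /=; ring.
- by move=> r [a b] [c d] /=; ring.
- by move=> [a b] /=; rewrite -!expr2 addr_ge0 ?sqr_ge0.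
- move=> [a b] /= /eqP; rewrite -!expr2 paddr_eq0 ?sqr_ge0// !sqrf_eq0.
  by move=> /andP[/eqP -> /eqP ->].
Qed.

Lemma eucl_nrm n (v : 'cV[R[i]]_n) :
  eucl_norm v = nrm (@ipn R R[i]^o (fun a b => Re a * Re b + Im a * Im b) n) (fun i => v i 0).
Proof.
by rewrite /eucl_norm /nrm /ipn; congr Num.sqrt; apply: eq_bigr => i _; rewrite normc_sqr !expr2.
Qed.

Lemma euclD n (u v : 'cV[R[i]]_n) : eucl_norm (u + v) <= eucl_norm u + eucl_norm v.
Proof.
rewrite !eucl_nrm; apply: le_trans (nrmD (ipn_is_ip n ReIm_is_ip) _ _).
by rewrite le_eqVlt; apply/orP; left; apply/eqP; congr nrm; apply/funext => i; rewrite mxE.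
Qed.

Lemma opnormD n (A B : 'M[R[i]]_n) : opnorm (A + B) <= opnorm A + opnorm B.
Proof.
apply: opnorm_le => [|v]; first by rewrite addr_ge0 ?opnorm_ge0.
rewrite mulmxDl mulrDl; apply: le_trans (euclD _ _) _.
by apply: lerD; exact: opnorm_bnd.
Qed.

End EuclTriangle.

Local Opaque pcalc.

Section DiscCalculus.
Variable R : realType.
Local Notation H := (l2 R).
Local Notation hip := (rip_is_ip R).
Local Notation BI := (bop R (idx R)).
Implicit Types (f g : disc_algebra R) (p q : {poly R[i]}).

Definition dext f : R[i] -> R[i] := valL_ 0 (f : closed_disc R -> R[i]).

Lemma dext_val f (z : closed_disc R) : dext f (set_val z) = f z.
Proof. by case: z => z hz; exact: (disc_extE f hz). Qed.

Lemma in_closed_disc z : normc z <= 1 -> z \in closed_disc R.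
Proof. by move=> h; rewrite inE /closed_disc /= normcEc lecR. Qed.

Lemma dextE f z (h : normc z <= 1) : dext f z = f (exist _ z (in_closed_disc h)).
Proof. exact: (disc_extE f (in_closed_disc h)). Qed.

Lemma dext_lin k f g z : normc z <= 1 -> dext (k *: f + g) z = k * dext f z + dext g z.
Proof. by move=> h; rewrite !dextE. Qed.

Lemma dextM f g z : normc z <= 1 -> dext (f * g) z = dext f z * dext g z.
Proof. by move=> h; rewrite !dextE. Qed.

Lemma dext1 z : normc z <= 1 -> dext 1 z = 1.
Proof. by move=> h; rewrite !dextE. Qed.

Lemma zfun_in : (fun z : closed_disc R => set_val z : R[i]) \in @disc_fun R.
Proof.
apply/asboolP; split.
  by move=> z; apply: initial_continuous.
have E (h : closed_disc R -> R[i]) w (hw : w \in closed_disc R) :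
    valL_ 0 h w = h (exist _ w hw) by rewrite -[h in RHS](@valLK _ _ 0).
move=> z z1; apply: (@near_eq_derivable _ _ _ (id : R[i] -> R[i]^o)) => //.
near=> w.
have hw : w \in closed_disc R.
  rewrite inE /closed_disc /=; apply: ltW.
  by near: w; exact: (@cvgr_norm_lt _ _ _ _ _ id _ cvg_id).
by rewrite (E _ _ hw).
Unshelve. all: by end_near. Qed.

(** The coordinate function, the generator of the disc algebra. *)
Definition zfun : disc_algebra R := DiscAlgebra zfun_in.

Lemma dext_zfun z : normc z <= 1 -> dext zfun z = z.
Proof. by move=> h; rewrite !dextE. Qed.

Definition dapprox f p (e : R) := forall z, normc z <= 1 -> normc (dext f z - p.[z]) <= e.

Lemma dapprox_ex f e : 0 < e -> exists p, dapprox f p e.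
Proof. exact: disc_poly_dense. Qed.

Lemma bop_cn (b : BI) : cn b = bonrm b. Proof. by []. Qed.

(** The functional calculus f |-> f(T) for the model family T, obtained by density
from the contractivity of the polynomial calculus.  The bound for all
approximations characterizes the value. *)
Lemma dcalc_ex f : exists b : BI, forall p e, dapprox f p e -> cn (b - pcalc p) <= e.
Proof.
have e0 n : 0 < n.+1%:R^-1 :> R by rewrite invr_gt0 ltr0n.
have [x hx] := choice (fun n => dapprox_ex f (e0 n)).
have small := @small_natSinv R.
have dist p q (a b : R) : dapprox f p a -> dapprox f q b -> cn (pcalc p - pcalc q : BI) <= a + b.
  move=> hp hq; rewrite -pcalcB; apply: pcalc_norm_le => z z1.
  rewrite hornerD hornerN (_ : _ - _ = (dext f z - q.[z]) - (dext f z - p.[z])); last by ring.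
  apply: le_trans (le_normcD _ _) _; rewrite normcN addrC.
  by apply: lerD; [exact: hp | exact: hq].
have [|l hl] := @cseq_cvg R BI (fun n => pcalc (x n)).
  move=> e ep; have e2 : 0 < e / 2 by rewrite divr_gt0.
  have [N hN] := small _ e2; exists N => n m Nn Nm.
  apply: le_trans (dist _ _ _ _ (hx n) (hx m)) _.
  by rewrite [leRHS](splitr e); apply: lerD; exact: hN.
exists l => p e hp; apply/ler_addgt0Pr => d d0; have d2 : 0 < d / 2 by rewrite divr_gt0.
have [N1 h1] := hl _ d2; have [N2 h2] := small _ d2; pose n := maxn N1 N2.
apply: le_trans (cn_triangle _ (pcalc (x n)) _) _.
have h3 := h1 n (leq_maxl _ _); rewrite cnB in h3.
apply: le_trans (lerD h3 (dist _ _ _ _ (hx n) hp)) _.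
have h4 := h2 n (leq_maxr _ _).
apply: le_trans (lerD (lexx _) (lerD h4 (lexx _))) _.
by rewrite [d in e + d]splitr; lra.
Qed.

Definition dcalc f : BI := projT1 (cid (dcalc_ex f)).

Lemma dcalcP f p e : dapprox f p e -> cn (dcalc f - pcalc p) <= e.
Proof. exact: (projT2 (cid (dcalc_ex f))). Qed.

Lemma dcalc_linear : linear dcalc.
Proof.
move=> k f g; apply/eqP; rewrite -subr_eq0; apply/eqP.
apply: (@cn_small _ _ _ (2 * (normc k + 1))) => e e0 _.
have [p hp] := dapprox_ex f e0; have [q hq] := dapprox_ex g e0.
have h : dapprox (k *: f + g) (k *: p + q) ((normc k + 1) * e).
  move=> z z1; rewrite dext_lin// hornerD hornerZ.
  rewrite (_ : _ - _ = k * (dext f z - p.[z]) + (dext g z - q.[z])); last by ring.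
  apply: le_trans (le_normcD _ _) _; rewrite normcM mulrDl mul1r.
  by apply: lerD; [rewrite ler_wpM2l ?normc_ge0// hp | exact: hq].
have h1 := dcalcP h; have h2 := dcalcP hp; have h3 := dcalcP hq.
apply: le_trans (cn_triangle _ (pcalc (k *: p + q)) _) _.
have -> : pcalc (k *: p + q) - (k *: dcalc f + dcalc g) =
   k *: (pcalc p - dcalc f) + (pcalc q - dcalc g).
  by rewrite pcalc_lin scalerBr opprD addrACA.
apply: le_trans (lerD h1 (cnD _ _)) _; rewrite cnZ (cnB (pcalc p)) (cnB (pcalc q)).
have h4 := ler_wpM2l (normc_ge0 k) h2.
apply: le_trans (lerD (lexx _) (lerD h4 h3)) _; move: (normc k) => {h1 h2 h3 h4} K.
by lra.
Qed.

Local Opaque dcalc.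

Lemma dext_bounded f : exists2 M : R, 0 <= M & forall z, normc z <= 1 -> normc (dext f z) <= M.
Proof.
have [M hM] := disc_ext_bounded f; exists M => //.
by apply: le_trans (hM 0 _); rewrite ?normc_ge0// normc0.
Qed.

Lemma dcalcM f g : dcalc (f * g) = dcalc f * dcalc g.
Proof.
have [M M0 hM] := dext_bounded f; have [N N0 hN] := dext_bounded g.
apply/eqP; rewrite -subr_eq0; apply/eqP.
apply: (@cn_small _ _ _ (M + N + 1 + (cn (dcalc f) + cn (dcalc g) + 1))) => e e0 e1.
have [p hp] := dapprox_ex f e0; have [q hq] := dapprox_ex g e0.
have h : dapprox (f * g) (p * q) ((M + N + 1) * e).
  move=> z z1; rewrite dextM// hornerM.
  have := hp z z1; have := hq z z1; have := hM z z1; have := hN z z1.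
  set a := dext f z; set b := dext g z => hb ha hbq hap.
  rewrite (_ : _ - _ = a * (b - q.[z]) + (a - p.[z]) * b - (a - p.[z]) * (b - q.[z])); last by ring.
  apply: le_trans (le_normcD _ _) _; rewrite normcN.
  rewrite [leRHS](_ : _ = M * e + e * N + 1 * e); last by ring.
  apply: lerD; last by rewrite normcM; apply: ler_pM; rewrite ?normc_ge0 ?(le_trans hap).
  apply: le_trans (le_normcD _ _) _; rewrite !normcM.
  by apply: lerD; apply: ler_pM; rewrite ?normc_ge0.
have h1 := dcalcP h; have h2 := dcalcP hp; have h3 := dcalcP hq.
rewrite cnB in h2; rewrite cnB in h3.
apply: le_trans (cn_triangle _ (pcalc (p * q)) _) _; rewrite mulrDl; apply: (lerD h1).
rewrite pcalcM.
exact: (@cs_mul_approx R (bop_cstar R (idx R)) (pcalc p) (pcalc q) (dcalc f) (dcalc g) e h2 h3 e1).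
Qed.

Lemma dcalc_exact f p : (forall z, normc z <= 1 -> dext f z = p.[z]) -> dcalc f = pcalc p.
Proof.
move=> h; apply/eqP; rewrite -subr_eq0; apply/eqP; apply: (@cn_small _ _ _ 0) => e _ _.
by rewrite mul0r; apply: dcalcP => z z1; rewrite h// subrr normc0.
Qed.

Lemma dcalc1 : dcalc 1 = 1.
Proof.
rewrite (@dcalc_exact _ 1) => [|z z1]; last by rewrite dext1// hornerC.
exact: pcalc1.
Qed.

Lemma dcalc_zfun : dcalc zfun = model R.
Proof.
rewrite (@dcalc_exact _ 'X) => [|z z1]; last by rewrite dext_zfun// hornerX.
exact: pcalcX.
Qed.

Lemma dcalc_disc f (z : closed_disc R) (u : H) : dcalc f (inl z) u = f z *: u.
Proof.
apply/eqP; rewrite -subr_eq0; apply/eqP; apply: (nrm0_eq0 hip).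
apply/le_anti; rewrite nrm_ge0 andbT; apply/ler_addgt0Pl => e e0; rewrite addr0.
have q0 : 0 < 2 * hn u + 1 by rewrite ltr_wpDl// mulr_ge0// nrm_ge0.
have [p hp] := dapprox_ex f (divr_gt0 e0 q0).
set d := e / _ in hp.
apply: le_trans (nrm_triangle hip _ (pcalc p (inl z) u) _) _.
have h1 : nrm (@rip R) (dcalc f (inl z) u - pcalc p (inl z) u) <= d * hn u.
  apply: le_trans (bonrm_bnd (dcalc f - pcalc p) (inl z) u) _.
  by rewrite ler_wpM2r ?nrm_ge0// -bop_cn dcalcP.
have h2 : nrm (@rip R) (pcalc p (inl z) u - f z *: u) <= d * hn u.
  rewrite pcalc_disc -scalerBl (nrmZ hip) ler_wpM2r ?nrm_ge0// normcB -dext_val.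
  exact/hp/closed_discP.
apply: le_trans (lerD h1 h2) _; have : d * (2 * hn u + 1) = e by rewrite divfK// gt_eqF.
have : 0 <= d by rewrite divr_ge0// ltW.
by lra.
Qed.

Section MatrixNorm.
Variable n : nat.
Implicit Type F : 'M[disc_algebra R]_n.
Local Notation NN := (nrm (@ipn R _ (@rip R) n)).
Local Notation hipn := (ipn_is_ip n hip).

Definition mxeval F (z : closed_disc R) : 'M[R[i]]_n := map_mx (fun f : disc_algebra R => f z) F.

Lemma disc_mxnorm_ge F z : opnorm (mxeval F z) <= disc_mxnorm F.
Proof.
apply: ub_le_sup; last by exists z.
have /choice[M hM] (kl : 'I_n * 'I_n) : exists M : R, forall z, normc z <= 1 -> normc (dext (F kl.1 kl.2) z) <= M.
  by have [M _ hM] := dext_bounded (F kl.1 kl.2); exists M.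
exists (\sum_(k < n) \sum_(l < n) M (k, l)) => _ [w _ <-].
apply: le_trans (opnorm_entries _) _; apply: ler_sum => k _; apply: ler_sum => l _.
by rewrite mxE -dext_val; apply: (hM (k, l)); exact: closed_discP.
Qed.

Lemma disc_mxnorm_ge0 F : 0 <= disc_mxnorm F.
Proof.
have h0 : normc (0 : R[i]) <= 1 by rewrite normc0.
by apply: le_trans (disc_mxnorm_ge F (exist _ 0 (in_closed_disc h0))); exact: opnorm_ge0.
Qed.

Lemma dcalc_ampl_le F i x : NN (ampl (map_mx dcalc F) i x) <= disc_mxnorm F * NN x.
Proof.
apply/ler_addgt0Pr => e e0.
pose c := 2 * (n%:R * n%:R) * NN x + 1.
have c0 : 0 < c by rewrite ltr_wpDl// !mulr_ge0// ?nrm_ge0// ler0n.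
have d0 : 0 < e / c by rewrite divr_gt0.
have /choice[P hP] (kl : 'I_n * 'I_n) := dapprox_ex (F kl.1 kl.2) d0.
set d := e / c in d0 hP.
pose PM := \matrix_(k, l) P (k, l).
have sumd : \sum_(k < n) \sum_(l < n) d = n%:R * n%:R * d.
  by rewrite sumr_const card_ord sumr_const card_ord -mulrnA -[LHS]mulr_natl natrM.
have hop z : normc z <= 1 -> opnorm (map_mx (fun p => p.[z]) PM) <= disc_mxnorm F + n%:R * n%:R * d.
  move=> z1; pose zz : closed_disc R := exist _ z (in_closed_disc z1).
  rewrite -[map_mx _ PM](subrK (mxeval F zz)) addrC.
  apply: le_trans (opnormD _ _) _; apply: lerD; first exact: disc_mxnorm_ge.
  apply: le_trans (opnorm_entries _) _; rewrite -sumd.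
  apply: ler_sum => k _; apply: ler_sum => l _.
  by rewrite !mxE normcB -dext_val; exact: (hP (k, l)).
have h1 := pcalc_ampl_le hop i x.
have h2 : NN (ampl (map_mx dcalc F - map_mx (@pcalc R) PM) i x) <= n%:R * n%:R * d * NN x.
  apply: le_trans (ampl_bnd _ _ _) _; rewrite ler_wpM2r ?nrm_ge0// -sumd.
  apply: ler_sum => k _; apply: ler_sum => l _.
  by rewrite !mxE -bop_cn; apply: dcalcP; exact: (hP (k, l)).
have -> : ampl (map_mx dcalc F) i x = ampl (map_mx dcalc F - map_mx (@pcalc R) PM) i x + ampl (map_mx (@pcalc R) PM) i x.
  apply/funext => k.
  change (\sum_(l < n) map_mx dcalc F k l i (x l) =
    \sum_(l < n) (map_mx dcalc F - map_mx (@pcalc R) PM) k l i (x l) +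
    \sum_(l < n) map_mx (@pcalc R) PM k l i (x l)).
  by rewrite -big_split; apply: eq_bigr => l _ /=; rewrite !mxE bop_addE bop_oppE subrK.
apply: le_trans (nrmD hipn _ _) _; apply: le_trans (lerD h2 h1) _.
have : d * c = e by rewrite divfK// gt_eqF.
rewrite /c; lra.
Qed.

(** A scalar matrix A acts on the copy of C^n spanned by the vectors e_0, so that
the disc fibers see its operator norm. *)
Lemma dcalc_ampl_ge F (C : R) (z : closed_disc R) : 0 <= C ->
  (forall x, NN (ampl (map_mx dcalc F) (inl z) x) <= C * NN x) -> opnorm (mxeval F z) <= C.
Proof.
move=> C0 hC; apply: opnorm_le => // v.
have key (w : 'cV[R[i]]_n) : NN (fun k => w k 0 *: ev R 0) = eucl_norm w.
  rewrite /nrm /eucl_norm; congr Num.sqrt; apply: eq_bigr => k _.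
  by rewrite -(nrm_sqr hip) (nrmZ hip) -/(hn _) hn_ev mulr1.
have := hC (fun k => v k 0 *: ev R 0); rewrite key -(key (mxeval F z *m v)).
congr (nrm _ _ <= _); apply/funext => k; rewrite mxE scaler_suml /ampl.
by apply: eq_bigr => l _; rewrite !mxE dcalc_disc scalerA.
Qed.

End MatrixNorm.

Section Reindex.
Variable kap : idx R -> idx R.

Lemma breidx_adjointable (b : BI) : adjointable (@rip R) (fun i => b (kap i)).
Proof.
have [M [T' [M0 l bd a]]] := bop_adj b; exists M, (fun i => T' (kap i)).
by split => //; move=> i; exact: l.
Qed.

(** Replacing the fiber at i by that at kap i; forgetting fibers is of this form. *)
Definition breidx (b : BI) : BI := Bop (introT (asboolP _) (breidx_adjointable b)).

Lemma breidxE b i u : breidx b i u = b (kap i) u. Proof. by []. Qed.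

Lemma breidx_hom : @star_hom R (bop_cstar R (idx R)) (bop_cstar R (idx R)) breidx.
Proof.
split => [k a b|a b|a]; try exact: bopP.
by apply/esym; apply: bstar_uniq => i u v; rewrite !breidxE bstarP.
Qed.

Lemma breidx_cn b : cn (breidx b) <= cn b.
Proof.
apply: bonrm_le => [|i u]; first exact: onrm_ge0.
exact: (bonrm_bnd b (kap i) u).
Qed.
End Reindex.

Section Cover.
Variable kap : idx R -> idx R.
Hypothesis kapz : forall z, kap (inl z) = inl z.
Local Notation BC := (bop_cstar R (idx R)).

Definition model_gens : set BC := [set b | b = (1 : BI) \/ b = breidx kap (model R)].
(** The closed *-algebra generated by the reindexed model and the unit. *)
Definition calg : set BC := cstar_generated model_gens.
Definition calgP : cstar_subalgebra calg := cstar_generated_subalgebra model_gens.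

Lemma calg1 : calg (1 : BI).
Proof. by move=> S [_ h]; apply: h; left. Qed.

Lemma calgT : calg (breidx kap (model R)).
Proof. by move=> S [_ h]; apply: h; right. Qed.

Lemma calg_dcalc f : calg (breidx kap (dcalc f)).
Proof.
have hp p : calg (breidx kap (pcalc p)).
  rewrite pcalcE; elim/big_ind: _ => [|a b ha hb|m _].
  - have -> : breidx kap (0 : BI) = 0 by exact: bopP.
    exact: (csub0 calgP).
  - have -> : breidx kap (a + b : BI) = 1 *: breidx kap a + breidx kap b.
      by rewrite scale1r; exact: bopP.
    exact: (csub_linear calgP).
  - have hm : calg (breidx kap (model R ^+ m)).
      elim: (nat_of_ord m) => [|j IH].
        have -> : breidx kap (model R ^+ 0) = (1 : BI) by exact: bopP.
        exact: calg1.
      have -> : breidx kap (model R ^+ j.+1) = @cs_mul R BC (breidx kap (model R)) (breidx kap (model R ^+ j)).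
        by apply: bopP => i u; rewrite exprS.
      by apply: (csub_mul calgP) => //; exact: calgT.
    have -> : breidx kap (p`_m *: model R ^+ m) = p`_m *: breidx kap (model R ^+ m) + (0 : BI).
      by rewrite addr0; exact: bopP.
    by apply: (csub_linear calgP) => //; exact: (csub0 calgP).
apply: (closed_cnP calg).1 (csub_closed calgP) _ _ => e e0.
have [p pe] := dapprox_ex f e0; exists (breidx kap (pcalc p)) => //.
rewrite -(shB (breidx_hom kap)); apply: le_trans (breidx_cn _ _) _; exact: dcalcP.
Qed.

Definition cmap f : sub_cstar calgP := mk_subcs calgP (calg_dcalc f).

Lemma cmap_linear : linear cmap.
Proof.
move=> k f g; apply: val_inj; apply: bopP => i u.
exact: (congr1 (fun b : BI => b (kap i) u) (dcalc_linear k f g)).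
Qed.

Lemma cmap_mul : {morph cmap : f g / f * g >-> cs_mul f g}.
Proof.
move=> f g; apply: val_inj; apply: bopP => i u.
exact: (congr1 (fun b : BI => b (kap i) u) (dcalcM f g)).
Qed.

Lemma cmap_isometric : completely_isometric cmap.
Proof.
move=> n; exists (fun a => mxnrm (map_mx (@subcs_val R BC calg calgP) a)).
  have [n0 nD nZ nM nS] := @mxnrm_is_cstar R n (idx R).
  have valsum (F : 'I_n -> subcs calgP) : subcs_val (\sum_(k < n) F k) = \sum_(k < n) subcs_val (F k).
    by elim/big_ind2: _ => // [x a y b <- <-].
  split.
  - move=> a /n0 h; apply/matrixP => k l; rewrite mxE; apply: val_inj.
    by have := congr1 (fun F : matrix BI n n => F k l) h; rewrite !mxE.
  - move=> a b; apply: le_trans (nD _ _); rewrite le_eqVlt; apply/orP; left; apply/eqP.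
    by congr mxnrm; apply/matrixP => k l; rewrite !mxE.
  - move=> c a; rewrite -nZ; congr mxnrm; apply/matrixP => k l; by rewrite !mxE.
  - move=> a b; apply: le_trans (nM _ _); rewrite le_eqVlt; apply/orP; left; apply/eqP.
    congr mxnrm; apply/matrixP => k l; rewrite !mxE valsum.
    by apply: eq_bigr => m _; rewrite !mxE.
  - move=> a; rewrite -nS; congr mxnrm; apply/matrixP => k l; rewrite !mxE valsum.
    by apply: eq_bigr => m _; rewrite !mxE.
move=> F; apply/eqP; rewrite eq_le; apply/andP; split.
  apply: onrm_le => [|i x]; first exact: disc_mxnorm_ge0.
  have -> : ampl (map_mx (@subcs_val R BC calg calgP) (map_mx cmap F)) i x = ampl (map_mx dcalc F) (kap i) x.
    by apply/funext => k; apply: eq_bigr => l _; rewrite !mxE.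
  exact: dcalc_ampl_le.
apply: ge_sup.
  have h0 : normc (0 : R[i]) <= 1 by rewrite normc0.
  pose z0 : closed_disc R := exist _ 0 (in_closed_disc h0).
  by exists (opnorm (mxeval F z0)); exists z0.
move=> _ [z _ <-]; apply: dcalc_ampl_ge => [|x]; first exact: onrm_ge0.
have -> : ampl (map_mx dcalc F) (inl z) x = ampl (map_mx (@subcs_val R BC calg calgP) (map_mx cmap F)) (inl z) x.
  by apply/funext => k; apply: eq_bigr => l _; rewrite !mxE /= breidxE kapz.
exact: (onrm_bnd (ipn_is_ip n hip) (ampl_adjointable _)).
Qed.

Lemma cmap_generates : cstar_generated (range cmap) = setT.
Proof.
apply: sub_generated => g [->|->]; [exists 1 | exists zfun]; rewrite /=.
  by apply: bopP => i u; rewrite breidxE dcalc1.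
by rewrite dcalc_zfun.
Qed.

(** Since kap fixes the disc, the disc fibers make the calculus completely
isometric whatever kap does to the shifts. *)
Definition model_cover : cstar_cover R :=
  @CStarCover R (sub_cstar calgP) cmap cmap_linear cmap_mul cmap_isometric cmap_generates.

End Cover.
End DiscCalculus.

(** * Closed subalgebras cut out by intertwiners and by convergence *)

Section SubalgebraTools.
Variable R : realType.
Local Notation H := (l2 R).
Local Notation hip := (rip_is_ip R).
Local Notation BI := (bop R (idx R)).
Local Notation BC := (bop_cstar R (idx R)).
Implicit Types (b : BI) (i j : idx R) (u v : H).

Lemma bop_diff_le b b' i u : hn (b i u - b' i u) <= cn (b - b') * hn u.
Proof. exact: (bonrm_bnd (b - b') i u). Qed.

Lemma hn_small u (K : R) : (forall e : R, 0 < e -> hn u <= K * e) -> u = 0.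
Proof.
move=> h; apply: (nrm0_eq0 hip); apply/le_anti; rewrite nrm_ge0 andbT.
apply/ler_addgt0Pl => e e0; rewrite addr0.
have K0 : 0 <= K by rewrite -[K]mulr1; apply: le_trans (h 1 ltr01); exact: nrm_ge0.
have q0 : 0 < K + 1 by rewrite ltr_wpDl.
apply: le_trans (h _ (divr_gt0 e0 q0)) _; rewrite mulrCA ler_piMr ?(ltW e0)//.
by rewrite ler_pdivrMr// mul1r lerDl.
Qed.

(** A contraction together with its adjoint. *)
Definition contr (Q Q' : H -> H) := [/\ linear Q, (forall u, hn (Q u) <= hn u) &
  forall u v, rip (Q u) v = rip u (Q' v)].

Lemma linB (Q : H -> H) u v : linear Q -> Q (u - v) = Q u - Q v.
Proof. by move=> l; have := l (-1) v u; rewrite !scaleN1r (addrC (- v)) (addrC (- Q v)). Qed.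

(** Two mutually adjoint intertwining relations are stable under adjoints and
limits, so that they extend from generators to the whole generated algebra. *)
Lemma intertwine_subalgebra i j (Q Q' : H -> H) : contr Q Q' -> contr Q' Q ->
  cstar_subalgebra [set b : BC | (forall u, (b : BI) i (Q u) = Q ((b : BI) j u)) /\
                           (forall u, (b : BI) j (Q' u) = Q' ((b : BI) i u))].
Proof.
move=> [l1 c1 a1] [l2 c2 a2].
have Q0 (P : H -> H) : linear P -> P 0 = 0.
  by move=> l; have := linB 0 0 l; rewrite !subrr.
have half i0 j0 (P P' : H -> H) (x : BI) : linear P -> (forall u, hn (P u) <= hn u) ->
    (forall e : R, 0 < e -> exists2 y : BI, (forall u, y i0 (P u) = P (y j0 u)) & cn (x - y) <= e) ->
    forall u, x i0 (P u) = P (x j0 u).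
  move=> l c h u; apply/eqP; rewrite -subr_eq0; apply/eqP; apply: (@hn_small _ (2 * hn u)) => e e0.
  have [y yE xy] := h e e0.
  rewrite (_ : _ - _ = (x i0 (P u) - y i0 (P u)) - P (x j0 u - y j0 u)); last first.
    by rewrite (linB _ _ l) yE opprB addrA subrK.
  apply: le_trans (nrmD hip _ _) _; rewrite (nrmN hip).
  have h1 := bop_diff_le x y i0 (P u); have h2 := bop_diff_le x y j0 u.
  have h3 := c (x j0 u - y j0 u); have h4 := c u.
  have n0 : 0 <= hn u by exact: nrm_ge0.
  have h5 : cn (x - y) * hn (P u) <= e * hn u.
    by apply: ler_pM => //; [exact: cn_ge0 | exact: nrm_ge0].
  have h6 : cn (x - y) * hn u <= e * hn u by rewrite ler_wpM2r.
  rewrite -!/(hn _); lra.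
split.
- by split => u; rewrite !bop_zeroE Q0.
- move=> k a b [h1 h2] [h3 h4]; split => u; rewrite !bop_addE !bop_scaleE.
    by rewrite h1 h3 l1.
  by rewrite h2 h4 l2.
- move=> a b [h1 h2] [h3 h4]; split => u; rewrite !bmulE.
    by rewrite h3 h1.
  by rewrite h4 h2.
- move=> b [h1 h2]; split => u /=; apply: (ip_ext hip) => v.
    by rewrite a1 (ipC hip) -bstarP (ipC hip) a1 -h2 (ipC hip) bstarP (ipC hip).
  by rewrite a2 (ipC hip) -bstarP (ipC hip) a2 -h1 (ipC hip) bstarP (ipC hip).
- apply/closed_cnP => x h; split; apply: half => // e e0; have [y [y1 y2] xy] := h e e0; by exists y.
Qed.

Definition fiber_cvg b := forall e : R, 0 < e -> exists N, forall n, (N <= n)%N -> forall u,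
  hn (b (inr (Some n)) u - b (inr None) u) <= e * hn u.

(** Norm convergence of the fibers is stable under products since the fibers are
uniformly bounded, and under adjoints since these preserve bounds. *)
Lemma fiber_cvg_subalgebra : cstar_subalgebra [set b : BC | fiber_cvg b].
Proof.
split.
- move=> e e0; exists 0%N => n _ u; rewrite !bop_zeroE subrr /hn (nrm0 hip).
  by rewrite mulr_ge0 ?nrm_ge0// ltW.
- move=> k a b ha hb e e0.
  have c0 : 0 < e / (normc k + 1) by rewrite divr_gt0// ltr_wpDl ?normc_ge0.
  have [N hN] := ha _ c0; have [M hM] := hb _ c0; exists (maxn N M) => n; rewrite geq_max => /andP[Nn Mn] u.
  rewrite !bop_addE !bop_scaleE opprD addrACA -scalerBr.
  apply: le_trans (nrmD hip _ _) _; rewrite (nrmZ hip) -!/(hn _).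
  have h1 := hN n Nn u; have h2 := hM n Mn u.
  have : normc k * hn (a (inr (Some n)) u - a (inr None) u) <= normc k * (e / (normc k + 1) * hn u).
    by rewrite ler_wpM2l ?normc_ge0.
  have -> : e * hn u = (normc k + 1) * (e / (normc k + 1) * hn u).
    by field; rewrite gt_eqF// ltr_wpDl ?normc_ge0.
  by set c := e / _ in h1 h2 *; lra.
- move=> a b ha hb e e0.
  have c0 : 0 < e / (bonrm a + bonrm b + 1) by rewrite divr_gt0// ltr_wpDl// addr_ge0// onrm_ge0.
  have [N hN] := ha _ c0; have [M hM] := hb _ c0; exists (maxn N M) => n; rewrite geq_max => /andP[Nn Mn] u.
  rewrite !bmulE.
  set x := b _ u; set y := b _ u.
  rewrite (_ : _ - _ = (a (inr (Some n)) x - a (inr None) x) + a (inr None) (x - y)); last first.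
    by rewrite bopB addrA subrK.
  apply: le_trans (nrmD hip _ _) _; rewrite -!/(hn _).
  have h1 := hN n Nn x; have h2 := bonrm_bnd a (inr None) (x - y); have h3 := hM n Mn u.
  have h4 : hn x <= bonrm b * hn u by exact: bonrm_bnd.
  set c := e / _ in h1 h3.
  have h5 : c * hn x <= c * (bonrm b * hn u) by rewrite ler_pM2l.
  have h6 : bonrm a * hn (x - y) <= bonrm a * (c * hn u) by rewrite ler_wpM2l// onrm_ge0.
  have -> : e * hn u = (bonrm a + bonrm b + 1) * (c * hn u).
    by rewrite /c; field; rewrite gt_eqF// ltr_wpDl// addr_ge0// onrm_ge0.
  have : 0 <= c * hn u by rewrite mulr_ge0 ?nrm_ge0// ltW.
  by lra.
- move=> b hb e e0; have [N hN] := hb _ e0; exists N => n Nn u.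
  apply: (@adjoint_bnd _ unit _ _ hip (fun _ u => b (inr (Some n)) u - b (inr None) u)
    (fun _ u => bstar b (inr (Some n)) u - bstar b (inr None) u) e (ltW e0) _ _ tt u).
    by move=> _ w; exact: hN.
  by move=> _ w v; rewrite (ipBl hip) (ipBr hip) !bstarP.
- apply/closed_cnP => x h e e0; have e3 : 0 < e / 3 by rewrite divr_gt0.
  have [y hy xy] := h _ e3; have [N hN] := hy _ e3; exists N => n Nn u.
  have h1 := hN n Nn u; have h2 := bop_diff_le x y (inr (Some n)) u.
  have h3 := bop_diff_le x y (inr None) u.
  have h4 : cn (x - y) * hn u <= e / 3 * hn u by rewrite ler_wpM2r// nrm_ge0.
  rewrite (_ : _ - _ = (x (inr (Some n)) u - y (inr (Some n)) u) + (y (inr (Some n)) u - y (inr None) u)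
     - (x (inr None) u - y (inr None) u)); last first.
    by apply: l2P => k; rewrite !(l2_addE, l2_oppE); ring.
  apply: le_trans (nrmD hip _ _) _; rewrite (nrmN hip).
  apply: le_trans (lerD (nrmD hip _ _) (lexx _)) _; rewrite -!/(hn _).
  have -> : e * hn u = e / 3 * hn u + e / 3 * hn u + e / 3 * hn u by field.
  by apply: lerD (lerD (le_trans h2 h4) h1) (le_trans h3 h4).
Qed.

Definition hproj_fun (d : nat) (u : nat -> R[i]) : nat -> R[i] := fun k => if (k < d)%N then u k else 0.

Fact hproj_l2 d u : hproj_fun d u \in @l2_pred R.
Proof. by apply: (@fin_in_l2 _ d) => k dk; rewrite /hproj_fun ltnNge dk. Qed.

(** The projection onto the first d coordinates; tproj below is its complement. *)
Definition hproj d u : H := L2 (hproj_l2 d u).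

Lemma hprojE d u k : hproj d u k = if (k < d)%N then u k else 0. Proof. by []. Qed.

Lemma hproj_linear d : linear (hproj d).
Proof.
move=> c u v; apply: l2P => k; rewrite l2_addE l2_scaleE !hprojE l2_addE l2_scaleE.
by case: ifP => _; rewrite ?mulr0 ?addr0.
Qed.

Lemma hproj_le d u : hn (hproj d u) <= hn u.
Proof.
apply: hn_le => [|n]; first exact: nrm_ge0.
apply: le_trans (psum_le_hn u n); apply: ler_sum => k _; rewrite hprojE.
by case: ifP => _ //; rewrite normc0 expr0n sqr_ge0.
Qed.

Lemma hproj_adj d u v : rip (hproj d u) v = rip u (hproj d v).
Proof.
rewrite (@rip_fin R u (hproj d v) d); last by move=> k dk; rewrite hprojE ltnNge dk.
rewrite (ipC hip) (@rip_fin R v (hproj d u) d); last by move=> k dk; rewrite hprojE ltnNge dk.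
by apply: eq_bigr => k _; rewrite !hprojE ltn_ord; ring.
Qed.

Lemma hproj_contr d : contr (hproj d) (hproj d).
Proof. by split; [exact: hproj_linear | exact: hproj_le | exact: hproj_adj]. Qed.

Definition tproj d u : H := u - hproj d u.

Lemma tprojE d u k : tproj d u k = if (k < d)%N then 0 else u k.
Proof. by rewrite /tproj l2_addE l2_oppE hprojE; case: ifP => _; rewrite ?subrr ?subr0. Qed.

Lemma tproj_le d u : hn (tproj d u) <= hn u.
Proof.
apply: hn_le => [|n]; first exact: nrm_ge0.
apply: le_trans (psum_le_hn u n); apply: ler_sum => k _; rewrite tprojE.
by case: ifP => _ //; rewrite normc0 expr0n sqr_ge0.
Qed.

Lemma tproj_contr d : contr (tproj d) (tproj d).
Proof.
split; last by move=> u v; rewrite /tproj (ipBl hip) (ipBr hip) hproj_adj.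
  move=> c u v; apply: l2P => k; rewrite [RHS]l2_addE [X in _ = X + _]l2_scaleE !tprojE l2_addE l2_scaleE.
  by case: ifP => _; rewrite ?mulr0 ?addr0.
exact: tproj_le.
Qed.

Lemma hproj_sum d u : hproj d u = \sum_(k < d) u k *: ev R k.
Proof.
apply: l2P => i; rewrite l2_sumE hprojE; case: ltnP => [lt|ge].
  rewrite (bigD1 (Ordinal lt)) //= big1 ?addr0.
    by change (u i = u i * (i == i)%:R); rewrite eqxx mulr1.
  by move=> j ji; change (u j * (i == j)%:R = 0); rewrite -val_eqE /= eq_sym in ji; rewrite (negbTE ji) mulr0.
by rewrite big1// => j _; change (u j * (i == j)%:R = 0); rewrite gtn_eqF ?mulr0// (leq_trans (ltn_ord j)).
Qed.

Definition rank1 k l u : H := u l *: ev R k.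

Lemma rank1E k l u m : rank1 k l u m = u l * (m == k)%:R. Proof. by []. Qed.

Lemma rank1_contr k l : contr (rank1 k l) (rank1 l k).
Proof.
split.
- by move=> c u v; rewrite /rank1 l2_addE l2_scaleE scalerDl scalerA.
- by move=> u; rewrite /rank1 /hn (nrmZ hip) -/(hn _) hn_ev mulr1; exact: coord_le_hn.
- move=> u v; rewrite /rank1 (ipC hip) !(ipZr hip) !rip_ev !l2_scaleE.
  by case: (u l) (v k) => a b [c d] /=; ring.
Qed.

End SubalgebraTools.

(** * Morphisms of covers and meets of their classes *)

Section CoverMorphisms.
Variable R : realType.
Implicit Types X Y Z : cstar_cover R.
Local Notation "a ⋅ b" := (cs_mul a b) (at level 40, left associativity).

(** Morphisms of covers, with the source as the larger cover. *)
Definition cover_morph X Y (s : X -> Y) :=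
  star_hom s /\ forall f, s (cov_map X f) = cov_map Y f.

Definition unital X := is_unit (cov_map X 1).

Lemma cover_morph_comp X Y Z (s : X -> Y) (t : Y -> Z) :
  cover_morph s -> cover_morph t -> cover_morph (t \o s).
Proof.
by move=> [hs es] [ht et]; split=> [|f /=]; [exact: star_hom_comp | rewrite es et].
Qed.

Lemma cover_le_refl X : cover_le X X.
Proof. by exists id => //; exact: star_hom_id. Qed.

Lemma cover_le_trans X Y Z : cover_le X Y -> cover_le Y Z -> cover_le X Z.
Proof.
move=> [s hs es] [t ht et]; exists (s \o t); first exact: star_hom_comp.
by move=> f /=; rewrite et es.
Qed.

Lemma cover_equiv_refl X : cover_equiv X X.
Proof. by split; exact: cover_le_refl. Qed.

(** The order of classes does not depend on the representatives. *)
Lemma lat_leP X Y : lat_le (cover_class X) (cover_class Y) <-> cover_le X Y.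
Proof.
split=> [[X' [Y' [[XX' X'X] [YY' Y'Y] XY]]]|XY].
  exact: cover_le_trans XX' (cover_le_trans XY Y'Y).
by exists X, Y; split => //; exact: cover_equiv_refl.
Qed.

Lemma lat_le_class (y : cstar_lat R) : exists Y, y = cover_class Y.
Proof.
case: y => c [Y cY]; exists Y; subst c.
by rewrite /cover_class; congr CStarLat; exact: Prop_irrelevance.
Qed.

(** Meets of classes are computed on representatives. *)
Lemma is_meet_cover (K : Type) (x : K -> cstar_lat R) (X : K -> cstar_cover R) M :
  (forall k, x k = cover_class (X k)) -> (forall k, cover_le M (X k)) ->
  (forall Y, (forall k, cover_le Y (X k)) -> cover_le Y M) ->
  is_meet x (cover_class M).
Proof.
move=> xX MX glb; split=> [k|y].
  by rewrite xX; apply/lat_leP.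
have [Y ->] := lat_le_class y => h; apply/lat_leP/glb => k; apply/lat_leP.
by rewrite -xX.
Qed.

Lemma unit_subalgebra (A : cstarAlgebra R) (e : A) : cs_star e = e ->
  cstar_subalgebra [set a | e ⋅ a = a /\ a ⋅ e = a].
Proof.
move=> es; split.
- by rewrite /= cs_mul0l cs_mul0r.
- move=> k a b [a1 a2] [b1 b2].
  by split; rewrite ?cs_mulDr ?cs_mulZr ?cs_mulDl ?cs_mulZl ?a1 ?b1 ?a2 ?b2.
- by move=> a b [a1 a2] [b1 b2]; rewrite /= cs_mulA a1 -cs_mulA b2.
- by move=> a [a1 a2]; split; rewrite -{1}es -cs_star_mul ?a1 ?a2.
- have small (x z : A) (L : A -> A) : (forall u v, L (u - v) = L u - L v) ->
     (forall u, cn (L u) <= cn e * cn u) ->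
     (forall d : R, 0 < d -> exists2 y, L y = y & cn (x - y) <= d) -> L x = x.
    move=> LB Lb h; apply/eqP; rewrite -subr_eq0; apply/eqP.
    apply: (@cn_small _ _ _ (cn e + 1)) => d d0 _; have [y Ly xy] := h d d0.
    have -> : L x - x = L (x - y) - (x - y) by rewrite LB Ly opprB addrA subrK.
    apply: le_trans (cnD _ _) _; rewrite cnN mulrDl mul1r; apply: lerD => //.
    by apply: le_trans (Lb _) _; rewrite ler_wpM2l ?cn_ge0.
  apply/closed_cnP => x h; split.
    apply: (small x x (cs_mul e)) => [u v|u|d d0]; first exact: cs_mulBr.
      exact: cn_mul.
    by have [y [y1 y2] xy] := h d d0; exists y.
  apply: (small x x (fun a => a ⋅ e)) => [u v|u|d d0]; first exact: cs_mulBl.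
    by rewrite mulrC; exact: cn_mul.
  by have [y [y1 y2] xy] := h d d0; exists y.
Qed.

(** The image e of 1 is self-adjoint because the unit of X is, so that the elements
fixed by e form a *-algebra, and that one contains the generators. *)
Lemma unital_morph X Y (s : X -> Y) : unital X -> cover_morph s -> unital Y.
Proof.
move=> uX [hs es]; apply: (generated_sub _ _ (cov_map_generates Y)).
  by apply: unit_subalgebra; rewrite -es -(star_hom_star hs) (unit_self_adjoint uX).
by move=> _ [f _ <-]; split; rewrite -cov_map_mul ?mul1r ?mulr1.
Qed.

Lemma cover_morph_contractive X Y (s : X -> Y) : unital X -> cover_morph s ->
  forall a, cn (s a) <= cn a.
Proof.
move=> uX hs; exact: (star_hom_contractive hs.1 uX (unital_morph uX hs) (hs.2 1)).
Qed.

(** Two contractive *-homomorphisms that agree on generators are equal. *)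
Lemma cover_morph_unique X Y (s t : X -> Y) : unital X -> cover_morph s -> cover_morph t ->
  forall a, s a = t a.
Proof.
move=> uX hs ht; apply: (generated_sub _ _ (cov_map_generates X)).
  by apply: equalizer_subalgebra hs.1 ht.1 _ _; exact: cover_morph_contractive.
by move=> _ [f _ <-] /=; rewrite hs.2 ht.2.
Qed.

(** The closure of the range of a *-homomorphism, described by approximations. *)
Lemma range_closure_subalgebra (A Z : cstarAlgebra R) (s : A -> Z) : star_hom s ->
  cstar_subalgebra [set z | forall e : R, 0 < e -> exists a, cn (s a - z) <= e].
Proof.
move=> hs; split.
- by move=> e e0; exists 0; rewrite (sh0 hs) subrr cn0 ltW.
- move=> k x y hx hy e e0.
  have d0 : 0 < e / (normc k + 1) by rewrite divr_gt0// ltr_wpDl// normc_ge0.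
  have [a ha] := hx _ d0; have [b hb] := hy _ d0; exists (k *: a + b).
  rewrite (star_hom_linear hs) opprD addrACA -scalerBr.
  apply: le_trans (cnD _ _) _; rewrite cnZ.
  apply: le_trans (lerD (ler_wpM2l (normc_ge0 k) ha) hb) _.
  rewrite -[X in _ + X]mul1r -mulrDl mulrC divfK//.
  by rewrite gt_eqF// ltr_wpDl// normc_ge0.
- move=> x y hx hy e e0.
  have q0 : 0 < cn x + cn y + 1 by rewrite ltr_wpDl// addr_ge0 ?cn_ge0.
  have d0 : 0 < Num.min 1 (e / (cn x + cn y + 1)) by rewrite lt_min ltr01 divr_gt0.
  have [a ha] := hx _ d0; have [b hb] := hy _ d0; exists (a ⋅ b).
  rewrite (star_hom_mul hs).
  have d1 : Num.min 1 (e / (cn x + cn y + 1)) <= 1 by rewrite ge_min lexx.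
  apply: le_trans (cs_mul_approx ha hb d1) _.
  by rewrite mulrC -ler_pdivlMr// ge_min lexx orbT.
- move=> x hx e e0; have [a ha] := hx e e0; exists (cs_star a).
  by rewrite (star_hom_star hs) -cs_starB cn_star.
- apply/closed_cnP => x h e e0; have e2 : 0 < e / 2 by rewrite divr_gt0.
  have [y hy xy] := h _ e2; have [a ha] := hy _ e2; exists a.
  apply: le_trans (cn_triangle _ y _) _; rewrite [leRHS]splitr (cnB y).
  exact: lerD.
Qed.

Lemma cover_morph_dense X Y (s : X -> Y) : cover_morph s ->
  forall b (e : R), 0 < e -> exists a, cn (s a - b) <= e.
Proof.
move=> [hs es]; apply: (generated_sub (range_closure_subalgebra hs) _ (cov_map_generates Y)).
by move=> _ [f _ <-] e e0; exists (cov_map X f); rewrite es subrr cn0 ltW.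
Qed.

(** Extension by density along r, whose range is dense. *)
Lemma cover_le_factor X (M : cstar_cover R) Y (r : X -> M) (s : X -> Y) : cover_morph r -> cover_morph s ->
  (forall a, cn (s a) <= cn (r a)) -> cover_le Y M.
Proof.
move=> hr hs sr; have [t ht tE] := hom_extend hr.1 hs.1 sr (cover_morph_dense hr).
by exists t => // f; rewrite -hr.2 tE hs.2.
Qed.

End CoverMorphisms.

(** * Covers with finitely or infinitely many truncated shifts *)

Section Fibers.
Variable R : realType.
Local Notation H := (l2 R).
Local Notation hip := (rip_is_ip R).
Local Notation I := (idx R).
Local Notation BI := (bop R I).
Local Notation BC := (bop_cstar R I).
Implicit Types (E : pred nat) (b : BI) (u v : H).

(** Forgetting the shifts x_n with n outside E: their fiber becomes that of x. *)
Definition truncate E (i : I) : I :=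
  if i is inr (Some n) then (if E n then i else inr None) else i.

Lemma truncate_disc E z : truncate E (inl z) = inl z. Proof. by []. Qed.

(** The cover C_E. *)
Definition tail_cover E : cstar_cover R := @model_cover R (truncate E) (truncate_disc E).

Definition fib E (b : tail_cover E) : BI := subcs_val b.

Lemma breidx_truncate E E' (EE : forall n, E' n -> E n) b :
  breidx (truncate E') (breidx (truncate E) b) = breidx (truncate E') b.
Proof.
apply: bopP => -[z//|[n|//]] u; rewrite !breidxE /=.
by have [/EE/= ->|] := boolP (E' n).
Qed.

Lemma calg_ind kap (S : set BC) : cstar_subalgebra S -> S (1 : BI) ->
  S (breidx kap (model R)) -> forall b, calg kap b -> S b.
Proof. by move=> hS h1 hT b hb; apply: hb; split => // g [->|->]. Qed.

Lemma calg_restr E E' (EE : forall n, E' n -> E n) b :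
  calg (truncate E) b -> calg (truncate E') (breidx (truncate E') b).
Proof.
move: b; apply: calg_ind.
- apply: (preimage_subalgebra (breidx_hom (truncate E')) _ (calgP (truncate E'))).
  exact: breidx_cn.
- have -> : breidx (truncate E') (1 : BI) = 1 by exact: bopP.
  exact: calg1.
- rewrite /= breidx_truncate//; exact: calgT.
Qed.

(** The morphism that forgets the fibers outside of E'. *)
Definition restr E E' (EE : forall n, E' n -> E n) (b : tail_cover E) : tail_cover E' :=
  mk_subcs (calgP (truncate E')) (calg_restr EE (subcsP b)).

Lemma restr_morph E E' (EE : forall n, E' n -> E n) :
  cover_morph (X := tail_cover E) (Y := tail_cover E') (restr EE).
Proof.
split; last by move=> f; apply: val_inj; exact: (breidx_truncate EE).
have [hl hm hs] := breidx_hom (truncate E').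
by split => [k a b|a b|a]; apply: val_inj; [exact: hl | exact: hm | exact: hs].
Qed.

Lemma tail_unital E : unital (tail_cover E).
Proof.
have e1 : fib (cov_map (tail_cover E) 1) = 1.
  by apply: bopP => i u; exact: (congr1 (fun b : BI => b (truncate E i) u) (@dcalc1 R)).
move=> a; split; apply: val_inj.
  by rewrite -[RHS](mul1r (subcs_val a : BI)) -e1.
by rewrite -[RHS](mulr1 (subcs_val a : BI)) -e1.
Qed.

Lemma tail_cover_le E E' : (forall n, E' n -> E n) -> cover_le (tail_cover E') (tail_cover E).
Proof. by move=> EE; have [h1 h2] := restr_morph EE; exists (restr EE). Qed.

Variable E : pred nat.
Local Notation A := (calg (truncate E)).

Lemma id_contr : @contr R id id.
Proof. by split. Qed.

Lemma model_disc z u : model R (inl z) u = set_val z *: u. Proof. by []. Qed.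
Lemma model_shift (k : option nat) u : model R (inr k) u = shift_fwd k u. Proof. by []. Qed.
Lemma shift_fwd0 (k : option nat) u : shift_fwd k u 0%N = 0. Proof. by []. Qed.
Lemma shift_fwdS (k : option nat) u j : shift_fwd k u j.+1 = (wt R k j)%:C * u j. Proof. by []. Qed.

Lemma calg_intertwine i j (Q Q' : H -> H) : contr Q Q' -> contr Q' Q ->
  (forall u, model R (truncate E i) (Q u) = Q (model R (truncate E j) u)) ->
  (forall u, model R (truncate E j) (Q' u) = Q' (model R (truncate E i) u)) ->
  forall b, A b -> forall u, b i (Q u) = Q (b j u).
Proof.
move=> cQ cQ' T1 T2 b Ab.
by have [] := calg_ind (intertwine_subalgebra i j cQ cQ') (conj (fun=> erefl) (fun=> erefl)) (conj T1 T2) Ab.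
Qed.

(** Disc fibers are scalar since they commute with all matrix units. *)
Lemma calg_disc b z u : A b -> b (inl z) u = b (inl z) (ev R 0) 0%N *: u.
Proof.
move=> Ab; have key k u' : b (inl z) (rank1 0 k u') = rank1 0 k (b (inl z) u').
  by apply: (calg_intertwine (rank1_contr R 0 k) (rank1_contr R k 0)) => // v; apply: l2P => j;
    rewrite !model_disc l2_scaleE !rank1E l2_scaleE mulrA.
apply: l2P => k; rewrite l2_scaleE.
have := congr1 (fun w : H => w 0%N) (key k u); rewrite rank1E eqxx mulr1 => <-.
by rewrite /rank1 bopZ l2_scaleE mulrC.
Qed.

Lemma calg_off b n u : ~~ E n -> A b -> b (inr (Some n)) u = b (inr None) u.
Proof.
move=> En Ab; apply: (calg_intertwine id_contr id_contr) => // v /=; by rewrite (negbTE En).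
Qed.

Lemma shift_fwd_hproj n u : shift_fwd (Some n) (hproj n.+2 u) = hproj n.+2 (shift_fwd (Some n) u).
Proof.
apply: l2P => -[//|j]; rewrite hprojE !shift_fwdS hprojE /= !ltnS.
by case: (leqP j n) => [jn|_]; rewrite ?mul0r ?if_same// (leqW jn).
Qed.

Lemma shift_fwd_tproj n u : shift_fwd (Some n) (tproj n.+2 u) = 0.
Proof.
apply: l2P => -[//|j]; rewrite shift_fwdS tprojE /= ltnS.
by case: (leqP j n) => [jn|_]; rewrite ?mul0r// (leqW jn) mulr0.
Qed.

Lemma tproj_shift_fwd n u : tproj n.+2 (shift_fwd (Some n) u) = 0.
Proof.
apply: l2P => j; rewrite tprojE; case: j => [//|j]; rewrite shift_fwdS /= !ltnS.
by case: (leqP j n) => // _; rewrite mul0r.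
Qed.

(** The first n+2 coordinates reduce the fiber at n, because they reduce x_n. *)
Lemma calg_hproj b n u : E n -> A b -> b (inr (Some n)) (hproj n.+2 u) = hproj n.+2 (b (inr (Some n)) u).
Proof.
move=> En Ab; apply: (calg_intertwine (hproj_contr R n.+2) (hproj_contr R n.+2)) => // v /=;
  rewrite En; exact: shift_fwd_hproj.
Qed.

Lemma closed_disc0 : (0 : R[i]) \in closed_disc R.
Proof. by apply: in_closed_disc; rewrite normc0. Qed.

Definition disc0 : closed_disc R := exist _ 0 closed_disc0.

Lemma model_disc0 u : model R (inl disc0) u = 0.
Proof. by rewrite model_disc scale0r. Qed.

Lemma tproj0 d : tproj d (0 : H) = 0.
Proof. by apply: l2P => k; rewrite tprojE; case: ifP. Qed.

(** On the remaining coordinates x_n is 0, so that the fiber at n coincides there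
with the fiber at the point 0 of the disc. *)
Lemma calg_tproj b n u : E n -> A b ->
  b (inr (Some n)) (tproj n.+2 u) = tproj n.+2 (b (inl disc0) u).
Proof.
move=> En Ab; apply: (calg_intertwine (tproj_contr R n.+2) (tproj_contr R n.+2)) => // v.
  by rewrite [truncate E (inr _)]/= En model_shift shift_fwd_tproj model_disc0 tproj0.
by rewrite [truncate E (inr _)]/= En model_shift tproj_shift_fwd model_disc0.
Qed.

Lemma realcB (r s : R) : (r - s)%:C = r%:C - s%:C.
Proof. by apply/eqP; rewrite eq_complex /= subr0 !eqxx. Qed.

Lemma wt_diff n j : `|wt R (Some n) j - wt R None j| <= 2 ^- n.
Proof.
rewrite /=; case: leqP => jn; first by rewrite subrr normr0 invr_ge0 exprn_ge0.
rewrite sub0r normrN ger0_norm ?invr_ge0 ?exprn_ge0//.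
by rewrite lef_pV2 ?posrE ?exprn_gt0// ler_eXn2l ?ltr1n// ltnW.
Qed.

Lemma shift_fwd_diff n u : hn (shift_fwd (Some n) u - shift_fwd None u) <= 2 ^- n * hn u.
Proof.
have h2 : 0 <= (2 ^- n : R) by rewrite invr_ge0 exprn_ge0.
apply: hn_le => [|D]; first by rewrite mulr_ge0 ?nrm_ge0.
rewrite exprMn; case: D => [|D]; first by rewrite big_ord0 mulr_ge0 ?sqr_ge0.
rewrite big_ord_recl l2_addE l2_oppE !shift_fwd0 subrr normc0 expr0n add0r.
apply: le_trans (ler_wpM2l (sqr_ge0 _) (psum_le_hn u D)); rewrite mulr_sumr.
apply: ler_sum => j _; rewrite l2_addE l2_oppE !shift_fwdS -mulrBl normcM exprMn.
rewrite ler_wpM2r ?sqr_ge0// -realcB normcR ler_pXn2r ?nnegrE//.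
exact: wt_diff.
Qed.

(** The truncations converge in norm: the weights left out are at most 2^-n. *)
Lemma calg_fiber_cvg b : A b -> fiber_cvg b.
Proof.
apply: (calg_ind (fiber_cvg_subalgebra R)) => [e e0|e e0].
  by exists 0%N => n _ u; rewrite !bop_oneE subrr /hn (nrm0 hip) mulr_ge0 ?nrm_ge0// ltW.
have [N hN] := small_expr (half01 R) e0.
exists N => n /hN; rewrite exprVn => ne u; rewrite !breidxE [truncate E (inr None)]/= [truncate E (inr (Some n))]/=.
case: ifP => _; last by rewrite subrr /hn (nrm0 hip) mulr_ge0 ?nrm_ge0// ltW.
apply: le_trans (shift_fwd_diff n u) _; by rewrite ler_wpM2r// nrm_ge0.
Qed.

End Fibers.

(** * Covers with infinitely many truncated shifts are residually finite-dimensional *)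

Section ResiduallyFinite.
Variables (R : realType) (E : pred nat).
Local Notation H := (l2 R).
Local Notation hip := (rip_is_ip R).
Local Notation I := (idx R).
Local Notation BI := (bop R I).
Local Notation A := (calg (truncate E)).
Implicit Types (b : BI) (u v : H).

Lemma bstar_coord b i j k : bstar b i (ev R k) j = conjc (b i (ev R j) k).
Proof.
have h c : Re (conjc c * bstar b i (ev R k) j) = Re (c * b i (ev R j) k).
  rewrite -l2_scaleE -rip_ev -(ipZr hip) (ipC hip) -[in RHS]l2_scaleE -bopZ -rip_ev.
  by rewrite [RHS]bstarP.
have := h 'i; have := h 1; rewrite mul1r.
case: (bstar _ _ _ _) (b _ _ _) => x y [z t] /=.
by rewrite !(oppr0, mul1r, mul0r, subr0, add0r, mulN1r, opprK) => -> ->.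
Qed.

Definition block := (closed_disc R + {n | E n})%type.
Definition bfib (l : block) : I :=
  match l with inl z => inl z | inr n => inr (Some (sval n)) end.
Definition bdim (l : block) : nat := if l is inr n then (sval n).+1 else 0%N.

Definition compress b l : 'M[R[i]]_((bdim l).+1) := \matrix_(j, k) b (bfib l) (ev R k) j.

Lemma calg_block b l u : A b ->
  b (bfib l) (hproj (bdim l).+1 u) = hproj (bdim l).+1 (b (bfib l) u).
Proof.
case: l => [z|[n En]] Ab /=; last exact: calg_hproj Ab.
rewrite (calg_disc z u Ab) [LHS](calg_disc z _ Ab); apply: l2P => k.
by rewrite l2_scaleE !hprojE l2_scaleE; case: ifP => _; rewrite ?mulr0.
Qed.

Lemma hproj_ev d k : (k < d)%N -> hproj d (ev R k) = ev R k.
Proof.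
move=> kd; apply: l2P => j; rewrite hprojE ev_val.
by case: ltnP => // dj; rewrite gtn_eqF// (leq_trans kd).
Qed.

(** Compression to a block is multiplicative because the block reduces the fiber. *)
Lemma compressM a b l : A b -> compress (a * b) l = compress a l *m compress b l.
Proof.
move=> Ab; apply/matrixP => j k; rewrite !mxE bop_mulE.
rewrite -{1}(hproj_ev (ltn_ord k)) calg_block// hproj_sum bop_sum l2_sumE.
by apply: eq_bigr => m _; rewrite !mxE bopZ l2_scaleE mulrC.
Qed.

Lemma compress_linear l : linear (compress^~ l).
Proof. by move=> c a b; apply/matrixP => j k; rewrite !mxE l2_addE l2_scaleE. Qed.

Lemma compress_star b l : compress (bstar b) l = adjmx (compress b l).
Proof. by apply/matrixP => j k; rewrite !mxE bstar_coord. Qed.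

Definition vec n (v : 'cV[R[i]]_n) : H := \sum_(k < n) v k 0 *: ev R k.

Lemma vecE n (v : 'cV[R[i]]_n) (j : 'I_n) : vec v j = v j 0.
Proof.
rewrite l2_sumE (bigD1 j)//= big1 ?addr0 => [|k kj].
  by change (v j 0 * ((j : nat) == j)%:R = v j 0); rewrite eqxx mulr1.
by change (v k 0 * ((j : nat) == k)%:R = 0); rewrite (inj_eq val_inj) eq_sym (negbTE kj) mulr0.
Qed.

Lemma vec_out n (v : 'cV[R[i]]_n) j : (n <= j)%N -> vec v j = 0.
Proof.
move=> nj; rewrite l2_sumE big1// => k _.
by change (v k 0 * ((j : nat) == k)%:R = 0); rewrite gtn_eqF ?mulr0// (leq_trans (ltn_ord k)).
Qed.

Lemma hn_vec n (v : 'cV[R[i]]_n) : hn (vec v) <= eucl_norm v.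
Proof.
rewrite -(@ler_pXn2r _ 2) ?nnegrE ?eucl_ge0 ?nrm_ge0// (nrm_sqr hip).
rewrite (rip_fin _ (@vec_out n v)) eucl_sqr le_eqVlt; apply/orP; left; apply/eqP.
by apply: eq_bigr => k _; rewrite vecE normc_sqr !expr2.
Qed.

Lemma compress_norm b l : opnorm (compress b l) <= bonrm b.
Proof.
apply: opnorm_le => [|v]; first exact: onrm_ge0.
apply: le_trans (ler_wpM2l (onrm_ge0 _ _) (hn_vec v)).
apply: le_trans (bonrm_bnd b (bfib l) (vec v)).
rewrite -(@ler_pXn2r _ 2) ?nnegrE ?eucl_ge0 ?nrm_ge0// eucl_sqr.
apply: le_trans (psum_le_hn _ (bdim l).+1); apply: ler_sum => j _.
rewrite le_eqVlt; apply/orP; left; apply/eqP; congr (normc _ ^+ 2).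
rewrite mxE bop_sum l2_sumE; apply: eq_bigr => k _.
by rewrite bopZ l2_scaleE mxE mulrC.
Qed.

(** The compressions to blocks separate the points: a fiber at n in E is determined
by its block and by a disc fiber, and the fiber at x is a limit of those. *)
Lemma rfd_tail : (forall N, exists2 n, (N <= n)%N & E n) -> rfd (tail_cover R E).
Proof.
move=> infE; exists block, bdim, (fun b : tail_cover R E => compress (fib b)); split.
- by move=> b; exists (bonrm (fib b)) => l; exact: compress_norm.
- by move=> l k a b; exact: (compress_linear l k (fib a) (fib b)).
- by move=> l a b; exact: (compressM (fib a) l (subcsP b)).
- by move=> l a; exact: (compress_star (fib a) l).
move=> /= a b ab; apply: val_inj => /=.
have Aa : A (fib a) := subcsP a; have Ab : A (fib b) := subcsP b.
change (fib a = fib b); move: Aa Ab ab; move: (fib a) (fib b) => {}a {}b Aa Ab ab.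
have entry l (j k : 'I_(bdim l).+1) : a (bfib l) (ev R k) j = b (bfib l) (ev R k) j.
  have := congr1 (fun f : forall l, 'M[R[i]]_((bdim l).+1) => f l j k) ab.
  by rewrite !mxE.
have disc z u : a (inl z) u = b (inl z) u.
  by rewrite (calg_disc _ _ Aa) (calg_disc _ _ Ab) (entry (inl z) ord0 ord0).
have shift n u : E n -> a (inr (Some n)) u = b (inr (Some n)) u.
  move=> En; pose l : block := inr (exist _ n En).
  have split_c (c : BI) : A c -> c (inr (Some n)) u =
      \sum_(k < n.+2) u k *: hproj n.+2 (c (inr (Some n)) (ev R k)) + tproj n.+2 (c (inl (disc0 R)) u).
    move=> Ac; rewrite -(calg_tproj _ En Ac) /tproj bopB hproj_sum bop_sum addrC.
    rewrite -[LHS](subrK (\sum_(k < n.+2) c (inr (Some n)) (u k *: ev R k))); congr (_ + _).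
    by apply: eq_bigr => k _; rewrite bopZ -{1}(hproj_ev (ltn_ord k)) (calg_hproj _ En Ac).
  rewrite (split_c a)// (split_c b)// disc; congr (_ + _); apply: eq_bigr => k _; congr (_ *: _).
  apply: l2P => j; rewrite !hprojE; case: ltnP => // jn.
  exact: (entry l (Ordinal jn) k).
have limit u : a (inr None) u = b (inr None) u.
  apply/eqP; rewrite -subr_eq0; apply/eqP; apply: (@hn_small _ _ (2 * hn u)) => e e0.
  have [N1 h1] := calg_fiber_cvg Aa e0; have [N2 h2] := calg_fiber_cvg Ab e0.
  have [n nN En] := infE (maxn N1 N2); move: nN; rewrite geq_max => /andP[n1 n2].
  have h3 := h1 n n1 u; have h4 := h2 n n2 u; rewrite -shift// in h4.
  apply: le_trans (nrm_triangle hip _ (a (inr (Some n)) u) _) _.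
  rewrite (nrmB hip) (_ : 2 * hn u * e = e * hn u + e * hn u); last by ring.
  exact: lerD.
apply: bopP => -[z|[n|]] u //.
have [En|En] := boolP (E n); first exact: shift.
by rewrite (calg_off _ En Aa) (calg_off _ En Ab).
Qed.

End ResiduallyFinite.

(** * The cover without truncated shifts is not residually finite-dimensional *)

Section Obstruction.
Variable R : realType.
Local Notation "a ⋅ b" := (cs_mul a b) (at level 40, left associativity).

(** A *-polynomial that takes the value e_00 at the full shift: the first factor is
diagonal with nonzero entry at 0, and the second one is diagonal and vanishes
beyond 0 since consecutive weights are in the ratio 1/2. *)
Definition corner (A : cstarAlgebra R) (x : A) : A :=
  (cs_star x ⋅ x - x ⋅ cs_star x) ⋅ (cs_star x ⋅ x - 4^-1 *: (x ⋅ cs_star x)).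

Lemma corner_hom (A B : cstarAlgebra R) (s : A -> B) x : star_hom s -> s (corner x) = corner (s x).
Proof.
by move=> hs; rewrite /corner (star_hom_mul hs) !(shB hs) (shZ hs) !(star_hom_mul hs) !(star_hom_star hs).
Qed.

Lemma orbit_hom (A B : cstarAlgebra R) (s : A -> B) x j : star_hom s ->
  s (iter j (cs_mul x) (corner x)) = iter j (cs_mul (s x)) (corner (s x)).
Proof. by move=> hs; elim: j => [|j IH]; [exact: corner_hom | rewrite !iterS (star_hom_mul hs) IH]. Qed.

(** Unless Y_0 = 0, all Y_j are nonzero, because A^* Y_(j+1) = 4^-j Y_j; their
columns are eigenvectors of A^* A for infinitely many eigenvalues. *)
Lemma no_infinite_spectrum n (A : 'M[R[i]]_n.+1) (Y : nat -> 'M[R[i]]_n.+1) :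
  (forall j, Y j.+1 = A *m Y j) ->
  (forall j, adjmx A *m (A *m Y j) = 4^-1 ^+ j *: Y j) -> Y 0%N = 0.
Proof.
move=> YS YE; apply/eqP; apply: contraT => Y0.
have q0 : 4^-1 != 0 :> R[i] by rewrite invr_eq0 pnatr_eq0.
have Yn j : Y j != 0.
  elim: j => // j; apply: contraNN => /eqP yj1.
  have := YE j; rewrite -YS yj1 mulmx0 => /esym/eqP.
  by rewrite scaler_eq0 expf_eq0 (negbTE q0) andbF.
pose B := (adjmx A *m A)^T.
have ev j : root (char_poly B) (4^-1 ^+ j).
  rewrite -eigenvalue_root_char; apply/eigenvalueP.
  have /rowV0Pn[v /submxP[w ->] v0] : ((Y j)^T != 0) by rewrite trmx_eq0.
  exists (w *m (Y j)^T) => //.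
  by rewrite /B -mulmxA -trmx_mul -mulmxA YE linearZ /= -scalemxAr.
pose rs := [seq (4^-1 : R[i]) ^+ j | j <- iota 0 n.+2].
have rsB : all (root (char_poly B)) rs by apply/allP => _ /mapP[j _ ->]; exact: ev.
have rsU : uniq rs.
  rewrite map_inj_uniq ?iota_uniq//; apply: ieexprIn; first by rewrite invr_gt0 ltr0n.
  by rewrite invr_eq1 pnatr_eq1.
have := max_poly_roots (monic_neq0 (char_poly_monic B)) rsB rsU.
by rewrite size_char_poly size_map size_iota ltnn.
Qed.

(** Each finite-dimensional representation kills the corner. *)
Lemma rfd_corner_eq0 (Z : cstarAlgebra R) (x : Z) : rfd Z ->
  (forall j, cs_star x ⋅ (x ⋅ iter j (cs_mul x) (corner x)) = 4^-1 ^+ j *: iter j (cs_mul x) (corner x)) ->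
  corner x = 0.
Proof.
move=> [L [r [phi [_ lin mul star inj]]]] h.
apply: inj; apply: functional_extensionality_dep => l.
have phi0 : phi 0 l = 0 by have := lin l (-1) 0 0; rewrite scaleN1r oppr0 addr0 scaleN1r addNr.
have phiZ k a : phi (k *: a) l = k *: phi a l.
  by have := lin l k a 0; rewrite !addr0 phi0 addr0.
rewrite phi0.
apply: (@no_infinite_spectrum _ (phi x l) (fun j => phi (iter j (cs_mul x) (corner x)) l)) => j.
  by rewrite iterS mul.
by rewrite -star -!mul h phiZ.
Qed.

Local Notation H := (l2 R).
Local Notation I := (idx R).
Local Notation BI := (bop R I).
Local Notation BC := (bop_cstar R I).
Implicit Types (u v : H).

(** The diagonal of the corner at a weighted shift: a and c are the j-th entries of
the diagonal operators x^* x and x x^*. *)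
Definition corner_diag (k : option nat) (j : nat) : R :=
  let a := wt R k j ^+ 2 in let c := if j is j'.+1 then wt R k j' ^+ 2 else 0 in
  (a - c) * (a - c / 4).

Lemma corner_model_disc z u : corner (model R : BC) (inl z) u = 0.
Proof.
set w := (bstar (model R) (inl z) (model R (inl z) u) - 4^-1 *: model R (inl z) (bstar (model R) (inl z) u)).
change (bstar (model R) (inl z) (model R (inl z) w) - model R (inl z) (bstar (model R) (inl z) w) = 0).
by rewrite !model_star /= !scalerA mulrC subrr.
Qed.

Lemma corner_model_shift k u j : corner (model R : BC) (inr k) u j = (corner_diag k j)%:C * u j.
Proof.
set w := (bstar (model R) (inr k) (model R (inr k) u) - 4^-1 *: model R (inr k) (bstar (model R) (inr k) u)).
change ((bstar (model R) (inr k) (model R (inr k) w) - model R (inr k) (bstar (model R) (inr k) w)) j = (corner_diag k j)%:C * u j).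
have S v m : bstar (model R) (inr k) (model R (inr k) v) m = (wt R k m ^+ 2)%:C * v m.
  by rewrite model_star expr2 realcM -mulrA.
have P v m : model R (inr k) (bstar (model R) (inr k) v) m =
    (if m is m'.+1 then wt R k m' ^+ 2 else 0)%:C * v m.
  by rewrite model_star; case: m => [|m]; [rewrite mul0r | rewrite expr2 realcM -mulrA].
rewrite l2_addE l2_oppE S P /w l2_addE l2_oppE l2_scaleE S P /corner_diag.
set a := wt R k j ^+ 2; set c := (if _ is _.+1 then _ else _).
have -> : (4^-1 : R[i]) = (4^-1)%:C by rewrite fmorphV rmorph_nat.
by rewrite realcM !realcB realcM; ring.
Qed.

(** The generator of C_E. *)
Definition kmodel E : BI := breidx (truncate E) (model R).

Lemma corner_kmodel E i u : corner (kmodel E : BC) i u = corner (model R : BC) (truncate E i) u.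
Proof. by rewrite /kmodel -(corner_hom _ (breidx_hom (truncate E))). Qed.

Lemma bstar_kmodel E i u : bstar (kmodel E) i u = bstar (model R) (truncate E i) u.
Proof. by rewrite -[bstar _]/(@cs_star R BC _) -(star_hom_star (breidx_hom (truncate E))). Qed.

Lemma corner_diag_None j : corner_diag None j = (j == 0%N)%:R.
Proof.
rewrite /corner_diag /=; case: j => [|j]; first by rewrite expr0 invr1 mul0r !subr0 expr1n mulr1.
have -> : (2 ^- j.+1 : R) = 2 ^- j / 2 by rewrite exprSr invfM.
by move: (2 ^- j) => t; rewrite (_ : _ - _ / 4 = 0) ?mulr0//; field.
Qed.

(** At the full shift x^j p maps e_0 to a multiple of e_j, on which x^* x is 4^-j;
all other fibers vanish. *)
Lemma kmodel_orbit (j : nat) :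
  bmul (bstar (kmodel pred0)) (bmul (kmodel pred0) (iter j (bmul (kmodel pred0)) (corner (kmodel pred0 : BC)))) =
  4^-1 ^+ j *: iter j (bmul (kmodel pred0)) (corner (kmodel pred0 : BC)).
Proof.
pose y m : BI := iter m (bmul (kmodel pred0)) (corner (kmodel pred0 : BC)); rewrite -/(y j).
have yS m i u : y m.+1 i u = model R (truncate pred0 i) (y m i u) by [].
have y0 m z u : y m (inl z) u = 0.
  elim: m => [|m IH]; first by rewrite [LHS]corner_kmodel; exact: corner_model_disc.
  by rewrite yS IH model_disc scaler0.
have yk m k u n : n != m -> y m (inr k) u n = 0.
  have e : truncate pred0 (inr k) = inr None :> I by case: k.
  elim: m n => [|m IH] n nm.
    have -> : y 0%N (inr k) u = corner (model R : BC) (inr None) u by rewrite -e; exact: corner_kmodel.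
    rewrite corner_model_shift corner_diag_None.
    by rewrite (negbTE nm) mul0r.
  rewrite yS e model_shift; case: n nm => [//|n nm].
  by rewrite shift_fwdS IH ?mulr0.
apply: bopP => -[z|k] u; rewrite !bmulE bop_scaleE.
  by rewrite y0 scaler0 !bop0.
have e : truncate pred0 (inr k) = inr None :> I by case: k.
apply: l2P => n; have e1 v : kmodel pred0 (inr k) v = shift_fwd None v by rewrite /kmodel breidxE e.
rewrite l2_scaleE bstar_kmodel e model_star e1.
change ((wt R None n)%:C * ((wt R None n)%:C * y j (inr k) u n) = 4^-1 ^+ j * y j (inr k) u n).
have [->|nj] := eqVneq n j; last by rewrite yk ?mulr0.
rewrite mulrA -realcM /= -expr2 -exprVn exprAC; congr (_ * _).
have -> : (4^-1 : R[i]) = (4^-1)%:C by rewrite fmorphV rmorph_nat.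
by rewrite -rmorphXn; congr ((_ ^+ _)%:C); rewrite exprVn -natrX.
Qed.

Lemma corner_kmodel_neq0 : corner (kmodel pred0 : BC) <> 0.
Proof.
move=> h; have := congr1 (fun b : BI => b (inr None) (ev R 0) 0%N) h.
by rewrite corner_kmodel corner_model_shift corner_diag_None ev_val mulr1 => /eqP; rewrite oner_eq0.
Qed.

(** A cover Z equivalent to C_0 exchanges the generators with C_0, hence their
corners.  If Z were residually finite-dimensional its corner would vanish, and so
would that of C_0. *)
Lemma not_rfd_compact : ~ lat_rfd (cover_class (tail_cover R pred0)).
Proof.
move=> [Z [[al hal alE] [be hbe beE]] rZ].
pose x : tail_cover R pred0 := cov_map (tail_cover R pred0) (zfun R).
have hv := sub_incl_hom (calgP (truncate pred0)) : @star_hom R (tail_cover R pred0) BC (subcs_val (hS := _)).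
have xv : subcs_val x = kmodel pred0 by rewrite /x /= dcalc_zfun.
have xZ : al (be x) = x by rewrite /x beE alE.
have corner0 : corner (be x) = 0.
  apply: (rfd_corner_eq0 rZ) => j.
  rewrite -(orbit_hom _ _ hbe) -(star_hom_star hbe) -!(star_hom_mul hbe) -(shZ hbe); congr be.
  apply: val_inj.
  change (bmul (bstar (subcs_val x)) (bmul (subcs_val x) (subcs_val (iter j (cs_mul x) (corner x)))) =
    4^-1 ^+ j *: (subcs_val (iter j (cs_mul x) (corner x)) : BI)).
  by rewrite (orbit_hom x j hv) xv; exact: kmodel_orbit.
apply: corner_kmodel_neq0; rewrite -xv -(corner_hom x hv) -xZ -(corner_hom _ hal) corner0 (sh0 hal).
by [].
Qed.

End Obstruction.

(** * Isolating the fibers of the truncated shifts *)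

Section Isolation.
Variable R : realType.
Local Notation H := (l2 R).
Local Notation hip := (rip_is_ip R).
Local Notation I := (idx R).
Local Notation BI := (bop R I).
Local Notation BC := (bop_cstar R I).
Local Notation A := (calg (R := R) (truncate predT)).
Implicit Types (b : BI) (u v : H).

(** The norm of the image in C_0. *)
Definition limit_norm b : R := cn (breidx (truncate pred0) b).

Lemma limit_norm_ge0 b : 0 <= limit_norm b. Proof. exact: cn_ge0. Qed.

Lemma limit_bnd_disc b z u : hn (b (inl z) u) <= limit_norm b * hn u.
Proof. exact: (bonrm_bnd (breidx (truncate pred0) b) (inl z) u). Qed.

Lemma limit_bnd_None b u : hn (b (inr None) u) <= limit_norm b * hn u.
Proof. exact: (bonrm_bnd (breidx (truncate pred0) b) (inr None) u). Qed.

Lemma limit_bnd_Some b (e : R) n u : hn (b (inr (Some n)) u - b (inr None) u) <= e * hn u ->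
  hn (b (inr (Some n)) u) <= (limit_norm b + e) * hn u.
Proof.
move=> h; rewrite -[b (inr (Some n)) u](subrK (b (inr None) u)) addrC mulrDl.
by apply: le_trans (nrmD hip _ _) _; apply: lerD => //; exact: limit_bnd_None.
Qed.

Lemma weaken_bnd (x e : R) u v : 0 <= e -> hn v <= x * hn u -> hn v <= (x + e) * hn u.
Proof.
by move=> e0 h; apply: le_trans h _; rewrite mulrDl lerDl mulr_ge0 ?nrm_ge0.
Qed.

Definition single_fun (n : nat) (Q : H -> H) (i : I) : H -> H :=
  if i is inr (Some m) then (if m == n then Q else fun=> 0) else fun=> 0.

Lemma single_adjointable n Q Q' : contr Q Q' -> adjointable (@rip R) (single_fun n Q).
Proof.
move=> [lQ bQ aQ]; have l0 : linear (fun _ : H => 0 : H) by move=> c u v; rewrite scaler0 addr0.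
have b0 u : hn (0 : H) <= 1 * hn u by rewrite mul1r /hn (nrm0 hip) nrm_ge0.
exists 1, (single_fun n Q'); split => //.
- by move=> [z|[m|]] //=; case: eqP.
- by move=> [z|[m|]] u //=; try exact: b0; case: eqP => _; [rewrite mul1r; exact: bQ | exact: b0].
- move=> [z|[m|]] u v /=; rewrite ?(ip0l hip) ?(ip0r hip)//.
  by case: eqP => _; [exact: aQ | rewrite (ip0l hip) (ip0r hip)].
Qed.

Definition single n k : BI :=
  Bop (introT (asboolP _) (single_adjointable n (rank1_contr R k k))).

Lemma single_Some n k m u : single n k (inr (Some m)) u = (m == n)%:R *: rank1 k k u.
Proof. by rewrite /single /=; case: eqP => _; rewrite ?scale1r ?scale0r. Qed.

Lemma single_None n k u : single n k (inr None) u = 0. Proof. by []. Qed.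

Lemma single_disc n k z u : single n k (inl z) u = 0. Proof. by []. Qed.

(** The families that are a m e_(m+1,m+1) in the fiber at m and vanish elsewhere.
The coordinate m+1 is the last one that x_m reaches, where the corner of x_m
differs from that of x. *)
Definition tip b (a : nat -> R) := [/\ forall m u, b (inr (Some m)) u = (a m)%:C *: rank1 m.+1 m.+1 u,
  forall u, b (inr None) u = 0 & forall z u, b (inl z) u = 0].

Lemma rank1_scale k c u : rank1 k k (c *: rank1 k k u) = c *: rank1 k k u.
Proof. apply: l2P => j.
change (c * (u k * (k == k)%:R) * (j == k)%:R = c * (u k * (j == k)%:R)).
by rewrite eqxx mulr1 mulrA. Qed.

Lemma tipM b a b' a' : tip b a -> tip b' a' -> tip (b * b') (fun m => a m * a' m).
Proof.
move=> [h1 h2 h3] [k1 k2 k3]; split.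
- by move=> m u; rewrite bop_mulE h1 k1 rank1_scale scalerA -realcM.
- by move=> u; rewrite bop_mulE k2 bop0.
- by move=> z u; rewrite bop_mulE k3 bop0.
Qed.

Lemma tipB b a b' a' : tip b a -> tip b' a' -> tip (b - b') (fun m => a m - a' m).
Proof.
move=> [h1 h2 h3] [k1 k2 k3]; split.
- by move=> m u; rewrite bop_addE bop_oppE h1 k1 realcB scalerBl.
- by move=> u; rewrite bop_addE bop_oppE h2 k2 subrr.
- by move=> z u; rewrite bop_addE bop_oppE h3 k3 subrr.
Qed.

Lemma tipZ (r : R) b a : tip b a -> tip (r%:C *: b) (fun m => r * a m).
Proof.
move=> [h1 h2 h3]; split.
- by move=> m u; rewrite bop_scaleE h1 scalerA -realcM.
- by move=> u; rewrite bop_scaleE h2 scaler0.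
- by move=> z u; rewrite bop_scaleE h3 scaler0.
Qed.

Lemma tipX b a j : tip b a -> tip (b ^+ j.+1) (fun m => a m ^+ j.+1).
Proof.
move=> h; elim: j => [|j IH]; first exact: h.
have -> : (fun m => a m ^+ j.+2) = (fun m => a m * a m ^+ j.+1) by apply/funext => m; rewrite exprS.
by rewrite exprS; exact: tipM.
Qed.

Lemma tip_single n : tip (single n n.+1) (fun m => (m == n)%:R).
Proof.
split => // m u; rewrite single_Some.
by case: eqP => [->|_]; rewrite ?scale1r ?scale0r.
Qed.

Lemma tip_norm b a (C : R) : tip b a -> 0 <= C -> (forall m, `|a m| <= C) -> cn b <= C.
Proof.
move=> [h1 h2 h3] C0 aC; apply: bonrm_le => // i u.
have z0 : hn (0 : H) <= C * hn u by rewrite /hn (nrm0 hip) mulr_ge0 ?nrm_ge0.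
case: i => [z|[m|]]; rewrite ?h1 ?h2 ?h3//.
rewrite /hn (nrmZ hip) normcR; apply: ler_pM => //; first exact: nrm_ge0.
by have [_ + _] := rank1_contr R m.+1 m.+1; apply.
Qed.

Lemma calgM a b : A a -> A b -> A (a * b).
Proof. exact: (csub_mul (calgP _)). Qed.

Lemma calgZ c a : A a -> A (c *: a).
Proof.
move=> Aa; rewrite -[c *: a]addr0.
exact: (csub_linear (calgP _) c Aa (csub0 (calgP _))).
Qed.

Lemma calgD a b : A a -> A b -> A (a + b).
Proof. by move=> Aa Ab; rewrite -[a]scale1r; exact: (csub_linear (calgP _) 1 Aa Ab). Qed.

Lemma calgB a b : A a -> A b -> A (a - b).
Proof. by move=> Aa Ab; rewrite -scaleN1r; apply: calgD => //; exact: calgZ. Qed.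

Lemma calg_star a : A a -> A (bstar a).
Proof. exact: (csub_star (calgP _)). Qed.

Lemma calg_model : A (model R).
Proof.
have <- : breidx (truncate predT) (model R) = model R by apply: bopP => -[z|[n|]].
exact: calgT.
Qed.

Definition model_corner : BI := corner (model R : BC).

Lemma calg_corner : A model_corner.
Proof.
have Ax := calg_model; have As := calg_star Ax.
apply: (calgM (a := bstar (model R) * model R - model R * bstar (model R))
   (b := bstar (model R) * model R - 4^-1 *: (model R * bstar (model R)))).
  by apply: calgB; exact: calgM.
by apply: calgB; [exact: calgM | apply: calgZ; exact: calgM].
Qed.

(** The entry at m+1 of the corner of x_m, where the missing weight prevents the
cancellation. *)
Definition tipv (m : nat) : R := (2 ^- m) ^+ 4 / 4.

Lemma corner_diag_Some n j : corner_diag R (Some n) j = (j == 0%N)%:R + tipv n * (j == n.+1)%:R.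
Proof.
have [jn|nj] := leqP j n.
  rewrite (@ltn_eqF j n.+1)// [_ * _]mulr0 addr0 -corner_diag_None /corner_diag /= jn.
  by case: j jn => // j /ltnW /= ->.
case: j nj => // j nj; rewrite /corner_diag /= leqNgt nj /= expr0n /= !sub0r add0r eqSS.
case: leqP => jn.
  have -> : j = n by apply/eqP; rewrite eqn_leq jn.
  by rewrite eqxx [tipv n * _]mulr1 /tipv; move: (2 ^- n) => t; field.
by rewrite gtn_eqF// [tipv _ * _]mulr0 expr0n /= mul0r oppr0 mulr0.
Qed.

Lemma tipv01 m : 0 < tipv m <= 4^-1.
Proof.
have h : 0 < (2 ^- m : R) <= 1.
  by rewrite invr_gt0 exprn_gt0//= invf_le1 ?exprn_gt0// exprn_ege1// ler1n.
rewrite /tipv; move: (2 ^- m) h => t /andP[t0 t1].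
by rewrite divr_gt0 ?exprn_gt0//= ler_pdivrMr// mulVf ?exprn_ile1// ltW.
Qed.

Lemma tipv_decr n m : (n < m)%N -> tipv m <= tipv n / 16.
Proof.
move=> nm.
have h : (2 ^- m : R) <= 2 ^- n / 2.
  rewrite -invfM -exprSr lef_pV2 ?posrE ?exprn_gt0//.
  by rewrite ler_eXn2l ?ltr1n.
have p : 0 < (2 ^- m : R) by rewrite invr_gt0 exprn_gt0.
rewrite /tipv; move: (2 ^- m) (2 ^- n) h p => t s ts t0.
rewrite (_ : s ^+ 4 / 4 / 16 = (s / 2) ^+ 4 / 4); last by field.
by rewrite ler_pM2r ?invr_gt0// ler_pXn2r ?nnegrE ?(ltW t0)// (le_trans (ltW t0)).
Qed.

Definition dtip m : R := tipv m - tipv m ^+ 2.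

Lemma sub_sqrE b i u : (b - b * b) i u = b i u - b i (b i u).
Proof. by []. Qed.

(** The corner p of the full family is e_00 plus a tip, so that p - p^2 is a tip. *)
Lemma tip_corner : tip (model_corner - model_corner * model_corner) dtip.
Proof.
split.
- move=> m u; apply: l2P => j.
  rewrite sub_sqrE l2_addE l2_oppE !corner_model_shift corner_diag_Some.
  rewrite mulrA -mulrBl -realcM -realcB.
  change (((j == 0%N)%:R + tipv m * (j == m.+1)%:R - ((j == 0%N)%:R + tipv m * (j == m.+1)%:R) *
    ((j == 0%N)%:R + tipv m * (j == m.+1)%:R))%:C * u j = (dtip m)%:C * (u m.+1 * (j == m.+1)%:R)).
  rewrite /dtip; case: eqP => [->|_] /=; first by rewrite mulr0 addr0 mulr1 subrr mul0r !mulr0.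
  case: eqP => [->|_]; last by rewrite !mulr0 addr0 mulr0 subr0 mul0r.
  by rewrite !mulr1 add0r expr2.
- move=> u; apply: l2P => j.
  rewrite sub_sqrE l2_addE l2_oppE !corner_model_shift corner_diag_None.
  rewrite mulrA -mulrBl -realcM -realcB; case: eqP => _; first by rewrite mulr1 subrr mul0r.
  by rewrite mulr0 subr0 mul0r.
- move=> z u; rewrite sub_sqrE.
  have c0 v : model_corner (inl z) v = 0 by exact: corner_model_disc.
  by rewrite !c0 subr0.
Qed.

Lemma dtip_gt0 n : 0 < dtip n.
Proof.
rewrite /dtip; have /andP[] := tipv01 n; move: (tipv n) => t t0 t1.
have : t * t <= 4^-1 * t by rewrite ler_pM2r.
rewrite expr2; lra.
Qed.

Lemma dtip_half n m : (n < m)%N -> `|(dtip n)^-1 * dtip m| <= 2^-1.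
Proof.
move=> nm; rewrite ger0_norm ?mulr_ge0 ?invr_ge0 ?(ltW (dtip_gt0 _))//.
rewrite ler_pdivrMl ?dtip_gt0//; have := tipv_decr nm.
rewrite /dtip; have /andP[] := tipv01 n; have /andP[] := tipv01 m.
move: (tipv n) (tipv m) => t s s0 s1 t0 t1 st.
(* With s <= t / 16 and t <= 1 / 4, s - s^2 <= t / 16 <= (t - t^2) / 2. *)
have : t * t <= 4^-1 * t by rewrite ler_pM2r.
have : 0 <= s * s by rewrite mulr_ge0 ?(ltW s0).
rewrite !expr2; lra.
Qed.

(** Power iteration: dtip m <= dtip n / 2 for m > n, so that the powers of
g / dtip n converge to the part of g in the fiber at n once the earlier fibers are
cleared. *)
Lemma isolate_tip n g : A g -> tip g (fun m => if (m < n)%N then 0 else dtip m) ->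
  A (single n n.+1).
Proof.
move=> Ag tg; apply: (closed_cnP A).1 (csub_closed (calgP _)) _ _ => e e0.
have [j /(_ j.+1 (leqnSn j)) hj] := small_expr (half01 R) e0.
exists (((dtip n)^-1%:C *: g) ^+ j.+1).
  elim: j {hj} => [|j IH]; first exact: calgZ.
  by rewrite exprS; apply: calgM => //; exact: calgZ.
apply: le_trans hj; apply: tip_norm (tipB (tip_single n) (tipX j (tipZ _ tg))) _ _.
  by rewrite exprn_ge0.
move=> m /=; case: ltngtP => mn.
- by rewrite mulr0 expr0n subrr normr0 exprn_ge0.
- rewrite sub0r normrN normrX ler_pXn2r ?nnegrE//; exact: dtip_half.
- by rewrite mn mulVf ?gt_eqF ?dtip_gt0// expr1n subrr normr0 exprn_ge0.
Qed.

(** The fibers are isolated one after the other, each one being subtracted from the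
family before the next. *)
Lemma calg_tip n : A (single n n.+1).
Proof.
have [g Ag tg] : exists2 g, A g & tip g (fun m => if (m < n)%N then 0 else dtip m); last first.
  exact: isolate_tip tg.
elim: n => [|n [g Ag tg]].
  by exists (model_corner - model_corner * model_corner); [apply: calgB; [|apply: calgM]; exact: calg_corner | exact: tip_corner].
exists (g - (dtip n)%:C *: single n n.+1).
  by apply: calgB => //; apply: calgZ; exact: isolate_tip tg.
have := tipB tg (tipZ (dtip n) (tip_single n)).
congr tip; apply/funext => m; rewrite ltnS.
by case: (ltngtP m n) => [_|_|->]; rewrite ?mulr0 ?subr0// mulr1 subrr.
Qed.

(** The shift moves matrix units down: x_n^* e_(i+1,i+1) x_n = w_i^2 e_ii. *)
Lemma single_pred n i : (i <= n)%N ->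
  single n i = ((wt R None i ^+ 2)^-1)%:C *: (bstar (model R) * single n i.+1 * model R).
Proof.
move=> lin; apply: bopP => -[z|[m|]] u; rewrite bop_scaleE !bop_mulE.
- by rewrite !single_disc bop0 scaler0.
- rewrite !single_Some; case: eqP => [->|_]; last by rewrite !scale0r bop0 scaler0.
  rewrite !scale1r model_star; apply: l2P => j.
  change (u i * (j == i)%:R = ((wt R None i ^+ 2)^-1)%:C * ((wt R (Some n) j)%:C *
    ((wt R (Some n) i)%:C * u i * (j.+1 == i.+1)%:R))).
  rewrite eqSS; case: eqP => [->|_]; last by rewrite !mulr0.
  rewrite /= lin !mulr1 mulrA -realcM mulrA -realcM -mulrA -expr2 mulVf ?mul1r//.
- by rewrite !single_None bop0 scaler0.
Qed.

Lemma calg_single n i : (i <= n.+1)%N -> A (single n i).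
Proof.
move=> lin; rewrite -(subKn lin); move: (n.+1 - i)%N => k {i lin}.
elim: k => [|k IH]; first by rewrite subn0; exact: calg_tip.
have [kn|nk] := leqP n.+1 k.
  have -> : (n.+1 - k.+1 = n.+1 - k)%N by lia.
  exact: IH.
have iE : (n.+1 - k = (n.+1 - k.+1).+1)%N by lia.
have lin : (n.+1 - k.+1 <= n)%N by lia.
rewrite iE in IH; rewrite (single_pred lin); apply: calgZ.
exact: (calgM (calgM (calg_star calg_model) IH) calg_model).
Qed.

(** The projection P_n onto the block of the fiber at n. *)
Definition blockp n : BI := \sum_(i < n.+2) single n i.

Lemma calg_blockp n : A (blockp n).
Proof.
rewrite /blockp; elim/big_ind: _ => [|a b|i _]; first exact: (csub0 (calgP _)).
  exact: calgD.
by apply: calg_single; rewrite -ltnS.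
Qed.

Lemma blockp_Some n m u : blockp n (inr (Some m)) u = (m == n)%:R *: hproj n.+2 u.
Proof.
rewrite bop_sumE hproj_sum scaler_sumr; apply: eq_bigr => i _.
by rewrite single_Some.
Qed.

Lemma blockp_None n u : blockp n (inr None) u = 0.
Proof. by rewrite bop_sumE big1. Qed.

Lemma blockp_disc n z u : blockp n (inl z) u = 0.
Proof. by rewrite bop_sumE big1. Qed.

End Isolation.

(** * The meets *)

Section Meets.
Variable R : realType.
Local Notation H := (l2 R).
Local Notation hip := (rip_is_ip R).
Local Notation I := (idx R).
Local Notation BI := (bop R I).
Implicit Types (b : BI) (u v : H) (Y : cstar_cover R).

Local Notation C := (tail_cover R predT).
(** The morphism C_N -> C_E. *)
Definition to_sub (E : pred nat) : C -> tail_cover R E := restr (E := predT) (fun n _ => isT).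

Lemma to_sub_morph E : cover_morph (to_sub E).
Proof. exact: restr_morph. Qed.

Lemma to_subE E (b : C) i u : fib (to_sub E b) i u = fib b (truncate E i) u.
Proof. by []. Qed.

(** An estimate by the image in C_0 is all that a factorization needs. *)
Lemma limit_factor Y (s : C -> Y) : cover_morph s ->
  (forall (b : C) (e : R), 0 < e -> cn (s b) <= limit_norm (fib b) + e) ->
  cover_le Y (tail_cover R pred0).
Proof.
move=> hs h; apply: (cover_le_factor (to_sub_morph pred0) hs) => b.
by apply/ler_addgt0Pr => e e0; exact: h.
Qed.

Lemma fib_cn_le E (b : tail_cover R E) (K : R) : 0 <= K ->
  (forall i u, hn (fib b i u) <= K * hn u) -> cn b <= K.
Proof. by move=> K0 h; rewrite subcs_cn; exact: bonrm_le. Qed.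

(** A morphism that factors through all C_[k,oo) sees b only through its late
fibers, which are close to the fiber at x. *)
Lemma chain_glb Y : (forall k, cover_le Y (tail_cover R (leq k))) ->
  cover_le Y (tail_cover R pred0).
Proof.
move=> YX.
have [s0 hs0 es0] := YX 0%N.
pose s : C -> Y := s0 \o to_sub (leq 0).
have hs : cover_morph s by apply: cover_morph_comp (to_sub_morph _) _; split.
apply: (limit_factor hs) => b e e0.
have [N hN] := calg_fiber_cvg (subcsP b) e0.
have [t ht et] := YX N.
have hst : cover_morph (t \o to_sub (leq N)).
  by apply: cover_morph_comp (to_sub_morph _) _; split.
rewrite (cover_morph_unique (@tail_unital R predT) hs hst).
apply: le_trans (cover_morph_contractive (@tail_unital R (leq N)) (conj ht et) _) _.
have L0 := limit_norm_ge0 (fib b).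
have None_le u : hn (fib b (inr None) u) <= (limit_norm (fib b) + e) * hn u.
  exact: (weaken_bnd (ltW e0) (limit_bnd_None _ _)).
apply: fib_cn_le => [|i u]; first by rewrite addr_ge0 ?(ltW e0).
rewrite to_subE; case: i => [z|[n|]] //.
  exact: (weaken_bnd (ltW e0) (limit_bnd_disc _ _ _)).
rewrite [truncate _ _]/=; case: ifP => // Nn.
by apply: limit_bnd_Some; exact: hN.
Qed.

Lemma to_sub_eq0 E (c : C) n : ~~ E n ->
  (forall z u, fib c (inl z) u = 0) -> (forall u, fib c (inr None) u = 0) ->
  (forall m u, m != n -> fib c (inr (Some m)) u = 0) -> to_sub E c = 0.
Proof.
move=> En c1 c2 c3; apply: val_inj; apply: bopP => i u.
change (fib (to_sub E c) i u = 0); rewrite to_subE.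
case: i => [z|[m|]]; [exact: c1 | | exact: c2].
rewrite [truncate _ _]/=; case: ifP => [Em|_]; last exact: c2.
by apply: c3; apply: contraNneq En => <-.
Qed.

Definition block_elt n : C := mk_subcs (calgP (truncate predT)) (@calg_blockp R n).

(** Subtracting P_0 b, ..., P_(N-1) b leaves in the first N fibers the part of b
outside the blocks, which comes from the disc. *)
Lemma kill_blocks Y (s : C -> Y) : star_hom s ->
  (forall (c : C) n, (forall z u, fib c (inl z) u = 0) -> (forall u, fib c (inr None) u = 0) ->
    (forall m u, m != n -> fib c (inr (Some m)) u = 0) -> s c = 0) ->
  forall (b : C) N, exists b' : C, [/\ s b' = s b,
    forall z u, fib b' (inl z) u = fib b (inl z) u,
    forall u, fib b' (inr None) u = fib b (inr None) u &
    forall m u, fib b' (inr (Some m)) u =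
      if (m < N)%N then tproj m.+2 (fib b (inl (disc0 R)) u) else fib b (inr (Some m)) u].
Proof.
move=> hs ks b; elim=> [|N [b' [sb b1 b2 b3]]]; first by exists b.
pose c : C := cs_mul (block_elt N) b'.
have cE i u : fib c i u = blockp R N i (fib b' i u) by [].
have bE i u : fib (b' - c) i u = fib b' i u - fib c i u by [].
exists (b' - c); split.
- rewrite (shB hs) sb (ks c N) ?subr0// => [z u|u|m u mN]; rewrite cE.
  + exact: blockp_disc.
  + exact: blockp_None.
  + by rewrite blockp_Some (negbTE mN) scale0r.
- by move=> z u; rewrite bE cE blockp_disc subr0.
- by move=> u; rewrite bE cE blockp_None subr0.
move=> m u; rewrite bE cE blockp_Some b3 ltnS.
case: (ltngtP m N) => [mN|mN|->]; rewrite ?scale0r ?subr0//.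
rewrite scale1r -(calg_hproj (E := predT) u isT (subcsP b)) -bopB.
exact: (calg_tproj (E := predT) u isT (subcsP b)).
Qed.

(** A morphism that factors through C_E0 and through C_E1 kills all elements
supported on one fiber, in particular every multiple of P_n.  This reduces its
norm to that of the limit fiber, up to the convergence of the fibers. *)
Lemma pair_glb (E0 E1 : pred nat) Y : (forall n, ~~ E0 n || ~~ E1 n) ->
  cover_le Y (tail_cover R E0) -> cover_le Y (tail_cover R E1) ->
  cover_le Y (tail_cover R pred0).
Proof.
move=> dis [s0 hs0 es0] [s1 hs1 es1].
pose s : C -> Y := s0 \o to_sub E0.
have hs : cover_morph s by apply: cover_morph_comp (to_sub_morph _) _; split.
have hs' : cover_morph (s1 \o to_sub E1) by apply: cover_morph_comp (to_sub_morph _) _; split.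
apply: (limit_factor hs) => b e e0.
have [N hN] := calg_fiber_cvg (subcsP b) e0.
have [c n c1 c2 c3|b' [sb b1 b2 b3]] := kill_blocks hs.1 _ b N.
  have /orP[En|En] := dis n.
    by rewrite /s /= (to_sub_eq0 En c1 c2 c3) (sh0 hs0).
  by rewrite (cover_morph_unique (@tail_unital R predT) hs hs') /= (to_sub_eq0 En c1 c2 c3) (sh0 hs1).
rewrite -sb; apply: le_trans (cover_morph_contractive (@tail_unital R predT) hs _) _.
have L0 := limit_norm_ge0 (fib b).
apply: fib_cn_le => [|i u]; first by rewrite addr_ge0 ?(ltW e0).
case: i => [z|[n|]].
- rewrite b1; exact: (weaken_bnd (ltW e0) (limit_bnd_disc _ _ _)).
- rewrite b3; case: ltnP => nN; last by apply: limit_bnd_Some; exact: hN.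
  apply: (weaken_bnd (ltW e0)); apply: le_trans (tproj_le _ _) _; exact: limit_bnd_disc.
- rewrite b2; exact: (weaken_bnd (ltW e0) (limit_bnd_None _ _)).
Qed.

Lemma rfd_even : rfd (tail_cover R (fun n => ~~ odd n)).
Proof.
apply: rfd_tail => N; exists N.*2; first by rewrite -addnn leq_addr.
by rewrite odd_double.
Qed.

Lemma rfd_odd : rfd (tail_cover R odd).
Proof.
apply: rfd_tail => N; exists N.*2.+1; first by rewrite -addnn ltnW// ltnS leq_addr.
by rewrite /= odd_double.
Qed.

Lemma even_odd_meet :
  is_meet2 (cover_class (tail_cover R (fun n => ~~ odd n))) (cover_class (tail_cover R odd))
    (cover_class (tail_cover R pred0)).
Proof.
apply: (is_meet_cover (X := fun b : bool => if b then tail_cover R (fun n => ~~ odd n) else tail_cover R odd)).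
- by case.
- by case; apply: tail_cover_le.
- move=> Y h; apply: (@pair_glb (fun n => ~~ odd n) odd); [|exact: (h true)|exact: (h false)].
  by move=> n; rewrite negbK; case: odd.
Qed.

Definition tail_class k := cover_class (tail_cover R (leq k)).
(** Indexing by the first occurrence of each class makes the chain injective
without having to separate the classes. *)
Definition first_occ := {k | forall l, (l < k)%N -> tail_class l <> tail_class k}.

Lemma first_occ_ex n : exists k : first_occ, tail_class (sval k) = tail_class n.
Proof.
elim/ltn_ind: n => n IH.
have [h|] := pselect (forall l, (l < n)%N -> tail_class l <> tail_class n).
  by exists (exist _ n h).
move=> /existsNP[l /not_implyP[ln /contrapT <-]]; exact: IH.
Qed.

Lemma first_occ_inj : injective (fun k : first_occ => tail_class (sval k)).
Proof.
move=> [k hk] [l hl] /= kl; apply: eq_exist => /=.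
have [lt|lt|//] := ltngtP k l; first by case: (hl _ lt).
by case: (hk _ lt).
Qed.

End Meets.

(* The names sublattice and meet_closed denote notions of ordered types until
   the definitions of the statement are imported again. *)
Import Defs.

Theorem theorem4p6 (R : realType) :
  [/\ exists X Y : cstar_cover R,
        [/\ rfd X, rfd Y &
            exists2 m, is_meet2 (cover_class X) (cover_class Y) m & ~ lat_rfd m],
      exists (K : Type) (X : K -> cstar_cover R),
        [/\ inhabited K,
            (forall k, rfd (X k)),
            (forall k l, lat_le (cover_class (X k)) (cover_class (X l)) \/
                         lat_le (cover_class (X l)) (cover_class (X k))),
            injective (fun k => cover_class (X k)) &
            exists2 m, is_meet (fun k => cover_class (X k)) m & ~ lat_rfd m],
      ~ sublattice (@lat_rfd R) &
      ~ meet_closed (@lat_rfd R)].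
Proof.
have meet_not_closed : ~ meet_closed (@lat_rfd R).
  move=> closed; apply: (@not_rfd_compact R).
  apply: closed (@even_odd_meet R).
    by exists (tail_cover R (fun n => ~~ odd n)); [exact: cover_equiv_refl | exact: rfd_even].
  by exists (tail_cover R odd); [exact: cover_equiv_refl | exact: rfd_odd].
split => //; last by case.
  exists (tail_cover R (fun n => ~~ odd n)), (tail_cover R odd); split.
  - exact: rfd_even.
  - exact: rfd_odd.
  - by exists (cover_class (tail_cover R pred0)); [exact: even_odd_meet | exact: not_rfd_compact].
exists (first_occ R), (fun k => tail_cover R (leq (sval k))); split.
- by have [k _] := first_occ_ex R 0; exists.
- by move=> k; apply: rfd_tail => N; exists (maxn N (sval k)); rewrite ?leq_maxl ?leq_maxr.
- move=> k l; case: (leqP (sval k) (sval l)) => [kl|/ltnW lk]; [right|left];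
    by apply/lat_leP/tail_cover_le => n; exact: leq_trans.
- exact: first_occ_inj.
exists (cover_class (tail_cover R pred0)); last exact: not_rfd_compact.
apply: (is_meet_cover (X := fun k : first_occ R => tail_cover R (leq (sval k)))) => // [k|Y h].
  exact: tail_cover_le.
apply: chain_glb => n; have [k kn] := first_occ_ex R n.
by apply/lat_leP; rewrite -[cover_class (tail_cover _ _)]/(tail_class R n) -kn; apply/lat_leP.
Qed.
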